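(* Let $\nu\in\mathbb R$ with $|\nu|\neq1$. Let $s,s'\in\mathbb R$ be such that $s\ge0$, $-\frac12\le s'$ and $s-1<s'$. Then for all $b,b',c\in\mathbb R$ such that $\frac12<b$, $\frac12<b'$ and $$\tfrac12<c<\min\left\{\tfrac34,\ \tfrac{s'-s}2+1\right\},$$ there is a constant $C>0$ (depending only on $\nu,s,s',b,b',c$) such that $$\|uv\|_{X^{s,c-1}}\le C\,\|u\|_{X^{s,b}}\|v\|_{Y^{s',b'}}\qquad\text{for all }u\in X^{s,b},\ v\in Y^{s',b'}.$$
   Context: Write $\langle\cdot\rangle=\sqrt{1+|\cdot|^2}$ and let $\widehat f(\tau,\xi)=\iint e^{-2\pi i(t\tau+x\xi)}f(t,x)\,dt\,dx$ be the space-time Fourier transform of complex-valued functions on $\mathbb R^2$ (variables $(t,x)$). For $s,a,s',b'\in\mathbb R$, the Bourgain spaces $X^{s,a}$ and $Y^{s',b'}=Y^{s',b'}_\nu$ are the completions of the Schwartz class $\mathcal S(\mathbb R^2)$ under the norms $$\|f\|_{X^{s,a}}=\|\langle\xi\rangle^s\langle\tau+\xi^2\rangle^a\widehat f(\tau,\xi)\|_{L^2_{\tau,\xi}},\qquad \|g\|_{Y^{s',b'}}=\|\langle\xi\rangle^{s'}\langle\tau+\nu|\xi|\xi\rangle^{b'}\widehat g(\tau,\xi)\|_{L^2_{\tau,\xi}} .$$ As usual, the estimate is the one for Schwartz functions $u,v$, and for general elements of the completions the product $uv$ is understood as the resulting continuous extension. *)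

(* Defs.v *)
From HB Require Import structures.
From mathcomp Require Import all_boot all_order all_algebra.
From mathcomp Require Import complex.
From mathcomp Require Import all_classical all_reals all_analysis.

Set Implicit Arguments.
Unset Strict Implicit.
Unset Printing Implicit Defensive.
Import Order.TTheory GRing.Theory Num.Theory.
Import numFieldNormedType.Exports.

Local Open Scope classical_set_scope.
Local Open Scope ring_scope.
Local Open Scope complex_scope.

Section schwartz_class.
Context {R : realType}.

(* Iterated partial derivatives of a real-valued function of [(t, x)] along a
   word of coordinate directions: [false] stands for d/dt, [true] for d/dx. *)
Fixpoint iter_partial (w : seq bool) (g : R * R -> R) : R * R -> R :=
  if w is d :: w' then
    fun p => 'D_(if d then (0, 1) else (1, 0)) (iter_partial w' g) p
  else g.

Definition smooth (g : R * R -> R) : Prop :=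
  forall (w : seq bool) (p : R * R), differentiable (iter_partial w g) p.

Definition rapidly_decreasing (g : R * R -> R) : Prop :=
  forall (w : seq bool) (j k : nat), exists M : R, forall p : R * R,
    `|p.1| ^+ j * `|p.2| ^+ k * `|iter_partial w g p| <= M.

Definition real_schwartz (g : R * R -> R) : Prop :=
  smooth g /\ rapidly_decreasing g.

Definition schwartz (f : R * R -> R[i]) : Prop :=
  real_schwartz (fun p => complex.Re (f p)) /\ real_schwartz (fun p => complex.Im (f p)).

End schwartz_class.

Section fourier_transform.
Context {R : realType}.

Definition lebesgue2 := (@lebesgue_measure R \x @lebesgue_measure R)%E.

Definition cintegral2 (F : R * R -> R[i]) : R[i] :=
  (\int[lebesgue2]_p complex.Re (F p)) +i* (\int[lebesgue2]_p complex.Im (F p)).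

Definition expi (y : R) : R[i] := cos y +i* sin y.

Definition fourier (f : R * R -> R[i]) (q : R * R) : R[i] :=
  cintegral2 (fun p => expi (- (2 * pi * (p.1 * q.1 + p.2 * q.2))) * f p).

End fourier_transform.

Section bourgain_norms.
Context {R : realType}.

Definition japanese (y : R) : R := Num.sqrt (1 + `|y| ^+ 2).

(* The frequency variable is [q = (tau, xi)].  The norms are extended reals;
   they are finite on the Schwartz class. *)
Definition normX (s a : R) (f : R * R -> R[i]) : \bar R :=
  Lnorm lebesgue2 2%:E (fun q => (japanese q.2 `^ s
     * japanese (q.1 + q.2 ^+ 2) `^ a
     * ComplexField.Normc.normc (fourier f q))%:E).

Definition normY (nu s' b' : R) (g : R * R -> R[i]) : \bar R :=
  Lnorm lebesgue2 2%:E (fun q => (japanese q.2 `^ s'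
     * japanese (q.1 + nu * `|q.2| * q.2) `^ b'
     * ComplexField.Normc.normc (fourier g q))%:E).

End bourgain_norms.

Section completions.
Context {R : realType}.
Implicit Type N : (R * R -> R[i]) -> \bar R.

(* The completion of the Schwartz class under [N]: an element is given by a
   Cauchy sequence of Schwartz functions.  Two sequences at distance [0]
   represent the same element; instead of passing to the quotient, the notions
   below depend only on the element represented. *)
Record completion N := Completion {
  cseq :> nat -> R * R -> R[i] ;
  cseq_schwartz : forall n, schwartz (cseq n) ;
  cseq_cauchy : forall e : R, 0 < e -> exists n0 : nat, forall m n : nat,
    (n0 <= m)%N -> (n0 <= n)%N ->
    (N (fun p => cseq m p - cseq n p)%R < e%:E)%E }.

Definition completion_norm N (x : completion N) : \bar R :=
  limn (fun n => N (x n)).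

(* [f n], viewed as an element of the completion, tends to [x]: the inner
   limit is the distance from [f n] to [x]. *)
Definition tends_in_completion N (f : nat -> R * R -> R[i])
    (x : completion N) : Prop :=
  (fun n => limn (fun m => N (fun p => f n p - x m p)%R)) @ \oo --> 0%E.

(* [w] is the value at [(u, v)] of the extension by continuity of the
   pointwise product of Schwartz functions. *)
Definition is_product N1 N2 N3
    (u : completion N1) (v : completion N2) (w : completion N3) : Prop :=
  forall f g : nat -> R * R -> R[i],
    (forall n, schwartz (f n)) -> (forall n, schwartz (g n)) ->
    tends_in_completion f u -> tends_in_completion g v ->
    tends_in_completion (fun n p => f n p * g n p) w.

End completions.

(* Main.v *)
Require Import Defs.
From HB Require Import structures.
From mathcomp Require Import all_boot all_order all_algebra.
From mathcomp Require Import complex ring lra.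
From mathcomp Require Import all_classical all_reals all_analysis measurable_realfun.

(** Write [s = tau + xi ^ 2], [s1 = tau1 + nu |xi1| xi1] and
    [s2 = (tau - tau1) + (xi - xi1) ^ 2] for the modulations of the output, of
    [v] and of [u].  Fourier inversion for [v] bounds the transform of [u v] by
    the convolution of the absolute values of the two transforms, so everything
    rests on a bilinear estimate for nonnegative functions, which follows by
    weighted Young inequalities once the square of the weight quotient is
    dominated by kernels whose integrals over slices are bounded uniformly.
    The resonance identity is [s - s1 - s2 = xi1 (2 xi - xi1 - nu |xi1|)].
    Away from [2 xi = xi1 + nu |xi1|] the largest modulation is at least of the
    order of [xi1 ^ 2], which pays for the possible loss [<xi1> ^ (s - s')]
    since [s - s' <= 2 (1 - c)].  Near that set the derivative
    [2 (nu |xi1| + xi1 - xi)] of [s1 + s2] in [xi1] has size comparable to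
    [|xi1|], because [|nu| <> 1], and serves as a Jacobian.  The Schwartz
    estimate then passes to the completions by bilinearity. *)

Set Implicit Arguments.
Unset Strict Implicit.
Unset Printing Implicit Defensive.
Import Order.TTheory GRing.Theory Num.Theory.
Import numFieldNormedType.Exports.
Local Open Scope classical_set_scope.
Local Open Scope ring_scope.

(** * Lebesgue measure on the plane *)

(** The exponents balance as follows. The weights enter squared, so [b, b' > 1/2] give the inputs a
    common exponent [g > 1], enough for finite slice integrals, while the output brings only
    [t = 2 (1 - c) < 1]. When an input modulation dominates, it therefore hands its exponent [g] to
    the output and keeps [t], which still suffices: the modulation is of order at least [xi1 ^ 2],
    and [2 (s - s') <= 2 t]. Near the resonant set no modulation need be large; there [xi] is
    controlled by [xi - xi1], so [s] costs nothing, and the loss [<xi1> ^ (- 2 s')] is at most the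
    one power that the Jacobian provides, since [s' >= - 1/2]. The three kernels correspond to
    holding the variable of the output, of [v] or of [u] fixed. Inversion is proved by Abel
    summation: the damping [exp (- e |tau| - e |xi|)] makes Fubini applicable, and its transform, a
    product of Poisson kernels, is a rescaled Cauchy density. Both limits then follow by dominated
    convergence, and the integrals involved have elementary antiderivatives. *)

Section lebesgue2_sigma_finite.
Context {R : realType}.

HB.instance Definition _ := Measure.on (@lebesgue2 R).
Lemma sigma_finite_lebesgue2 : sigma_finite setT (@lebesgue2 R).
Proof.
pose I (n : nat) : set (measurableTypeR R) := [set` `[- n%:R, n%:R]%R].
have mI n : measurable (I n) by exact: measurable_itv.
exists (fun n => I n `*` I n).
  apply/seteqP; split => // -[x y] _.
  exists (maxn (Num.truncn `|x|).+1 (Num.truncn `|y|).+1) => //.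
  have B (z : R) m : ((Num.truncn `|z|).+1 <= m)%N -> I m z.
    move=> zm; rewrite /I /= in_itv /= -ler_norml.
    by rewrite (le_trans (ltW (truncnS_gt _))) // ler_nat.
  by split; apply: B; rewrite ?leq_maxl ?leq_maxr.
move=> n; split; first exact: measurableX.
have Ioo : (@lebesgue_measure R (I n) < +oo)%E.
  have := @lebesgue_measure_itv R `[- n%:R, n%:R]%R; rewrite /= => ->.
  by case: ifP => // _; rewrite -EFinD ltry.
by rewrite /lebesgue2 product_measure1E // lte_mul_pinfty // ge0_fin_numE.
Qed.
HB.instance Definition _ := Measure_isSigmaFinite.Build _ _ _ (@lebesgue2 R) sigma_finite_lebesgue2.

End lebesgue2_sigma_finite.

(** * Affine changes of variables *)

Section change_of_variables.
Context {R : realType}.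
Local Notation mu := (@lebesgue_measure R).
Local Open Scope ereal_scope.

Definition affine_map (k a : R) : measurableTypeR R -> measurableTypeR R :=
  fun x => (k * x + a)%R.

Lemma measurable_affine (k a : R) : measurable_fun setT (affine_map k a).
Proof. by apply: measurable_funD => //; apply: measurable_funM. Qed.

Definition affine_pushforward (k a : R) :
  {measure set (measurableTypeR R) -> \bar R}.
Proof.
unshelve refine (pushforward mu (affine_map k a)).
exact: measurable_affine.
Defined.

(** Uniqueness of Lebesgue measure: the rescaled pushforward gives half-open intervals their
    length. *)
Lemma lebesgue_measure_affine (k a : R) (k0 : (0 < k)%R)
    (A : set (measurableTypeR R)) : measurable A ->
  mu A = mscale (NngNum (ltW k0)) (affine_pushforward k a) A.
Proof.
move=> mA; apply: lebesgue_measure_unique => //= _ [[u v]] _ <-.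
rewrite /mscale /= /pushforward /=.
have -> : affine_map k a @^-1` `]u, v] = [set` `](u - a) / k, (v - a) / k]%R].
  apply/seteqP; split => x /=; rewrite !in_itv /= ltr_pdivrMr // ler_pdivlMr // ltrBlDr lerBrDr mulrC => //.
rewrite !lebesgue_measure_itv /= !lte_fin ltr_pM2r ?invr_gt0 // ltrD2r.
case: ifP => // _; last by rewrite mule0.
rewrite -!EFinD -EFinM -mulrBl mulrC divfK ?gt_eqF //.
by congr (_%:E); ring.
Qed.

Lemma ge0_integral_affine (k a : R) (f : R -> \bar R) : (0 < k)%R ->
  measurable_fun setT f -> (forall x, 0 <= f x) ->
  \int[mu]_x f x = k%:E * \int[mu]_x f (k * x + a)%R.
Proof.
move=> k0 mf f0.
transitivity (\int[mscale (NngNum (ltW k0)) (affine_pushforward k a)]_x f x).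
  by apply: eq_measure_integral => A mA _; exact: lebesgue_measure_affine.
rewrite ge0_integral_mscale //=; congr (_ * _).
rewrite (@ge0_integral_pushforward _ _ _ _ _ _ (measurable_affine k a)) //.
Qed.

Lemma ge0_integral_affine2 (k a b : R) (f : R * R -> \bar R) : (0 < k)%R ->
  measurable_fun setT f -> (forall x, 0 <= f x) ->
  \int[lebesgue2]_p f p = (k ^+ 2)%:E * \int[lebesgue2]_p f (k * p.1 + a, k * p.2 + b)%R.
Proof.
move=> k0 mf f0; rewrite /lebesgue2.
have mf' : measurable_fun setT (fun p : R * R => f (k * p.1 + a, k * p.2 + b)%R).
  have h : measurable_fun setT (fun p : R * R => (k * p.1 + a, k * p.2 + b)%R).
    apply: measurable_fun_pair => /=.
      by apply: measurable_funD => //; apply: measurable_funM.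
    by apply: measurable_funD => //; apply: measurable_funM.
  exact: (measurableT_comp mf h).
rewrite fubini_tonelli1 // fubini_tonelli1 //= /fubini_F /=.
rewrite (ge0_integral_affine a k0); last 2 first.
- exact: (@measurable_fun_fubini_tonelli_F _ _ _ _ _ mu f mf f0).
- by move=> x; apply: integral_ge0.
rewrite expr2 EFinM -muleA; congr (_ * _).
rewrite -ge0_integralZl //; last 3 first.
- exact: (@measurable_fun_fubini_tonelli_F _ _ _ _ _ mu _ mf').
- by move=> x _; apply: integral_ge0.
- by rewrite lee_fin ltW.
apply: eq_integral => x _.
rewrite (ge0_integral_affine b k0) //.
by apply: (measurableT_comp mf); apply: measurable_fun_pair.
Qed.

Lemma integral_affine2 (k a b : R) (f : R * R -> \bar R) : (0 < k)%R ->
  lebesgue2.-integrable setT f ->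
  \int[lebesgue2]_p f p = (k ^+ 2)%:E * \int[lebesgue2]_p f (k * p.1 + a, k * p.2 + b)%R.
Proof.
move=> k0 intf; have mf := measurable_int _ intf.
rewrite integralE [X in _ = _ * X]integralE.
rewrite (ge0_integral_affine2 a b k0) //; last exact: measurable_funepos.
rewrite [X in _ - X](ge0_integral_affine2 a b k0) //; last exact: measurable_funeneg.
have -> : (fun p : R * R => f (k * p.1 + a, k * p.2 + b)%R)^\+ = fun p => f^\+ (k * p.1 + a, k * p.2 + b)%R by rewrite !funepos.unlock.
have -> : (fun p : R * R => f (k * p.1 + a, k * p.2 + b)%R)^\- = fun p => f^\- (k * p.1 + a, k * p.2 + b)%R by rewrite !funeneg.unlock.
set A := \int[lebesgue2]_p f^\+ _; set B := \int[lebesgue2]_p f^\- _.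
(* The factor distributes over the difference of the two parts once one of them is finite; this is
   read off from the integral of the negative part of [f], which equals [k ^ 2 * B]. *)
suff Bfin : B \is a fin_num by rewrite (@muleBr _ _ A B) // fin_num_adde_defl // fin_numN.
have : (k ^+ 2)%:E * B \is a fin_num.
  rewrite -(ge0_integral_affine2 a b k0) //; last exact: measurable_funeneg.
  exact: integrable_neg_fin_num.
have : (0 < k ^+ 2)%R by rewrite exprn_gt0.
by case: B => //= k2; rewrite (gt0_muley, gt0_muleNy).
Qed.

End change_of_variables.

(** * Measurability of continuous functions on the plane *)

Section continuous_measurable.
Context {R : realType}.

(** An open set of the plane is the countable union of the rational boxes that it contains, hence it
    belongs to the product sigma-algebra. *)
Lemma continuous2_measurable (g : R * R -> R) : continuous g -> measurable_fun setT g.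
Proof.
move=> cg; apply: (measurability _ (RGenOInfty.measurableE R)) => //.
move=> _ [_ [a ->]] <-; rewrite setTI.
have oU : open (g @^-1` `]a, +oo[).
  by apply: open_comp => // p _; exact: cg.
set U := _ @^-1` _ in oU *.
pose box (q1 q2 e : rat) : set (R * R) :=
  `]ratr q1 - ratr e, ratr q1 + ratr e[%classic `*` `]ratr q2 - ratr e, ratr q2 + ratr e[%classic.
have -> : U = \bigcup_(q1 : rat) \bigcup_(q2 : rat) \bigcup_(e : rat)
   (if `[< box q1 q2 e `<=` U >] then box q1 q2 e else set0).
  apply/seteqP; split; last first.
    by move=> p [q1 _] [q2 _] [e _]; case: ifP => // /asboolP; exact.
  move=> p Up.
  have /nbhs_ballP[d /= d0 dU] : nbhs p U by exact: open_nbhs_nbhs.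
  have [e] := rat_in_itvoo (divr_gt0 d0 (ltr0n _ 4)); rewrite in_itv/= => /andP[e0 ed].
  have e0' : 0 < ratr e :> R by [].
  have [q1] := @rat_in_itvoo R (p.1 - ratr e) (p.1 + ratr e) ltac:(lra).
  rewrite in_itv/= => /andP[q1l q1r].
  have [q2] := @rat_in_itvoo R (p.2 - ratr e) (p.2 + ratr e) ltac:(lra).
  rewrite in_itv/= => /andP[q2l q2r].
  exists q1 => //; exists q2 => //; exists e => //.
  rewrite asboolT; first by split; rewrite /= in_itv/=; apply/andP; split; lra.
  move=> [x y] [/=]; rewrite !in_itv/= => /andP[x1 x2] /andP[y1 y2].
  apply: dU; split; rewrite /ball /= ltr_norml; apply/andP; split; lra.
apply: bigcupT_measurable_rat => q1; apply: bigcupT_measurable_rat => q2.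
apply: bigcupT_measurable_rat => e; case: ifP => // _.
by apply: measurableX.
Qed.

End continuous_measurable.

(** * Japanese brackets *)

(** Follows the syntax of the function. Measurability of named functions is taken from the context,
    which is why the proofs below first bring such facts there. *)
Ltac meas_step :=
  match goal with
  | H : measurable_fun _ ?f |- measurable_fun _ ?f => exact: H
  | |- measurable_fun _ (fun x => x) => exact: measurable_id
  | |- measurable_fun _ (fun _ => ?c) => exact: measurable_cst
  | |- measurable_fun _ fst => exact: measurable_fst
  | |- measurable_fun _ snd => exact: measurable_snd
  | |- measurable_fun _ (fun x => ((@?f x)%:E)%E) => apply/(measurable_EFinP _ f)
  | |- measurable_fun _ (EFin \o ?f) => apply/(measurable_EFinP _ f)
  | |- measurable_fun _ (fun x => ((@?f x) - (@?g x))%R) => apply: (@measurable_funB _ _ _ _ f g)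
  | |- measurable_fun _ (fun x => ((@?f x) + (@?g x))%R) => apply: (@measurable_funD _ _ _ _ f g)
  | |- measurable_fun _ (fun x => ((@?f x) * (@?g x))%R) => apply: (@measurable_funM _ _ _ _ f g)
  | |- measurable_fun _ (fun x => (- (@?f x))%R) => apply: (@measurable_funN _ _ _ _ f)
  | |- measurable_fun _ (fun x => ((@?f x) ^+ ?n)%R) => apply: (@measurable_funX _ _ _ _ f n)
  | |- measurable_fun _ (fun x => ((@?f x) `^ ?n)%R) => apply: (@measurableT_comp _ _ _ _ _ _ (fun y => y `^ n) _ f (measurable_powR _))
  | |- measurable_fun _ (fun x => @Num.norm ?K ?V (@?f x)) => apply: (@measurableT_comp _ _ _ _ _ _ (@Num.norm K V) _ f (@normr_measurable _ _))
  | |- measurable_fun _ (fun x => (@?f x, @?g x)) => apply: (@measurable_fun_pair _ _ _ _ _ _ f g)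
  | |- measurable_fun _ (fun x => (@?f x).1) => apply: (@measurableT_comp _ _ _ _ _ _ fst _ f measurable_fst)
  | |- measurable_fun _ (fun x => (@?f x).2) => apply: (@measurableT_comp _ _ _ _ _ _ snd _ f measurable_snd)
  | |- measurable_fun _ (fun x => ((@?f x) + (@?g x))%E) => apply: (@emeasurable_funD _ _ _ _ f g)
  | |- measurable_fun _ (fun x => ((@?f x) * (@?g x))%E) => apply: (@emeasurable_funM _ _ _ _ f g)
  | |- measurable_fun _ (fun x => @indic _ _ ?A x) => apply: measurable_indic
  | H : measurable_fun _ ?h |- measurable_fun _ (fun x => ?h (@?f x)) => apply: (@measurableT_comp _ _ _ _ _ _ h _ f H)
  end.
Ltac meas := repeat meas_step.

Section ge0_integral_EFin.
Context d (T : measurableType d) (R : realType) (mu : {measure set T -> \bar R}).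
Implicit Types f g : T -> R.
Local Open Scope ereal_scope.

Lemma ge0_integral_EFinZl (c : R) f : (0 <= c)%R -> measurable_fun setT f ->
  (forall x, 0 <= f x)%R -> \int[mu]_x (c * f x)%:E = c%:E * \int[mu]_x (f x)%:E.
Proof.
move=> c0 mf f0; under eq_integral do rewrite EFinM.
by rewrite ge0_integralZl //; [exact/measurable_EFinP | move=> x _; rewrite lee_fin].
Qed.

Lemma ge0_integral_EFinD f g : measurable_fun setT f -> measurable_fun setT g ->
  (forall x, 0 <= f x)%R -> (forall x, 0 <= g x)%R ->
  \int[mu]_x (f x + g x)%:E = \int[mu]_x (f x)%:E + \int[mu]_x (g x)%:E.
Proof.
move=> mf mg f0 g0; under eq_integral do rewrite EFinD.
by rewrite ge0_integralD //; (try exact/measurable_EFinP); move=> x _; rewrite lee_fin.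
Qed.

Lemma ge0_le_integral_EFin f g : measurable_fun setT f -> measurable_fun setT g ->
  (forall x, 0 <= f x)%R -> (forall x, f x <= g x)%R ->
  \int[mu]_x (f x)%:E <= \int[mu]_x (g x)%:E.
Proof.
move=> mf mg f0 fg; apply: ge0_le_integral => //.
- by move=> x _; rewrite lee_fin.
- exact/measurable_EFinP.
- exact/measurable_EFinP.
- by move=> x _; rewrite lee_fin.
Qed.

End ge0_integral_EFin.

Section japanese_bracket.
Context {R : realType}.
Implicit Types x y g : R.
Local Notation j := (@japanese R).

Lemma japanese_sqr x : j x ^+ 2 = 1 + x ^+ 2.
Proof. by rewrite /japanese sqr_sqrtr ?real_normK ?num_real // addr_ge0 ?sqr_ge0. Qed.

Lemma japanese_ge0 x : 0 <= j x. Proof. exact: sqrtr_ge0. Qed.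

Lemma japanese_ge1 x : 1 <= j x.
Proof.
rewrite -(ler_pXn2r (ltn0Sn 1)) ?nnegrE ?japanese_ge0 // japanese_sqr expr1n.
by rewrite lerDl sqr_ge0.
Qed.

Lemma japanese_gt0 x : 0 < j x. Proof. exact: lt_le_trans (japanese_ge1 x). Qed.
Hint Resolve japanese_ge0 japanese_ge1 japanese_gt0 : core.

Lemma japaneseN x : j (- x) = j x. Proof. by rewrite /japanese normrN. Qed.

Lemma le_japanese x y : `|x| <= `|y| -> j x <= j y.
Proof. by move=> xy; apply: ler_wsqrtr; rewrite lerD2l ler_sqr ?nnegrE. Qed.

Lemma norm_le_japanese x : `|x| <= j x.
Proof.
rewrite -(ler_pXn2r (ltn0Sn 1)) ?nnegrE ?japanese_ge0 // japanese_sqr.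
by rewrite real_normK ?num_real // lerDr.
Qed.

Lemma japanese_le1D x : j x <= 1 + `|x|.
Proof.
rewrite -(ler_pXn2r (ltn0Sn 1)) ?nnegrE ?japanese_ge0 ?addr_ge0 // japanese_sqr.
by rewrite sqrrD real_normK ?num_real // expr1n mul1r lerD2r lerDl mulrn_wge0.
Qed.

Lemma japaneseD x y : j (x + y) <= j x + j y.
Proof.
rewrite -(ler_pXn2r (ltn0Sn 1)) ?nnegrE ?japanese_ge0 ?addr_ge0 // sqrrD !japanese_sqr.
suff : x * y <= j x * j y by nra.
by apply: (le_trans (ler_norm _)); rewrite normrM ler_pM ?norm_le_japanese.
Qed.

Lemma japaneseM_ge x y : j (x + y) <= 2 * j x * j y.
Proof.
have := japaneseD x y; have := japanese_ge1 x; have := japanese_ge1 y; nra.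
Qed.

Lemma measurable_japanese : measurable_fun setT j.
Proof.
have mf : measurable_fun setT (fun x : R => 1 + `|x| ^+ 2) by meas.
exact: (measurableT_comp (continuous_measurable_fun (@sqrt_continuous R)) mf).
Qed.

Definition jweight (g x : R) : R := j x `^ (- g).
Local Notation h := jweight.

Lemma measurable_jweight g : measurable_fun setT (h g).
Proof. have := measurable_japanese => mj; rewrite /jweight; by meas. Qed.

Lemma jweight_ge0 g x : 0 <= h g x. Proof. exact: powR_ge0. Qed.
Lemma jweight_gt0 g x : 0 < h g x. Proof. by rewrite powR_gt0. Qed.

Lemma jweightN g x : h g (- x) = h g x. Proof. by rewrite /jweight japaneseN. Qed.

Lemma jweight_le1 g x : 0 <= g -> h g x <= 1.
Proof.
move=> g0; rewrite /jweight -(powRr0 (j x)); apply: ler_powR => //.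
by rewrite oppr_le0.
Qed.

Lemma le_jweight g k x y : 0 <= g -> 0 < k -> j y <= k * j x -> h g x <= k `^ g * h g y.
Proof.
move=> g0 k0 yx; rewrite /jweight !powRN ler_pdivlMr ?powR_gt0 // mulrC.
rewrite ler_pdivrMr ?powR_gt0 // -powRM ?(ltW k0) //.
by rewrite ge0_ler_powR // nnegrE ?mulr_ge0 // ?(ltW k0).
Qed.

(** The larger of the two brackets is at least half of the bracket of [x + y], so its weight is at
    most [2 ^ g] times the weight at [x + y]; the other weight is bounded by the sum. *)
Lemma jweight_conv g x y : 0 <= g ->
  h g x * h g y <= 2 `^ g * h g (x + y) * (h g x + h g y).
Proof.
move=> g0; have xy := japaneseD x y.
have aux (a b K : R) : 0 <= a -> 0 <= b -> 0 <= K -> a <= K -> a * b <= K * (a + b).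
  by move=> a0 b0 K0 aK; apply: (le_trans (ler_wpM2r b0 aK)); rewrite ler_wpM2l // lerDr.
have k2 : 0 <= 2 `^ g * h g (x + y) by rewrite mulr_ge0 ?powR_ge0.
have [yx|xy'] := leP (j y) (j x).
  have H : h g x <= 2 `^ g * h g (x + y).
    by apply: le_jweight => //; apply: (le_trans xy); rewrite mulrDl mul1r lerD2l.
  exact: (aux _ _ _ (jweight_ge0 g x) (jweight_ge0 g y) k2 H).
have H : h g y <= 2 `^ g * h g (x + y).
  by apply: le_jweight => //; apply: (le_trans xy); rewrite mulrDl mul1r lerD2r ltW.
by rewrite mulrC [h g x + _]addrC; exact: (aux _ _ _ (jweight_ge0 g y) (jweight_ge0 g x) k2 H).
Qed.

End japanese_bracket.
#[global] Hint Extern 0 (is_true (0 <= japanese _)) => exact: japanese_ge0 : core.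
#[global] Hint Extern 0 (is_true (1 <= japanese _)) => exact: japanese_ge1 : core.
#[global] Hint Extern 0 (is_true (0 < japanese _)) => exact: japanese_gt0 : core.
#[global] Hint Extern 0 (is_true (0 <= jweight _ _)) => exact: jweight_ge0 : core.
#[global] Hint Extern 0 (is_true (0 < jweight _ _)) => exact: jweight_gt0 : core.

(** * Dyadic decomposition of the weights *)

Section dyadic.
Context {R : realType}.
Local Notation mu := (@lebesgue_measure R).
Local Notation h := (@jweight R).

Lemma jweight_dyadic (g x : R) : 0 <= g -> exists k : nat,
  `|x| <= 2 ^+ k /\ h g x <= 2 `^ g * (2 `^ (- g)) ^+ k.
Proof.
move=> g0.
have exk : exists k : nat, `|x| <= 2 ^+ k.
  exists (Num.truncn `|x|).+1; apply: (le_trans (ltW (truncnS_gt _))).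
  by rewrite -natrX ler_nat ltnW // ltn_expl.
(* For the least [k], if positive, minimality gives [2 ^ (k - 1) < |x|] and so a lower bound on the
   bracket; for [k = 0] the weight is simply at most [1]. *)
case: (ex_minnP exk) => -[|k] xk kmin; [exists 0%N|exists k.+1]; split=> //.
  rewrite expr0 mulr1 (le_trans (jweight_le1 _ g0)) //.
  by rewrite -[leLHS](powRr0 2); apply: ler_powR => //; lra.
have k2 : (2 ^+ k : R) < `|x|.
  by rewrite ltNge; apply/negP => /kmin; rewrite ltnn.
rewrite -powR_mulrn ?powR_ge0 // -powRrM -powRD; last by apply/implyP => _; lra.
rewrite -natr1 (_ : g + _ = k%:R * - g); last by ring.
rewrite powRrM powR_mulrn // /jweight !powRN lef_pV2 ?posrE ?powR_gt0 ?exprn_gt0 //.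
apply: ge0_ler_powR => //; rewrite ?nnegrE ?exprn_ge0 //.
exact: (le_trans (ltW k2) (norm_le_japanese x)).
Qed.

Local Open Scope ereal_scope.

(** Cut at the levels [|Q| <= 2 ^ k]: the weight contributes [2 ^ (- g k)] and the sublevel bound
    [B 2 ^ k], so the levels sum to a geometric series of ratio [2 ^ (1 - g) < 1]. The constant
    depends on [g] alone, which makes the bounds below uniform in the lower coefficients of [Q]. *)
Lemma integral_jweight_dyadic (g : R) : (1 < g)%R -> exists2 C : R, (0 < C)%R &
  forall (w Q : R -> R) (B : R), measurable_fun setT w -> measurable_fun setT Q ->
    (forall x, 0 <= w x)%R ->
    (forall M : R, (1 <= M)%R ->
       \int[mu]_x (w x * \1_[set y | (`|Q y| <= M)%R] x)%:E <= (B * M)%:E) ->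
    \int[mu]_x (w x * h g (Q x))%:E <= (C * B)%:E.
Proof.
move=> g1; pose q : R := (2 `^ (1 - g))%R.
have q0 : (0 < q)%R by rewrite powR_gt0.
have q1 : (q < 1)%R.
  by rewrite -[ltRHS](powRr0 2) /q /powR !gt_eqF // ltr_expR ltr_pM2r ?ln_gt0 ?ltr1n //; lra.
have g0 : (0 <= g)%R by lra.
exists (2 `^ g / (1 - q))%R; first by rewrite divr_gt0 ?powR_gt0 ?subr_gt0.
move=> w Q B mw mQ w0 wQ.
have mS (M : R) : measurable [set y | (`|Q y| <= M)%R].
  rewrite (_ : [set y | _] = (fun y => `|Q y|%R) @^-1` [set` `]-oo, M]%R]); last first.
    by apply/seteqP; split => y /=; rewrite in_itv.
  rewrite -[X in measurable X]setTI.
  have mQ' : measurable_fun setT (fun y => `|Q y|%R) by meas.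
  exact: mQ'.
pose f k x := (2 `^ g * (2 `^ (- g)) ^+ k * (w x * \1_[set y | (`|Q y| <= 2 ^+ k)%R] x))%R.
have f0 k x : (0 <= f k x)%R by rewrite !mulr_ge0 ?exprn_ge0 ?powR_ge0 // indicE.
have mind k : measurable_fun setT (fun x => (w x * \1_[set y | (`|Q y| <= 2 ^+ k)%R] x)%R).
  by apply: measurable_funM => //; exact: measurable_indic.
have mf k : measurable_fun setT (fun x => (f k x)%:E).
  by rewrite /f; meas.
have mh := @measurable_jweight R g.
apply: (@le_trans _ _ (\int[mu]_x \sum_(0 <= k <oo) (f k x)%:E)).
  apply: ge0_le_integral => //.
  - by move=> x _; rewrite lee_fin mulr_ge0.
  - by meas.
  - apply: (@ge0_emeasurable_sum _ _ _ setT (fun k x => (f k x)%:E) xpredT) => [k x _ _|k _]; last exact: mf.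
    by rewrite lee_fin.
  move=> x _; have [k [xk hk]] := jweight_dyadic (Q x) g0.
  apply: (@le_trans _ _ (f k x)%:E).
    rewrite lee_fin /f indicE mem_set // mulr1 mulrC.
    by rewrite ler_wpM2r.
  apply: le_trans (nneseries_lim_ge k.+1 _); last by move=> n _ _; rewrite lee_fin.
  rewrite big_nat_recr //= leeDr // sume_ge0 // => i _.
  by rewrite lee_fin.
rewrite integral_nneseries //; last by move=> n x _; rewrite lee_fin.
have step k : \int[mu]_x (f k x)%:E <= (2 `^ g * B * q ^+ k)%:E.
  rewrite /f; under eq_integral do rewrite EFinM.
  rewrite ge0_integralZl //; last 2 first.
  - by meas; exact: mS.
  - by move=> x _; rewrite lee_fin mulr_ge0 // indicE.
  apply: (@le_trans _ _ ((2 `^ g * (2 `^ (- g)) ^+ k)%:E * (B * 2 ^+ k)%:E)).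
    rewrite lee_pmul2l // ?lte_fin ?mulr_gt0 ?exprn_gt0 ?powR_gt0 //.
    by apply: wQ; rewrite exprn_ege1 // ler1n.
  rewrite -EFinM lee_fin /q powRD; last by apply/implyP => _; lra.
  rewrite powRr1 // exprMn le_eqVlt; apply/orP; left; apply/eqP; ring.
apply: lime_le.
  by apply: is_cvg_nneseries => k _ _; apply: integral_ge0 => x _; rewrite lee_fin.
apply: nearW => n.
apply: (@le_trans _ _ (\sum_(0 <= k < n) (2 `^ g * B * q ^+ k)%:E)).
  by apply: lee_sum => k _; exact: step.
rewrite sumEFin lee_fin -mulr_sumr.
(* The sign of [B] comes from the sublevel bound at [M = 1]. *)
have B0 : (0 <= B)%R.
  rewrite -lee_fin -[B]mulr1; apply: (le_trans _ (wQ 1%R (lexx _))).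
  by apply: integral_ge0 => x _; rewrite lee_fin mulr_ge0 // indicE.
rewrite (_ : 2 `^ g / (1 - q) * B = 2 `^ g * B * (1 - q)^-1)%R; last by ring.
rewrite ler_wpM2l ?mulr_ge0 ?powR_ge0 //.
have qn : (`|q| < 1)%R by rewrite gtr0_norm.
have := @geometric_le_lim R n 1 q ler01 q0 qn; rewrite div1r; apply: le_trans.
rewrite /series /geometric /=.
by under [leRHS]eq_bigr do rewrite mul1r.
Qed.

End dyadic.

(** * Weighted integrals over the line *)

Section one_dimensional_integrals.
Context {R : realType}.
Local Notation mu := (@lebesgue_measure R).
Local Notation h := (@jweight R).
Local Open Scope ereal_scope.

(** Two intervals cover a sublevel set of a quadratic polynomial; in the affine case they
    coincide. *)
Lemma integral_le_two_itv (f : R -> R) (c a1 b1 a2 b2 : R) :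
  measurable_fun setT f -> (forall x, 0 <= f x)%R -> (0 <= c)%R ->
  (a1 <= b1)%R -> (a2 <= b2)%R ->
  (forall x, f x <= c * (\1_[set` `[a1, b1]%R] x + \1_[set` `[a2, b2]%R] x))%R ->
  \int[mu]_x (f x)%:E <= (c * ((b1 - a1) + (b2 - a2)))%:E.
Proof.
move=> mf f0 c0 ab1 ab2 fc.
have m1 : measurable_fun setT (\1_[set` `[a1, b1]%R] : R -> R) by apply: measurable_indic.
have m2 : measurable_fun setT (\1_[set` `[a2, b2]%R] : R -> R) by apply: measurable_indic.
have E (a b : R) : (a <= b)%R -> \int[mu]_x (\1_[set` `[a, b]%R] x)%:E = (b - a)%:E.
  move=> ab; rewrite integral_indic // setIT.
  have := @lebesgue_measure_itv R `[a, b]%R; rewrite /= lte_fin => ->.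
  case: ltP => // ba; have -> : a = b by apply/eqP; rewrite eq_le ab.
  by rewrite subrr.
apply: (@le_trans _ _ (\int[mu]_x (c * (\1_[set` `[a1, b1]%R] x + \1_[set` `[a2, b2]%R] x))%:E)).
  by apply: ge0_le_integral_EFin => //; meas.
rewrite ge0_integral_EFinZl; [|by []|by meas|by move=> x; rewrite addr_ge0 // indicE].
rewrite ge0_integral_EFinD; [|by meas|by meas|by move=> x; rewrite indicE|by move=> x; rewrite indicE].
by rewrite !E // -EFinD -EFinM.
Qed.

Lemma measurable_sublevel (Q : R -> R) (M : R) : measurable_fun setT Q ->
  measurable [set y | (`|Q y| <= M)%R].
Proof.
move=> mQ; rewrite (_ : [set y | _] = (fun y => `|Q y|%R) @^-1` [set` `]-oo, M]%R]); last first.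
  by apply/seteqP; split => y /=; rewrite in_itv.
rewrite -[X in measurable X]setTI.
have mQ' : measurable_fun setT (fun y => `|Q y|%R) by meas.
exact: mQ'.
Qed.

(* On the sublevel set [x] lies in the two intervals where
   [p1 <= |x - x0| <= p2]; there [|Q'|] is at most [2 |a| p2], and
   [p2 (p2 - p1) <= p2 ^ 2 - p1 ^ 2 <= 2 M / |a|]. *)
Lemma integral_quadratic_sublevel (a be de M : R) : (a != 0)%R -> (1 <= M)%R ->
  \int[mu]_x ((1 + `|2 * a * x + be|)
     * \1_[set y | (`|a * y ^+ 2 + be * y + de| <= M)%R] x)%:E
  <= ((10 + 4 / `|a|) * M)%:E.
Proof.
move=> a0 M1.
have aa0 : (0 < `|a|)%R by rewrite normr_gt0.
(* Completing the square at the vertex [x0]: the sublevel condition becomes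
   [|(x - x0) ^ 2 + e| <= N]. *)
pose x0 := (- be / (2 * a))%R; pose e := (de / a - x0 ^+ 2)%R; pose N := (M / `|a|)%R.
have N0 : (0 < N)%R by rewrite divr_gt0 //; lra.
have QE x : (a * x ^+ 2 + be * x + de = a * ((x - x0) ^+ 2 + e))%R.
  by rewrite /e /x0; field.
have Q'E x : (2 * a * x + be = 2 * a * (x - x0))%R by rewrite /x0; field.
(* The maxima with [0] cover the cases where a bound for [(x - x0) ^ 2] is negative. *)
pose p1 := Num.sqrt (Num.max 0 (- e - N))%R; pose p2 := Num.sqrt (Num.max 0 (N - e))%R.
have p10 : (0 <= p1)%R by exact: sqrtr_ge0.
have p20 : (0 <= p2)%R by exact: sqrtr_ge0.
have p1E : (p1 ^+ 2 = Num.max 0 (- e - N))%R by rewrite sqr_sqrtr // le_max lexx.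
have p2E : (p2 ^+ 2 = Num.max 0 (N - e))%R by rewrite sqr_sqrtr // le_max lexx.
have p12 : (p1 <= p2)%R by apply: ler_wsqrtr; rewrite /Num.max; (case: ltP => ?; case: ltP => ?; lra).
have dp : (p2 ^+ 2 - p1 ^+ 2 <= 2 * N)%R by rewrite p1E p2E /Num.max; (case: ltP => ?; case: ltP => ?; lra).
have aN : (`|a| * N = M)%R by rewrite /N mulrC divfK // gt_eqF.
apply: (@le_trans _ _ ((1 + 2 * `|a| * p2) * ((x0 + p2 - (x0 + p1)) + (x0 - p1 - (x0 - p2))))%:E).
  apply: integral_le_two_itv; [| | by rewrite addr_ge0 // !mulr_ge0 // | by lra | by lra | ].
  - meas; apply: measurable_sublevel; by meas.
  - by move=> x; rewrite mulr_ge0 ?addr_ge0 // indicE.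
  move=> x; rewrite [X in (_ * X <= _)%R]indicE.
  have [/set_mem /= xS|_] := boolP (x \in _); last first.
    by rewrite mulr0 mulr_ge0 ?addr_ge0 // ?indicE // !mulr_ge0.
  rewrite mulr1 Q'E !normrM (@ger0_norm _ 2) //.
  move: xS; rewrite QE normrM mulrC -ler_pdivlMr // -/N ler_norml => /andP[yl yr].
  have y2 : (`|x - x0| <= p2)%R.
    rewrite -sqrtr_sqr; apply: ler_wsqrtr; rewrite le_max; apply/orP; right; lra.
  have y1 : (p1 <= `|x - x0|)%R.
    rewrite -sqrtr_sqr; apply: ler_wsqrtr; rewrite ge_max sqr_ge0 /=; lra.
  have : (1 <= \1_[set` `[(x0 + p1), (x0 + p2)]%R] x + \1_[set` `[(x0 - p2), (x0 - p1)]%R] x :> R)%R.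
    have [xx|xx] := leP x0 x.
      move: y1 y2; rewrite ger0_norm ?subr_ge0 // => y1 y2.
      rewrite [X in (X + _)%R]indicE mem_set ?lerDl ?indicE //= in_itv /=.
      by apply/andP; split; lra.
    move: y1 y2; rewrite ltr0_norm ?subr_lt0 // => y1 y2.
    rewrite [X in (_ + X)%R]indicE mem_set ?lerDr ?indicE //= in_itv /=.
    by apply/andP; split; lra.
  have c0 : (0 <= 2 * `|a| * p2)%R by rewrite !mulr_ge0.
  have : (2 * `|a| * `|x - x0| <= 2 * `|a| * p2)%R by rewrite ler_wpM2l // mulr_ge0.
  nra.
(* The total is [2 (p2 - p1) + 4 |a| p2 (p2 - p1)], at most [2 (1 + 2 N) + 8 M]; since [M >= 1] and
   [N = M / |a|], this is at most [(10 + 4 / |a|) M]. *)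
rewrite lee_fin.
have d0 : (0 <= p2 - p1)%R by lra.
have dd : (p2 * (p2 - p1) <= 2 * N)%R by nra.
have d1 : (p2 - p1 <= 1 + 2 * N)%R by nra.
have da : (`|a| * (p2 * (p2 - p1)) <= `|a| * (2 * N))%R by rewrite ler_wpM2l // ltW.
have NM : (4 / `|a| * M = 4 * N)%R by rewrite /N; ring.
rewrite (mulrDl 10%R) NM; nra.
Qed.

(** The derivative is the Jacobian of the two-to-one substitution by the polynomial, so the bound is
    uniform in [be] and [de]. *)
Lemma integral_jweight_quadratic (g a : R) : (1 < g)%R -> (a != 0)%R ->
  exists2 C : R, (0 < C)%R & forall be de : R,
    \int[mu]_x ((1 + `|2 * a * x + be|) * h g (a * x ^+ 2 + be * x + de))%:E <= C%:E.
Proof.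
move=> g1 a0; have [C C0 HC] := integral_jweight_dyadic g1.
exists (C * (10 + 4 / `|a|))%R => [|be de].
  by rewrite mulr_gt0 // addr_gt0 // divr_gt0 // normr_gt0.
apply: HC; [by meas | by meas | | ].
- by move=> x; rewrite addr_ge0.
- by move=> M M1; exact: integral_quadratic_sublevel.
Qed.

Lemma integral_jweight_affine (g : R) : (1 < g)%R ->
  exists2 C : R, (0 < C)%R & forall k e : R, (1 <= `|k|)%R ->
    \int[mu]_x (h g (k * x + e))%:E <= C%:E.
Proof.
move=> g1; have [C C0 HC] := integral_jweight_dyadic g1.
exists (C * 4)%R => [|k e k1]; first by rewrite mulr_gt0.
have k0 : k != 0%R by rewrite -normr_gt0; lra.
under eq_integral do rewrite -(mul1r (h _ _)).
apply: HC; [by meas | by meas | by [] | ].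
(* Since [|k| >= 1], the sublevel set lies within distance [M] of the zero [x0]; the factor [4]
   comes from counting this interval of length [2 M] twice. *)
move=> M M1; pose x0 := (- e / k)%R.
rewrite (_ : 4 * M = 1 * ((x0 + M - (x0 - M)) + (x0 + M - (x0 - M))))%R; last by ring.
apply: integral_le_two_itv; [| |by []|by lra|by lra| ].
- meas; apply: measurable_sublevel; by meas.
- by move=> x; rewrite mul1r indicE.
move=> x; rewrite !mul1r [leLHS]indicE.
have [/set_mem /= xS|_] := boolP (x \in _); last by rewrite addr_ge0 // indicE.
rewrite [X in (X + _)%R]indicE mem_set ?lerDl ?indicE //= in_itv /=.
have : (`|x - x0| <= M)%R.
  apply: le_trans xS; rewrite (_ : k * x + e = k * (x - x0))%R; last by rewrite /x0; field.
  by rewrite normrM ler_peMl.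
by rewrite ler_norml => /andP[? ?]; apply/andP; split; lra.
Qed.

(** [jweight_conv] takes the decay in [al + be] out of the integral and leaves two translated or
    reflected weights. Integrating out the time frequency with it merges two modulation weights into
    one, at a combination of the modulations that is free of that variable. *)
Lemma integral_jweight_conv (g : R) : (1 < g)%R ->
  exists2 C : R, (0 < C)%R & forall al be : R,
    \int[mu]_x (h g (x + al) * h g (be - x))%:E <= (C * h g (al + be))%:E.
Proof.
move=> g1; have [C C0 HC] := integral_jweight_affine g1.
have mh := @measurable_jweight R g.
exists (2 `^ g * (C + C))%R => [|al be].
  by rewrite mulr_gt0 ?powR_gt0 ?addr_gt0.
apply: (@le_trans _ _ (\int[mu]_x (2 `^ g * h g (al + be) * (h g (x + al) + h g (be - x)))%:E)).
  apply: ge0_le_integral_EFin; [by meas|by meas|by move=> x; rewrite mulr_ge0|].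
  move=> x; apply: le_trans (jweight_conv _ _ _) _; first by lra.
  by rewrite (_ : x + al + (be - x) = al + be)%R //; ring.
rewrite ge0_integral_EFinZl; [|by rewrite mulr_ge0 ?powR_ge0|by meas|by move=> x; rewrite addr_ge0].
rewrite ge0_integral_EFinD; [|by meas|by meas|by []|by []].
rewrite (_ : 2 `^ g * (C + C) * h g (al + be) = 2 `^ g * h g (al + be) * (C + C))%R; last by ring.
rewrite [leRHS]EFinM lee_pmul2l ?lte_fin ?mulr_gt0 ?powR_gt0 // [leRHS]EFinD leeD //.
- apply: le_trans (HC 1%R al _); last by rewrite normr1.
  by under [leRHS]eq_integral do rewrite mul1r.
- apply: le_trans (HC (-1)%R be _); last by rewrite normrN1.
  by under [leRHS]eq_integral do rewrite mulN1r addrC.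
Qed.

End one_dimensional_integrals.

(** * Resonance integrals *)

Section resonance_integrals.
Context {R : realType}.
Local Notation mu := (@lebesgue_measure R).
Local Notation h := (@jweight R).
Local Open Scope ereal_scope.

Definition modX (q : R * R) : R := (q.1 + q.2 ^+ 2)%R.
Definition modY (nu : R) (q : R * R) : R := (q.1 + nu * `|q.2| * q.2)%R.

Lemma measurable_modX : measurable_fun setT modX.
Proof. by rewrite /modX; meas. Qed.

Lemma measurable_modY nu : measurable_fun setT (modY nu).
Proof. by rewrite /modY; meas. Qed.

Lemma integral_le_slices (F : R * R -> R) (G : R -> R) (C : \bar R) :
  measurable_fun setT F -> (forall p, 0 <= F p)%R -> measurable_fun setT G ->
  (forall xi, \int[mu]_tau (F (tau, xi))%:E <= (G xi)%:E) ->
  \int[mu]_xi (G xi)%:E <= C ->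
  \int[lebesgue2]_p (F p)%:E <= C.
Proof.
move=> mF F0 mG FG; apply: le_trans.
have mF' : measurable_fun setT (fun p => (F p)%:E) by meas.
rewrite /lebesgue2 fubini_tonelli2 //; apply: ge0_le_integral => //.
- by move=> y _; apply: integral_ge0 => x _; rewrite lee_fin.
- exact: (@measurable_fun_fubini_tonelli_G _ _ _ _ _ mu _ mF').
- by meas.
- by move=> x _; exact: FG.
Qed.

(** On the two half-lines [nu |x| x + x ^ 2] is [(1 + nu) x ^ 2] and [(1 - nu) x ^ 2], with nonzero
    leading coefficients because [|nu| <> 1]; the integrand is dominated by the sum of the two
    quadratic ones. *)
Lemma integral_jweight_signed_quadratic (g nu : R) : (1 < g)%R -> (`|nu| != 1)%R ->
  exists2 C : R, (0 < C)%R & forall be de : R,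
    \int[mu]_x ((1 + `|2 * (nu * `|x| + x) + be|)
      * h g (nu * `|x| * x + x ^+ 2 + be * x + de))%:E <= C%:E.
Proof.
move=> g1 nu1.
have ap : (1 + nu != 0)%R.
  by apply: contra nu1 => /eqP nuE; rewrite (_ : nu = -1)%R ?normrN1 //; lra.
have am : (1 - nu != 0)%R.
  by apply: contra nu1 => /eqP nuE; rewrite (_ : nu = 1)%R ?normr1 //; lra.
have [C1 C10 H1] := integral_jweight_quadratic g1 ap.
have [C2 C20 H2] := integral_jweight_quadratic g1 am.
have mh := @measurable_jweight R g.
exists (C1 + C2)%R => [|be de]; first by rewrite addr_gt0.
pose F a x := ((1 + `|2 * a * x + be|) * h g (a * x ^+ 2 + be * x + de))%R.
have F0 a x : (0 <= F a x)%R by rewrite mulr_ge0 ?addr_ge0.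
have mF a : measurable_fun setT (F a) by rewrite /F; meas.
have mFp := mF (1 + nu)%R; have mFm := mF (1 - nu)%R.
apply: (@le_trans _ _ (\int[mu]_x (F (1 + nu)%R x + F (1 - nu)%R x)%:E)).
  apply: ge0_le_integral_EFin; [by meas|exact: (measurable_funD mFp mFm)|by move=> x; rewrite mulr_ge0 ?addr_ge0|move=> x].
  have [x0|x0] := leP 0%R x.
    rewrite (ger0_norm x0) (_ : 2 * (nu * x + x) = 2 * (1 + nu) * x)%R; last by ring.
    by rewrite (_ : nu * x * x + x ^+ 2 = (1 + nu) * x ^+ 2)%R ?lerDl //; ring.
  rewrite (ltr0_norm x0) (_ : 2 * (nu * - x + x) = 2 * (1 - nu) * x)%R; last by ring.
  by rewrite (_ : nu * - x * x + x ^+ 2 = (1 - nu) * x ^+ 2)%R ?lerDr //; ring.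
rewrite ge0_integral_EFinD; [|exact: mFp|exact: mFm|exact: F0|exact: F0].
by rewrite EFinD; exact: (leeD (H1 be de) (H2 be de)).
Qed.

(** With the output frequency fixed, integrating in [r.1] leaves a weight at the sum of the two
    input modulations. The prefactor is [1] plus the size of the derivative of this sum in [r.2]. *)
Lemma integral_resonance_X (g nu : R) : (1 < g)%R -> (`|nu| != 1)%R ->
  exists2 C : R, (0 < C)%R & forall q : R * R,
    \int[lebesgue2]_r ((1 + `|2 * (nu * `|r.2| + r.2 - q.2)|)
      * (h g (modY nu r) * h g (modX (q.1 - r.1, q.2 - r.2))))%:E <= C%:E.
Proof.
move=> g1 nu1; have [C1 C10 H1] := integral_jweight_conv g1.
have [C2 C20 H2] := integral_jweight_signed_quadratic g1 nu1.
have mh := @measurable_jweight R g.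
have mX := measurable_modX; have mY := measurable_modY nu.
exists (C1 * C2)%R => [|[tau xi] /=]; first by rewrite mulr_gt0.
apply: (@integral_le_slices _ (fun x => C1 * ((1 + `|2 * (nu * `|x| + x) + (- 2 * xi)|)
      * h g (nu * `|x| * x + x ^+ 2 + (- 2 * xi) * x + (tau + xi ^+ 2))))%R).
- by meas.
- by move=> r; rewrite !mulr_ge0 ?addr_ge0.
- by meas.
- move=> x /=; rewrite /modX /modY /=.
  rewrite ge0_integral_EFinZl; [|by rewrite addr_ge0|by meas|by move=> y; rewrite mulr_ge0].
  rewrite (_ : 2 * (nu * `|x| + x) + - 2 * xi = 2 * (nu * `|x| + x - xi))%R; last by ring.
  rewrite mulrCA [leRHS]EFinM lee_pmul2l ?lte_fin ?ltr_pwDl //.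
  rewrite (_ : _ + _ + _ * x + _ = nu * `|x| * x + (tau + (xi - x) ^+ 2))%R; last by ring.
  apply: le_trans (H1 _ _).
  by under [leRHS]eq_integral do rewrite addrAC.
rewrite ge0_integral_EFinZl; [|exact: ltW|by meas|by move=> x; rewrite mulr_ge0 ?addr_ge0].
by rewrite [leRHS]EFinM lee_pmul2l ?lte_fin.
Qed.

(** With the frequency of [v] fixed, both modulations have the same quadratic part, so their
    difference is affine in [q.2] with slope [2 r.2]; [|r.2| >= 1] keeps the slope away from [0]. *)
Lemma integral_resonance_Y (g : R) : (1 < g)%R ->
  exists2 C : R, (0 < C)%R & forall r : R * R, (1 <= `|r.2|)%R ->
    \int[lebesgue2]_q (h g (modX q) * h g (modX (q.1 - r.1, q.2 - r.2)))%:E <= C%:E.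
Proof.
move=> g1; have [C1 C10 H1] := integral_jweight_conv g1.
have [C2 C20 H2] := integral_jweight_affine g1.
have mh := @measurable_jweight R g; have mX := measurable_modX.
exists (C1 * C2)%R => [|[tau xi] /= xi1]; first by rewrite mulr_gt0.
apply: (@integral_le_slices _ (fun x => C1 * h g (2 * xi * x + (tau - xi ^+ 2)))%R).
- by meas.
- by move=> r; rewrite mulr_ge0.
- by meas.
- move=> x /=; rewrite /modX /=.
  rewrite (_ : _ * x + _ = x ^+ 2 + (tau - (x - xi) ^+ 2))%R; last by ring.
  apply: le_trans (H1 _ _); apply: ge0_le_integral_EFin; [by meas|by meas|by move=> y; rewrite mulr_ge0|].
  by move=> y; rewrite -(jweightN _ (y - tau + _)) opprD opprB addrAC.
rewrite ge0_integral_EFinZl; [|exact: ltW|by meas|by []].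
rewrite [leRHS]EFinM lee_pmul2l ?lte_fin // H2 // normrM.
by rewrite (@ger0_norm _ 2) //; lra.
Qed.

(** With the frequency of [u] fixed, the difference of the two modulations is a signed quadratic
    with [- nu] in place of [nu]; the Jacobian factor, at least [1], is inserted for free. *)
Lemma integral_resonance_XY (g nu : R) : (1 < g)%R -> (`|nu| != 1)%R ->
  exists2 C : R, (0 < C)%R & forall p : R * R,
    \int[lebesgue2]_r (h g (modX (p.1 + r.1, p.2 + r.2)) * h g (modY nu r))%:E <= C%:E.
Proof.
move=> g1 nu1; have [C1 C10 H1] := integral_jweight_conv g1.
have [C2 C20 H2] := @integral_jweight_signed_quadratic g (- nu) g1 ltac:(by rewrite normrN).
have mh := @measurable_jweight R g.
have mX := measurable_modX; have mY := measurable_modY nu.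
exists (C1 * C2)%R => [|[tau xi] /=]; first by rewrite mulr_gt0.
apply: (@integral_le_slices _ (fun x => C1 * ((1 + `|2 * (- nu * `|x| + x) + (2 * xi)|)
      * h g (- nu * `|x| * x + x ^+ 2 + (2 * xi) * x + (tau + xi ^+ 2))))%R).
- by meas.
- by move=> r; rewrite mulr_ge0.
- by meas.
- move=> x /=; rewrite /modX /modY /=.
  apply: (@le_trans _ _ (C1 * h g (tau + (xi + x) ^+ 2 + - (nu * `|x| * x)))%:E); last first.
    rewrite lee_fin ler_wpM2l ?(ltW C10) //.
    rewrite (_ : _ + _ + _ * x + _ = tau + (xi + x) ^+ 2 + - (nu * `|x| * x))%R; last by ring.
    by rewrite ler_peMl // lerDl.
  apply: le_trans (H1 _ _); apply: ge0_le_integral_EFin; [by meas|by meas|by move=> y; rewrite mulr_ge0|].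
  move=> y; rewrite (_ : tau + y + _ = y + (tau + (xi + x) ^+ 2))%R; last by ring.
  rewrite -[X in (_ * X <= _)%R]jweightN (_ : - (y + _) = - (nu * `|x| * x) - y)%R //; ring.
rewrite ge0_integral_EFinZl; [|exact: ltW|by meas|by move=> x; rewrite mulr_ge0 ?addr_ge0].
by rewrite [leRHS]EFinM lee_pmul2l ?lte_fin.
Qed.

End resonance_integrals.

(** * Pointwise bound of the kernel *)

Section kernel_bound.
Context {R : realType}.
Local Notation j := (@japanese R).
Local Notation h := (@jweight R).

Definition wX (s a : R) (q : R * R) : R := j q.2 `^ s * j (modX q) `^ a.
Definition wY (nu s a : R) (q : R * R) : R := j q.2 `^ s * j (modY nu q) `^ a.

Lemma wX_gt0 s a q : 0 < wX s a q. Proof. by rewrite mulr_gt0 ?powR_gt0. Qed.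
Lemma wY_gt0 nu s a q : 0 < wY nu s a q. Proof. by rewrite mulr_gt0 ?powR_gt0. Qed.

Lemma powR_sqr (x a : R) : (x `^ a) ^+ 2 = x `^ (2 * a).
Proof. by rewrite -powR_mulrn ?powR_ge0 // -powRrM mulrC. Qed.

Lemma le_powR_nneg (x y a : R) : 0 <= x -> x <= y -> 0 <= a -> x `^ a <= y `^ a.
Proof. by move=> x0 xy a0; apply: ge0_ler_powR; rewrite ?nnegrE // (le_trans x0). Qed.

Lemma powRD_pos (x a b : R) : 0 < x -> x `^ (a + b) = x `^ a * x `^ b.
Proof. by move=> x0; rewrite powRD // (gt_eqF x0) implybT. Qed.

(* The exponent [g] of the dominant modulation is traded for the exponent [t]
   of a smaller one. *)
Lemma jweight_swap (t g x y : R) : t <= g -> j x <= j y ->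
  h t x * h g y <= h t y * h g x.
Proof.
move=> tg xy; rewrite /jweight.
have E z : j z `^ (- g) = j z `^ (- t) * j z `^ (t - g).
  by rewrite -powRD_pos //; congr (_ `^ _); ring.
rewrite (E x) (E y) mulrA [leRHS]mulrCA [leRHS]mulrA ler_wpM2l ?mulr_ge0 ?powR_ge0 //.
rewrite -(opprB g t) !powRN lef_pV2 ?posrE ?powR_gt0 //.
by apply: le_powR_nneg => //; rewrite subr_ge0.
Qed.

Lemma resonance_identity (nu : R) (q r : R * R) :
  modX q - modY nu r - modX (q.1 - r.1, q.2 - r.2)
  = r.2 * (2 * q.2 - r.2 - nu * `|r.2|).
Proof. by rewrite /modX /modY /=; ring. Qed.


Lemma sqr_quotient_le (a b c d e f A h0 h1 h2 : R) :
  a ^+ 2 / c ^+ 2 * (e ^+ 2)^-1 = A -> b ^+ 2 = h0 ->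
  (d ^+ 2)^-1 <= h1 -> (f ^+ 2)^-1 <= h2 ->
  (a * b / (c * d * (e * f))) ^+ 2 <= A * (h0 * h1 * h2).
Proof.
move=> <- <- d1 f1.
rewrite (_ : _ ^+ 2 = a ^+ 2 / c ^+ 2 * (e ^+ 2)^-1 * (b ^+ 2 * (d ^+ 2)^-1 * (f ^+ 2)^-1)); last first.
  by rewrite -!exprVn !invfM; ring.
have i0 (x : R) : 0 <= (x ^+ 2)^-1 by rewrite invr_ge0 sqr_ge0.
have s0 (x : R) : 0 <= x ^+ 2 by exact: sqr_ge0.
apply: ler_wpM2l; first exact: mulr_ge0 (mulr_ge0 (s0 a) (i0 c)) (i0 e).
apply: ler_pM => //; first exact: mulr_ge0.
exact: ler_wpM2l.
Qed.

(** Squaring separates a frequency factor from three modulation weights; the input exponents [2 b]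
    and [2 b'] are lowered to the common [g]. *)
Lemma kernel_le_modulations (nu s s' b b' c g : R) (q r p : R * R) :
  g <= 2 * b -> g <= 2 * b' ->
  (wX s (c - 1) q / (wX s b p * wY nu s' b' r)) ^+ 2 <=
  (j q.2 / j p.2) `^ (2 * s) * j r.2 `^ (- (2 * s')) *
  (h (2 * (1 - c)) (modX q) * h g (modX p) * h g (modY nu r)).
Proof.
move=> gb gb'.
have H (e x : R) : g <= 2 * e -> ((j x `^ e) ^+ 2)^-1 <= h g x.
  by move=> ge; rewrite powR_sqr -powRN /jweight; apply: ler_powR; rewrite // lerN2.
have Hq (x y : R) : (j x `^ s) ^+ 2 / (j y `^ s) ^+ 2 = (j x / j y) `^ (2 * s).
  rewrite !powR_sqr [RHS]powRM ?invr_ge0 //; congr (_ * _).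
  by rewrite -(powR_inv1 (japanese_ge0 _)) -powRrM mulN1r powRN.
have Hr (x : R) : ((j x `^ s') ^+ 2)^-1 = j x `^ (- (2 * s')) by rewrite powR_sqr powRN.
have HS (x : R) : (j x `^ (c - 1)) ^+ 2 = h (2 * (1 - c)) x.
  by rewrite powR_sqr /jweight; congr (_ `^ _); ring.
apply: (sqr_quotient_le _ (HS (modX q)) (H b (modX p) gb) (H b' (modY nu r) gb')).
by rewrite (Hq q.2 p.2) (Hr r.2).
Qed.

(** Peetre's inequality [japaneseM_ge], raised to the power [2 s >= 0], moves the whole loss to
    [y]. *)
Lemma frequency_ratio_le (s s' x y : R) : 0 <= s ->
  (j (x + y) / j x) `^ (2 * s) * j y `^ (- (2 * s')) <= 2 `^ (2 * s) * j y `^ (2 * (s - s')).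
Proof.
move=> s0; have s2 : 0 <= 2 * s by rewrite mulr_ge0.
have -> : j y `^ (2 * (s - s')) = j y `^ (2 * s) * j y `^ (- (2 * s')).
  by rewrite -powRD_pos //; congr (_ `^ _); ring.
rewrite mulrA ler_wpM2r ?powR_ge0 // -powRM //; apply: le_powR_nneg => //.
  by rewrite divr_ge0.
by rewrite ler_pdivrMr // mulrAC japaneseM_ge.
Qed.

(** Near resonance [2 x] is close to [y + nu |y|] and [2 (x - y)] is close to [nu |y| - y]. The
    former is at most of the order of [|y|], the latter at least, so [|x|] is controlled by
    [|x - y|]. *)
Lemma comparable_frequencies (nu k0 x y : R) : 0 < k0 ->
  2 * k0 * `|y| <= `|nu * `|y| - y| -> `|2 * x - y - nu * `|y| | < k0 * `|y| ->
  j x <= (1 + `|nu| + k0) / k0 * j (x - y).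
Proof.
move=> k00 Hm DB.
have n0 := normr_ge0 nu.
have m1 : 0 <= 1 + `|nu| + k0 by lra.
have xy : 2 * `|x| <= (1 + `|nu| + k0) * `|y|.
  have -> : 2 * `|x| = `|y + nu * `|y| + (2 * x - y - nu * `|y|)|.
    by rewrite -{1}(@ger0_norm _ (2 : R)) // -normrM; congr `|_|; ring.
  apply: (le_trans (ler_normD _ _)); apply: (le_trans (lerD (ler_normD _ _) (ltW DB))).
  by rewrite normrM normr_id !mulrDl mul1r.
have py : k0 * `|y| <= 2 * `|x - y|.
  have -> : 2 * `|x - y| = `|(nu * `|y| - y) - (- (2 * x - y - nu * `|y|))|.
    by rewrite -{1}(@ger0_norm _ (2 : R)) // -normrM; congr `|_|; ring.
  apply: le_trans (lerB_dist _ _); rewrite normrN.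
  by move: Hm DB; clear; lra.
rewrite mulrAC ler_pdivlMr //.
have le1 : (1 + `|nu| + k0) * (k0 * `|y|) <= (1 + `|nu| + k0) * (2 * `|x - y|) by rewrite ler_wpM2l.
have le2 : k0 * (2 * `|x|) <= k0 * ((1 + `|nu| + k0) * `|y|) by rewrite ler_wpM2l // ltW.
have le3 : `|x| * k0 <= (1 + `|nu| + k0) * `|x - y|.
  by move: le1 le2; move: (1 + _ + _) (`|x|) (`|y|) (`|x - y|) => *; nra.
have k01 : k0 <= 1 + `|nu| + k0 by lra.
move: le3 m1 k01 (normr_ge0 x) (normr_ge0 (x - y)); move: (1 + _ + _) => m le3 m1 k01 x0 y0 {DB Hm xy py le1 le2 n0}.
have ja := japanese_ge0 (x - y); have jx := japanese_ge0 x.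
have k0' := ltW k00.
rewrite -(ler_pXn2r (ltn0Sn 1)) ?nnegrE ?mulr_ge0 // !exprMn !japanese_sqr.
rewrite -(real_normK (num_real x)) -(real_normK (num_real (x - y))).
have : (`|x| * k0) ^+ 2 <= (m * `|x - y|) ^+ 2 by rewrite ler_sqr ?nnegrE ?mulr_ge0.
have : k0 ^+ 2 <= m ^+ 2 by rewrite ler_sqr ?nnegrE.
rewrite !exprMn; move: (`|x| ^+ 2) (`|x - y| ^+ 2) (k0 ^+ 2) (m ^+ 2) {le3} => *; lra.
Qed.

(** Twice [nu |y| + y - x] differs from [nu |y| + y], of size at least [2 k0 |y|], by the resonance
    defect, of size less than [k0 |y|]; at least [k0 |y|] remains. *)
Lemma derivative_bound (nu k0 x y : R) : 0 < k0 ->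
  2 * k0 * `|y| <= `|nu * `|y| + y| -> `|2 * x - y - nu * `|y| | < k0 * `|y| ->
  j y <= (1 + k0^-1) * (1 + `|2 * (nu * `|y| + y - x)|).
Proof.
move=> k00 Hp DB; apply: (le_trans (japanese_le1D _)).
have H : k0 * `|y| <= `|2 * (nu * `|y| + y - x)|.
  rewrite (_ : 2 * (nu * `|y| + y - x) = (nu * `|y| + y) - (2 * x - y - nu * `|y|)); last by ring.
  apply: le_trans (lerB_dist _ _).
  by move: Hp DB; clear; lra.
move: (normr_ge0 (2 * (nu * `|y| + y - x))) H; move: (`|2 * (nu * `|y| + y - x)|) => Z Z0.
have ki : 0 < k0^-1 by rewrite invr_gt0.
rewrite -ler_pdivlMl //; move: Z0 ki; clear; move: (`|y|) (k0^-1) => *; nra.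
Qed.

(** For [|y| >= 1] one has [<y> ^ 2 <= 2 y ^ 2 <= (6 / k0) <x>], so the weight of exponent [t] in
    the modulation [x] absorbs [<y> ^ (2 t)], hence [<y> ^ (2 (s - s'))]. *)
Lemma dominant_modulation (s s' t k0 y x A : R) : 0 < k0 -> 1 <= `|y| ->
  0 <= t -> s - s' <= t -> 0 <= A -> k0 * y ^+ 2 <= 3 * `|x| ->
  A <= 2 `^ (2 * s) * j y `^ (2 * (s - s')) ->
  A * h t x <= 2 `^ (2 * s) * (6 / k0) `^ t.
Proof.
move=> k00 y1 t0 st A0 yx AB.
apply: (@le_trans _ _ (2 `^ (2 * s) * j y `^ (2 * (s - s')) * h t x)).
  by rewrite ler_wpM2r.
rewrite -mulrA ler_wpM2l ?powR_ge0 //.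
apply: (@le_trans _ _ (j y `^ (2 * t) * h t x)).
  by rewrite ler_wpM2r //; apply: ler_powR; rewrite // ler_wpM2l.
have k60 : 0 <= 6 / k0 by rewrite divr_ge0 // ltW.
rewrite /jweight powRN ler_pdivrMr; last exact: powR_gt0.
rewrite -(powRM _ k60 (japanese_ge0 x)).
rewrite powRrM powR_mulrn //; apply: le_powR_nneg; rewrite ?exprn_ge0 //.
rewrite japanese_sqr mulrAC ler_pdivlMr //.
have y2 : 1 <= y ^+ 2 by rewrite -(real_normK (num_real y)) exprn_ege1.
move: (norm_le_japanese x) yx y2 k00; clear; move: (j x) (`|x|) (y ^+ 2) => *; nra.
Qed.

(** The largest of the three terms carries at least a third of the sum. In the last two cases the
    comparison with the output [x] is what [jweight_swap] asks for. *)
Lemma max_modulation (x y z u v : R) : x - y - z = u ->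
  v <= `|u| -> [\/ `|y| <= `|x| /\ `|z| <= `|x| /\ v <= 3 * `|x|,
    `|x| <= `|y| /\ v <= 3 * `|y| | `|x| <= `|z| /\ v <= 3 * `|z|].
Proof.
move=> <- vu.
have {vu} : v <= `|x| + `|y| + `|z|.
  apply: (le_trans vu); apply: (le_trans (ler_normB _ _)).
  by rewrite lerD2r ler_normB.
move: (`|x|) (`|y|) (`|z|) => {u} {}x {}y {}z vs.
have [zy|zy] := leP z y.
  by have [xy|xy] := leP x y; [apply: Or32; split => //; lra|apply: Or31; split; [|split]; lra].
by have [xz|xz] := leP x z; [apply: Or33; split => //; lra|apply: Or31; split; [|split]; lra].
Qed.

Lemma le_dominant_output (K A ht h1 h2 B C W Z : R) : K <= A * (ht * h2 * h1) ->
  A * ht <= B * W -> 0 <= B -> B <= C -> 0 <= W -> W <= Z -> 0 <= h1 -> 0 <= h2 ->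
  K <= C * (Z * (h1 * h2)).
Proof.
move=> Kle AB B0 BC W0 WZ h10 h20; apply: (le_trans Kle).
rewrite (_ : A * _ = A * ht * (h1 * h2)); last by ring.
rewrite [leRHS]mulrA ler_wpM2r ?mulr_ge0 //; apply: (le_trans AB).
exact: ler_pM.
Qed.

(** After the swap the dominant input keeps the exponent of the output, which the bound on [A * ht1]
    absorbs, and the output gains the full exponent. *)
Lemma le_dominant_input (K A ht0 ht1 h0 h1 h2 B C : R) : K <= A * (ht0 * h2 * h1) ->
  ht0 * h1 <= ht1 * h0 -> A * ht1 <= B -> B <= C ->
  0 <= A -> 0 <= h0 -> 0 <= h2 -> K <= C * (h0 * h2).
Proof.
move=> Kle sw AB BC A0 h00 h20; apply: (le_trans Kle).
rewrite (_ : A * _ = A * h2 * (ht0 * h1)); last by ring.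
apply: (@le_trans _ _ (A * h2 * (ht1 * h0))); first by rewrite ler_wpM2l // mulr_ge0.
rewrite (_ : A * h2 * (ht1 * h0) = A * ht1 * (h0 * h2)); last by ring.
by rewrite ler_wpM2r ?mulr_ge0 // (le_trans AB).
Qed.

Lemma kernel_case_analysis (nu s s' t g : R) : `|nu| != 1 ->
  0 <= s -> - (1 / 2) <= s' -> 0 <= t -> t <= g -> s - s' <= t ->
  exists2 C : R, 0 < C & forall x y S S1 S2 K : R,
    S - S1 - S2 = y * (2 * x - y - nu * `|y|) ->
    K <= (j x / j (x - y)) `^ (2 * s) * j y `^ (- (2 * s')) * (h t S * h g S2 * h g S1) ->
    [\/ K <= C * ((1 + `|2 * (nu * `|y| + y - x)|) * (h g S1 * h g S2)),
        1 <= `|y| /\ K <= C * (h g S * h g S2) |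
        K <= C * (h g S * h g S1)].
Proof.
move=> nu1 s0 s'h t0 tg ss'.
have ap : 0 < `|1 + nu|.
  by rewrite normr_gt0; apply: contra nu1 => /eqP nuE; rewrite (_ : nu = -1) ?normrN1 //; lra.
have am : 0 < `|1 - nu|.
  by rewrite normr_gt0; apply: contra nu1 => /eqP nuE; rewrite (_ : nu = 1) ?normr1 //; lra.
(* [k0] is the relative width of the near-resonant set. Half of the minimum makes [nu |y| + y] and
   [nu |y| - y] at least [2 k0 |y|], so a defect below [k0 |y|] cannot cancel them. *)
pose k0 := Num.min `|1 + nu| `|1 - nu| / 2.
have k00 : 0 < k0 by rewrite divr_gt0 // lt_min ap am.
have k0p : 2 * k0 <= `|1 + nu| by rewrite mulrC divfK // ge_min lexx.
have k0m : 2 * k0 <= `|1 - nu| by rewrite mulrC divfK // ge_min lexx orbT.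
have sgn_bound (x : R) : 2 * k0 * `|x| <= `|nu * `|x| + x| /\ 2 * k0 * `|x| <= `|nu * `|x| - x|.
  have [x0|x0] := leP 0 x.
    rewrite (ger0_norm x0) (_ : nu * x + x = (1 + nu) * x); last by ring.
    rewrite (_ : nu * x - x = - ((1 - nu) * x)); last by ring.
    by rewrite normrN !normrM (ger0_norm x0) !ler_wpM2r.
  rewrite (ltr0_norm x0) (_ : nu * - x + x = (1 - nu) * x); last by ring.
  rewrite (_ : nu * - x - x = - ((1 + nu) * x)); last by ring.
  by rewrite normrN !normrM (ltr0_norm x0) !ler_wpM2r // oppr_ge0 ltW.
move: k0 k00 sgn_bound {ap am k0p k0m} => k0 k00 sgn_bound.
have n0 := normr_ge0 nu.
pose m := (1 + `|nu| + k0) / k0.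
have m0 : 0 < m by apply: divr_gt0 => //; lra.
pose e := 2 * `|s - s'|.
(* [CL], [CB] and [CA] serve the low frequencies [|y| <= 1], the near-resonant set and its
   complement. *)
pose CL := 2 `^ (2 * s) * 2 `^ e.
pose CB := m `^ (2 * s) * (1 + k0^-1).
pose CA := 2 `^ (2 * s) * (6 / k0) `^ t.
have CL0 : 0 < CL by rewrite mulr_gt0 ?powR_gt0.
have CB0 : 0 < CB by rewrite mulr_gt0 ?powR_gt0 // addr_gt0 // invr_gt0.
have CA0 : 0 < CA by rewrite mulr_gt0 ?powR_gt0 // divr_gt0.
exists (CL + CB + CA) => [|x y S S1 S2 K Sxy Kle]; first by rewrite !addr_gt0.
have CLle : CL <= CL + CB + CA by move: CL0 CB0 CA0; clear; lra.
have CBle : CB <= CL + CB + CA by move: CL0 CB0 CA0; clear; lra.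
have CAle : CA <= CL + CB + CA by move: CL0 CB0 CA0; clear; lra.
have s2 : 0 <= 2 * s by rewrite mulr_ge0.
set A := (j x / j (x - y)) `^ (2 * s) * j y `^ (- (2 * s')) in Kle.
have A0 : 0 <= A by rewrite mulr_ge0 ?powR_ge0.
have AB : A <= 2 `^ (2 * s) * j y `^ (2 * (s - s')).
  by have := frequency_ratio_le s' (x - y) y s0; rewrite subrK.
have h0 := jweight_ge0 g S; have h1 := jweight_ge0 g S1; have h2 := jweight_ge0 g S2.
have ht1 := jweight_le1 S t0.
set Z := 1 + `|2 * (nu * `|y| + y - x)|.
have Z1 : 1 <= Z by rewrite lerDl.
have drop : A * h t S <= A by rewrite ler_piMr.
have [y1|/ltW y1] := leP `|y| 1.
  apply: Or31; apply: (le_dominant_output Kle (B := CL) (W := 1)) => //; last exact: ltW.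
  rewrite mulr1; apply: (le_trans drop); apply: (le_trans AB).
  rewrite ler_wpM2l ?powR_ge0 //; apply: (@le_trans _ _ (j y `^ e)).
    by apply: ler_powR => //; rewrite /e ler_wpM2l // ler_norm.
  apply: le_powR_nneg => //; last by rewrite mulr_ge0.
  by apply: (le_trans (japanese_le1D _)); move: y1; clear; lra.
have [Hp Hm] := sgn_bound y.
have [DB|DA] := ltP `|2 * x - y - nu * `|y| | (k0 * `|y|).
  apply: Or31; apply: (le_dominant_output Kle (B := CB) (W := Z)) => //; [|exact: ltW|exact: le_trans ler01 Z1].
  apply: (le_trans drop); rewrite /CB -mulrA.
  apply: ler_pM; [exact: powR_ge0|exact: powR_ge0| |].
    apply: le_powR_nneg => //; first by rewrite divr_ge0.
    by rewrite ler_pdivrMr //; exact: comparable_frequencies.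
  apply: le_trans (derivative_bound k00 Hp DB).
  (* Here [- 2 s' <= 1] is spent: one power of [<y>], supplied by the derivative, covers
     [<y> ^ (- 2 s')]. *)
  rewrite -[leRHS](powRr1 (japanese_ge0 _)); apply: ler_powR => //.
  by move: s'h; clear; lra.
have yD : k0 * y ^+ 2 <= `|y * (2 * x - y - nu * `|y|)|.
  rewrite normrM -(real_normK (num_real y)) expr2 mulrCA.
  by rewrite ler_wpM2l.
have dom (M : R) : k0 * y ^+ 2 <= 3 * `|M| -> A * h t M <= CA.
  by move=> yM; exact: dominant_modulation AB.
have [[_ [_ /dom SA]]|[S01 /dom SA]|[S02 /dom SA]] := max_modulation Sxy yD.
- apply: Or31; apply: (le_dominant_output Kle (B := CA) (W := 1)) => //; last exact: ltW.
  by rewrite mulr1.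
- apply: Or32; split; first exact: y1.
  exact: (le_dominant_input Kle (jweight_swap tg (le_japanese S01)) SA).
- apply: Or33.
  rewrite [X in A * X]mulrAC in Kle.
  exact: (le_dominant_input Kle (jweight_swap tg (le_japanese S02)) SA).
Qed.

Lemma kernel_bound (nu s s' b b' c g : R) : `|nu| != 1 ->
  0 <= s -> - (1 / 2) <= s' -> 1 < g -> g <= 2 * b -> g <= 2 * b' ->
  1 / 2 < c -> c < 1 -> s - s' <= 2 * (1 - c) ->
  exists2 C : R, 0 < C & forall q r : R * R,
    let p := (q.1 - r.1, q.2 - r.2) in
    let k := wX s (c - 1) q / (wX s b p * wY nu s' b' r) in
    [\/ k ^+ 2 <= C * ((1 + `|2 * (nu * `|r.2| + r.2 - q.2)|)
                       * (h g (modY nu r) * h g (modX p))),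
        1 <= `|r.2| /\ k ^+ 2 <= C * (h g (modX q) * h g (modX p)) |
        k ^+ 2 <= C * (h g (modX q) * h g (modY nu r))].
Proof.
move=> nu1 s0 s'h g1 gb gb' c12 c1 ss'.
have t0 : 0 <= 2 * (1 - c) by lra.
(* From [c > 1/2] the output exponent is below [1 < g], as the swap of exponents requires. *)
have tg : 2 * (1 - c) <= g by lra.
have [C C0 HC] := kernel_case_analysis nu1 s0 s'h t0 tg ss'.
exists C => // q r p k; apply: HC; first exact: resonance_identity.
exact: (kernel_le_modulations nu s s' c q r p gb gb').
Qed.

End kernel_bound.

(** * The bilinear estimate for nonnegative functions *)

Section double_integrals.
Context {R : realType}.
Local Open Scope ereal_scope.
Local Notation mu2 := (@lebesgue2 R).

Definition dint (F : (R * R) * (R * R) -> R) : \bar R :=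
  \int[lebesgue2]_q \int[lebesgue2]_r (F (q, r))%:E.

Implicit Types F G : (R * R) * (R * R) -> R.

Lemma measurable_dint_inner F : measurable_fun setT F -> (forall z, 0 <= F z)%R ->
  measurable_fun setT (fun q => \int[lebesgue2]_r (F (q, r))%:E).
Proof.
move=> mF F0; have mF' : measurable_fun setT (fun z => (F z)%:E) by meas.
have F0' z : 0 <= (F z)%:E by rewrite lee_fin.
exact: (@measurable_fun_fubini_tonelli_F _ _ _ _ _ mu2 _ mF' F0').
Qed.

Lemma dint_swap F : measurable_fun setT F -> (forall z, 0 <= F z)%R ->
  dint F = \int[lebesgue2]_r \int[lebesgue2]_q (F (q, r))%:E.
Proof.
move=> mF F0; have mF' : measurable_fun setT (fun z => (F z)%:E) by meas.
have F0' z : 0 <= (F z)%:E by rewrite lee_fin.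
exact: (@fubini_tonelli _ _ _ _ _ mu2 mu2 _ mF' F0').
Qed.

Lemma dint_translate F : measurable_fun setT F -> (forall z, 0 <= F z)%R ->
  dint F = dint (fun z => F ((z.1.1 + z.2.1, z.1.2 + z.2.2), z.2))%R.
Proof.
move=> mF F0.
have m1 : measurable_fun setT (fun z : (R * R) * (R * R) => (((z.1.1 + z.2.1, z.1.2 + z.2.2), z.2))%R).
  by meas.
rewrite (dint_swap mF F0) (dint_swap (measurableT_comp mF m1) (fun z => F0 _)).
apply: eq_integral => r _.
rewrite (ge0_integral_affine2 r.1 r.2 (@ltr01 R)).
- by rewrite expr1n mul1e; apply: eq_integral => q _; rewrite !mul1r.
- by meas.
- by move=> q; rewrite lee_fin.
Qed.

Lemma le_dint F G : measurable_fun setT F -> measurable_fun setT G ->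
  (forall z, 0 <= F z)%R -> (forall z, F z <= G z)%R -> dint F <= dint G.
Proof.
move=> mF mG F0 FG; have G0 z : (0 <= G z)%R := le_trans (F0 z) (FG z).
apply: ge0_le_integral => //.
- by move=> q _; apply: integral_ge0 => r _; rewrite lee_fin.
- exact: measurable_dint_inner.
- exact: measurable_dint_inner.
- move=> q _; apply: ge0_le_integral_EFin; [by meas|by meas|by []|by []].
Qed.

Lemma dintD F G : measurable_fun setT F -> measurable_fun setT G ->
  (forall z, 0 <= F z)%R -> (forall z, 0 <= G z)%R ->
  dint (fun z => F z + G z)%R = dint F + dint G.
Proof.
move=> mF mG F0 G0; rewrite /dint -ge0_integralD //.
- by apply: eq_integral => q _; rewrite ge0_integral_EFinD //; meas.
- by move=> q _; apply: integral_ge0 => r _; rewrite lee_fin.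
- exact: measurable_dint_inner.
- by move=> q _; apply: integral_ge0 => r _; rewrite lee_fin.
- exact: measurable_dint_inner.
Qed.

Lemma dint_le_mull (f : R * R -> R) F (C : R) :
  measurable_fun setT f -> measurable_fun setT F ->
  (forall q, 0 <= f q)%R -> (forall z, 0 <= F z)%R -> (0 <= C)%R ->
  (forall q, \int[lebesgue2]_r (F (q, r))%:E <= C%:E) ->
  dint (fun z => f z.1 * F z)%R <= C%:E * \int[lebesgue2]_q (f q)%:E.
Proof.
move=> mf mF f0 F0 C0 FC.
rewrite -ge0_integral_EFinZl //.
apply: ge0_le_integral => //.
- by move=> q _; apply: integral_ge0 => r _; rewrite lee_fin mulr_ge0.
- apply: (@measurable_dint_inner (fun z => f z.1 * F z)%R); first by meas.
  by move=> z; rewrite mulr_ge0.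
- by meas.
move=> q _ /=; rewrite ge0_integral_EFinZl //; last by meas.
by rewrite mulrC [leRHS]EFinM lee_wpmul2l // lee_fin.
Qed.

Lemma dint_mul (f g : R * R -> R) :
  measurable_fun setT f -> measurable_fun setT g ->
  (forall q, 0 <= f q)%R -> (forall q, 0 <= g q)%R ->
  dint (fun z => f z.1 * g z.2)%R
  = (\int[lebesgue2]_q (f q)%:E) * (\int[lebesgue2]_q (g q)%:E).
Proof.
move=> mf mg f0 g0; rewrite /dint /=.
under eq_integral do rewrite ge0_integral_EFinZl //.
rewrite ge0_integralZr //.
- by meas.
- by move=> q _; rewrite lee_fin.
- by apply: integral_ge0 => q _; rewrite lee_fin.
Qed.

End double_integrals.

Section bilinear_estimate.
Context {R : realType}.
Local Open Scope ereal_scope.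
Local Notation h := (@jweight R).

Implicit Types F G : (R * R) * (R * R) -> R.

Lemma dintZ_le F (a f : R) : measurable_fun setT F -> (forall z, 0 <= F z)%R ->
  (0 <= a)%R -> dint F <= f%:E -> dint (fun z => a * F z)%R <= (a * f)%:E.
Proof.
move=> mF F0 a0 Ff; rewrite /dint.
have E q : \int[lebesgue2]_r (a * F (q, r))%:E = a%:E * \int[lebesgue2]_r (F (q, r))%:E.
  by rewrite ge0_integral_EFinZl //; meas.
under eq_integral do rewrite E.
rewrite ge0_integralZl //; first by rewrite EFinM lee_wpmul2l.
- exact: measurable_dint_inner.
- by move=> q _; apply: integral_ge0 => r _; rewrite lee_fin.
Qed.

Lemma dintD_le F G (f g : R) : measurable_fun setT F -> measurable_fun setT G ->
  (forall z, 0 <= F z)%R -> (forall z, 0 <= G z)%R ->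
  dint F <= f%:E -> dint G <= g%:E -> dint (fun z => F z + G z)%R <= (f + g)%:E.
Proof. by move=> mF mG F0 G0 Ff Gg; rewrite dintD // EFinD leeD. Qed.

(** Passes from the output frequency to that of [u], which turns the factor [f] into a function of
    one variable. *)
Lemma dint_translate_sub (f : R * R -> R) G :
  measurable_fun setT f -> measurable_fun setT G ->
  (forall z, 0 <= f z)%R -> (forall z, 0 <= G z)%R ->
  dint (fun z => f (z.1.1 - z.2.1, z.1.2 - z.2.2) * G z)%R
  = dint (fun z => f z.1 * G ((z.1.1 + z.2.1, z.1.2 + z.2.2), z.2))%R.
Proof.
move=> mf mG f0 G0; rewrite dint_translate; last 2 first.
- by meas.
- by move=> z; rewrite mulr_ge0.
by congr dint; apply/funext => -[[a b] [u v]] /=; rewrite !addrK.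
Qed.

Lemma young_weighted (x y l : R) : (0 < l)%R -> (x * y <= l * x ^+ 2 + l^-1 * y ^+ 2)%R.
Proof.
move=> l0; have li : (0 < l^-1)%R by rewrite invr_gt0.
have ll : (l * l^-1 = 1)%R by rewrite divff // gt_eqF.
have : (0 <= l^-1 * (l * x - y) ^+ 2)%R by rewrite mulr_ge0 ?sqr_ge0 // ltW.
have -> : (l^-1 * (l * x - y) ^+ 2 = l * x ^+ 2 * (l * l^-1) - 2 * (l * l^-1) * (x * y) + l^-1 * y ^+ 2)%R by ring.
rewrite ll !mulr1.
have : (0 <= l * x ^+ 2)%R by rewrite mulr_ge0 ?sqr_ge0 // ltW.
have : (0 <= l^-1 * y ^+ 2)%R by rewrite mulr_ge0 ?sqr_ge0 // ltW.
move: (l * x ^+ 2)%R (l^-1 * _)%R (x * y)%R => *; lra.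
Qed.

(* Replacing the Cauchy-Schwarz inequality by a weighted Young inequality
   leaves only integrals of nonnegative functions; the terms containing
   [X] on the right are absorbed because [X] is finite. *)
Lemma trilinear_bound (C C1 C2 C3 : R) (H F G : R * R -> R)
    (K E1 E2 E3 : (R * R) * (R * R) -> R) (X A B : R) :
  (0 < C)%R -> (0 < C1)%R -> (0 < C2)%R -> (0 < C3)%R ->
  measurable_fun setT H -> measurable_fun setT F -> measurable_fun setT G ->
  measurable_fun setT K ->
  measurable_fun setT E1 -> measurable_fun setT E2 -> measurable_fun setT E3 ->
  (forall q, 0 <= H q)%R -> (forall q, 0 <= F q)%R -> (forall q, 0 <= G q)%R ->
  (forall z, 0 <= K z)%R ->
  (forall z, 0 <= E1 z)%R -> (forall z, 0 <= E2 z)%R -> (forall z, 0 <= E3 z)%R ->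
  (forall z, [\/ K z ^+ 2 <= C * E1 z, K z ^+ 2 <= C * E2 z | K z ^+ 2 <= C * E3 z])%R ->
  (forall q, \int[lebesgue2]_r (E1 (q, r))%:E <= C1%:E) ->
  (forall r, \int[lebesgue2]_q (E2 (q, r))%:E <= C2%:E) ->
  (forall p, \int[lebesgue2]_r (E3 ((p.1 + r.1, p.2 + r.2)%R, r))%:E <= C3%:E) ->
  \int[lebesgue2]_q (H q ^+ 2)%:E = X%:E ->
  \int[lebesgue2]_q (F q ^+ 2)%:E = A%:E ->
  \int[lebesgue2]_q (G q ^+ 2)%:E = B%:E ->
  X%:E <= dint (fun z => H z.1 * K z * (F (z.1.1 - z.2.1, z.1.2 - z.2.2) * G z.2))%R ->
  (X <= 2 * (4 * C * C1 + 8 * C * C2 + 8 * C * C3) * A * B)%R.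
Proof.
move=> C0 C10 C20 C30 mH mF mG mK mE1 mE2 mE3 H0 F0 G0 K0 E10 E20 E30 KE.
move=> HE1 HE2 HE3 HX HA HB Xle.
pose p (z : (R * R) * (R * R)) := (z.1.1 - z.2.1, z.1.2 - z.2.2)%R.
have mp : measurable_fun setT p by rewrite /p; meas.
have mFp : measurable_fun setT (fun z => F (p z)) := measurableT_comp mF mp.
have X0 : (0 <= X)%R.
  by rewrite -lee_fin -HX; apply: integral_ge0 => q _; rewrite lee_fin sqr_ge0.
have A0 : (0 <= A)%R.
  by rewrite -lee_fin -HA; apply: integral_ge0 => q _; rewrite lee_fin sqr_ge0.
have B0 : (0 <= B)%R.
  by rewrite -lee_fin -HB; apply: integral_ge0 => q _; rewrite lee_fin sqr_ge0.
(* Each unprimed product joins a kernel to the square of the function whose variable stays fixed in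
   the slice integral of that kernel; the primed one collects the squares of the other two
   functions. *)
pose D1 z := (H z.1 ^+ 2 * E1 z)%R; pose D1' z := (F (p z) ^+ 2 * G z.2 ^+ 2)%R.
pose D2 z := (G z.2 ^+ 2 * E2 z)%R; pose D2' z := (F (p z) ^+ 2 * H z.1 ^+ 2)%R.
pose D3 z := (F (p z) ^+ 2 * E3 z)%R; pose D3' z := (H z.1 ^+ 2 * G z.2 ^+ 2)%R.
have mD1 : measurable_fun setT D1 by rewrite /D1; meas.
have mD1' : measurable_fun setT D1' by rewrite /D1'; meas.
have mD2 : measurable_fun setT D2 by rewrite /D2; meas.
have mD2' : measurable_fun setT D2' by rewrite /D2'; meas.
have mD3 : measurable_fun setT D3 by rewrite /D3; meas.
have mD3' : measurable_fun setT D3' by rewrite /D3'; meas.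
have D10 z : (0 <= D1 z)%R by rewrite mulr_ge0 ?sqr_ge0.
have D10' z : (0 <= D1' z)%R by rewrite mulr_ge0 ?sqr_ge0.
have D20 z : (0 <= D2 z)%R by rewrite mulr_ge0 ?sqr_ge0.
have D20' z : (0 <= D2' z)%R by rewrite mulr_ge0 ?sqr_ge0.
have D30 z : (0 <= D3 z)%R by rewrite mulr_ge0 ?sqr_ge0.
have D30' z : (0 <= D3' z)%R by rewrite mulr_ge0 ?sqr_ge0.
have mX2 : measurable_fun setT (fun q => H q ^+ 2)%R by meas.
have mF2 : measurable_fun setT (fun q => F q ^+ 2)%R by meas.
have mG2 : measurable_fun setT (fun q => G q ^+ 2)%R by meas.
have sq0 (f : R * R -> R) q : (0 <= f q ^+ 2)%R by exact: sqr_ge0.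
have I1 : dint D1 <= (C1 * X)%:E.
  rewrite EFinM -HX; apply: (@dint_le_mull _ (fun q => H q ^+ 2)%R); [exact: mX2|exact: mE1|exact: sq0|by []|exact: ltW|by []].
have I1' : dint D1' <= (A * B)%:E.
  rewrite (@dint_translate_sub (fun q => F q ^+ 2)%R (fun z => G z.2 ^+ 2)%R) ; [|exact: mF2|by meas|by []|by move=> z; exact: sqr_ge0].
  by rewrite (@dint_mul _ (fun q => F q ^+ 2)%R (fun q => G q ^+ 2)%R) // HA HB.
have I2 : dint D2 <= (C2 * B)%:E.
  rewrite dint_swap // EFinM -HB.
  apply: (@dint_le_mull _ (fun q => G q ^+ 2)%R (fun z => E2 (z.2, z.1))); [exact: mG2|by meas|exact: sq0|by []|exact: ltW|by []].
have I2' : dint D2' <= (A * X)%:E.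
  rewrite (@dint_translate_sub (fun q => F q ^+ 2)%R (fun z => H z.1 ^+ 2)%R) ; [|exact: mF2|by meas|by []|by move=> z; exact: sqr_ge0].
  rewrite EFinM -HA muleC -HX.
  have -> : (\int[lebesgue2]_q (H q ^+ 2)%:E * \int[lebesgue2]_q (F q ^+ 2)%:E) = X%:E * \int[lebesgue2]_q (F q ^+ 2)%:E by rewrite HX.
  apply: (@dint_le_mull _ (fun q => F q ^+ 2)%R (fun z => H (z.1.1 + z.2.1, z.1.2 + z.2.2) ^+ 2)%R); [exact: mF2|by meas|exact: sq0|by move=> z; exact: sqr_ge0|by []|].
  move=> [a b] /=; rewrite -HX (ge0_integral_affine2 a b (@ltr01 R)); [|by meas|by move=> q; rewrite lee_fin sqr_ge0].
  rewrite expr1n mul1e le_eqVlt; apply/orP; left; apply/eqP.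
  by apply: eq_integral => q _; rewrite !mul1r ![(_ + a)%R]addrC ![(_ + b)%R]addrC.
have I3 : dint D3 <= (C3 * A)%:E.
  rewrite (@dint_translate_sub (fun q => F q ^+ 2)%R E3) // EFinM -HA.
  apply: (@dint_le_mull _ (fun q => F q ^+ 2)%R (fun z => E3 ((z.1.1 + z.2.1, z.1.2 + z.2.2), z.2))%R); [exact: mF2|by meas|exact: sq0|by []|exact: ltW|by []].
have I3' : dint D3' <= (X * B)%:E.
  by rewrite /D3' (@dint_mul _ (fun q => H q ^+ 2)%R (fun q => G q ^+ 2)%R) // HX HB.
(* Young's parameters must be positive while [A] and [B] may vanish, so positive majorants [A1] and
   [B1] take their place; they are brought down to [A] and [B] at the end. *)
have main (A1 B1 : R) : (0 < A1)%R -> (0 < B1)%R -> (A <= A1)%R -> (B <= B1)%R ->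
    (X <= 2 * (4 * C * C1 + 8 * C * C2 + 8 * C * C3) * A1 * B1)%R.
  move=> A10 B10 AA1 BB1.
  (* These parameters bound the terms containing [X] by [X / 4], [X / 8] and [X / 8]; half of [X] is
     absorbed, whence the factor [2] in the conclusion. *)
  pose l1 := ((4 * C * C1)^-1)%R; pose l2 := (8 * A1)%R; pose l3 := (8 * B1)%R.
  have l10 : (0 < l1)%R by rewrite invr_gt0 !mulr_gt0.
  have l20 : (0 < l2)%R by rewrite mulr_gt0.
  have l30 : (0 < l3)%R by rewrite mulr_gt0.
  pose S z := (((l1 * C) * D1 z + l1^-1 * D1' z)
    + (((l2 * C) * D2 z + l2^-1 * D2' z) + ((l3 * C) * D3 z + l3^-1 * D3' z)))%R.
  have a1 : (0 <= l1 * C)%R by rewrite mulr_ge0 // ltW.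
  have a2 : (0 <= l2 * C)%R by rewrite mulr_ge0 // ltW.
  have a3 : (0 <= l3 * C)%R by rewrite mulr_ge0 // ltW.
  have a1' : (0 <= l1^-1)%R by rewrite invr_ge0 ltW.
  have a2' : (0 <= l2^-1)%R by rewrite invr_ge0 ltW.
  have a3' : (0 <= l3^-1)%R by rewrite invr_ge0 ltW.
  have T1 z : (0 <= l1 * C * D1 z + l1^-1 * D1' z)%R by rewrite addr_ge0 // mulr_ge0.
  have T2 z : (0 <= l2 * C * D2 z + l2^-1 * D2' z)%R by rewrite addr_ge0 // mulr_ge0.
  have T3 z : (0 <= l3 * C * D3 z + l3^-1 * D3' z)%R by rewrite addr_ge0 // mulr_ge0.
  have PhiS z : (H z.1 * K z * (F (p z) * G z.2) <= S z)%R.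
    have absorb (E x t l : R) : (0 < l)%R -> (K z ^+ 2 <= C * E)%R ->
        (H z.1 * K z * (F (p z) * G z.2) = (x * K z) * t)%R -> (0 <= x)%R ->
        (H z.1 * K z * (F (p z) * G z.2) <= l * C * (x ^+ 2 * E) + l^-1 * t ^+ 2)%R.
      move=> l0 KEz -> x0; have /le_trans := @young_weighted (x * K z)%R t l l0; apply.
      rewrite lerD2r exprMn (_ : (l * C * (x ^+ 2 * E)) = l * (x ^+ 2 * (C * E)))%R; last by ring.
      by rewrite ler_wpM2l ?(ltW l0) // ler_wpM2l ?sqr_ge0.
    have [k|k|k] := KE z; rewrite /S.
    - apply: (@le_trans _ _ (l1 * C * D1 z + l1^-1 * D1' z)%R); last by rewrite lerDl addr_ge0.
      rewrite /D1 /D1' -(exprMn 2).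
      by apply: absorb => //; ring.
    - apply: (@le_trans _ _ (l2 * C * D2 z + l2^-1 * D2' z)%R); last by rewrite addrCA lerDl addr_ge0.
      rewrite /D2 /D2' -(exprMn 2).
      by apply: absorb => //; ring.
    - apply: (@le_trans _ _ (l3 * C * D3 z + l3^-1 * D3' z)%R); last by rewrite addrA lerDr addr_ge0.
      rewrite /D3 /D3' -(exprMn 2).
      by apply: absorb => //; ring.
  have XS : X%:E <= dint S.
    apply: (le_trans Xle); apply: le_dint => //.
    - by meas.
    - by rewrite /S; meas.
    - by move=> z; rewrite !mulr_ge0.
  have SS : dint S <= ((l1 * C * (C1 * X) + l1^-1 * (A * B)) +
    ((l2 * C * (C2 * B) + l2^-1 * (A * X)) + (l3 * C * (C3 * A) + l3^-1 * (X * B))))%:E.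
    apply: dintD_le; [by meas|by meas|by []|by move=> z; rewrite addr_ge0| |].
      by apply: dintD_le; [by meas|by meas|by move=> z; rewrite mulr_ge0|by move=> z; rewrite mulr_ge0|exact: dintZ_le|exact: dintZ_le].
    apply: dintD_le; [by meas|by meas|by []|by []| |].
      by apply: dintD_le; [by meas|by meas|by move=> z; rewrite mulr_ge0|by move=> z; rewrite mulr_ge0|exact: dintZ_le|exact: dintZ_le].
    by apply: dintD_le; [by meas|by meas|by move=> z; rewrite mulr_ge0|by move=> z; rewrite mulr_ge0|exact: dintZ_le|exact: dintZ_le].
  have := le_trans XS SS; rewrite lee_fin.
  have -> : (l1 * C * (C1 * X) = X / 4)%R.
    by rewrite /l1; field; rewrite (gt_eqF C0) (gt_eqF C10).
  rewrite /l1 invrK.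
  have AX : (l2^-1 * (A * X) <= X / 8)%R.
    rewrite /l2 ler_pdivrMl ?mulr_gt0 //.
    have : (A * X <= A1 * X)%R by rewrite ler_wpM2r.
    by move: (A * X)%R => AX; clear; lra.
  have BX : (l3^-1 * (X * B) <= X / 8)%R.
    rewrite /l3 ler_pdivrMl ?mulr_gt0 //.
    have : (X * B <= X * B1)%R by rewrite ler_wpM2l.
    by move: (X * B)%R => BX; clear; lra.
  have AB : (A * B <= A1 * B1)%R by rewrite ler_pM.
  have e1 : (4 * C * C1 * (A * B) <= 4 * C * C1 * (A1 * B1))%R.
    by rewrite ler_wpM2l // !mulr_ge0 // ltW.
  have e2 : (l2 * C * (C2 * B) <= 8 * C * C2 * (A1 * B1))%R.
    rewrite /l2 (_ : 8 * A1 * C * (C2 * B) = 8 * C * C2 * (A1 * B))%R; last by ring.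
    by rewrite ler_wpM2l ?ler_wpM2l // ?mulr_ge0 // ltW.
  have e3 : (l3 * C * (C3 * A) <= 8 * C * C3 * (A1 * B1))%R.
    rewrite /l3 (_ : 8 * B1 * C * (C3 * A) = 8 * C * C3 * (A * B1))%R; last by ring.
    by rewrite ler_wpM2l ?ler_wpM2r // ?mulr_ge0 // ltW.
  rewrite (_ : 2 * _ * A1 * B1 = 2 * (4 * C * C1 * (A1 * B1) + 8 * C * C2 * (A1 * B1) + 8 * C * C3 * (A1 * B1)))%R; last by ring.
  move: AX BX e1 e2 e3; clear.
  move: (4 * C * C1 * (A * B))%R (_ * (A * X))%R (_ * (X * B))%R (l2 * C * (C2 * B))%R (l3 * C * (C3 * A))%R (4 * C * C1 * (A1 * B1))%R (8 * C * C2 * (A1 * B1))%R (8 * C * C3 * (A1 * B1))%R => *; lra.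
set M := (2 * _)%R in main *.
have M0 : (0 < M)%R by rewrite /M mulr_gt0 // !addr_gt0 // !mulr_gt0.
apply/ler_addgt0Pr => e e0.
(* The excess is [M d (A + B + d)]; since [d <= 1] it is at most [d M (A + B + 1)], which the second
   entry of the minimum keeps below [e]. *)
pose d := (Num.min 1 (e / (M * (A + B + 1))))%R.
have MAB : (0 < M * (A + B + 1))%R by rewrite mulr_gt0 // ltr_wpDl // addr_ge0.
have d0 : (0 < d)%R by rewrite lt_min ltr01 divr_gt0.
have d1 : (d <= 1)%R by rewrite ge_min lexx.
have de : (d * (M * (A + B + 1)) <= e)%R by rewrite -ler_pdivlMr // ge_min lexx orbT.
have leD (x : R) : (x <= x + d)%R by rewrite lerDl ltW.
have := main (A + d)%R (B + d)%R (ltr_wpDl A0 d0) (ltr_wpDl B0 d0) (leD A) (leD B).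
move=> /le_trans; apply.
have : (M * (d * d) <= M * (d * 1))%R by rewrite ler_wpM2l ?(ltW M0) // ler_wpM2l // ltW.
move: de; clear; nra.
Qed.

End bilinear_estimate.

(** * The bilinear estimate with the Bourgain weights *)

Section weighted_bilinear_estimate.
Context {R : realType}.
Local Open Scope ereal_scope.
Local Notation h := (@jweight R).

Lemma measurable_wX (s a : R) : measurable_fun setT (wX s a).
Proof.
have mj := @measurable_japanese R; have mX := @measurable_modX R.
by rewrite /wX; meas.
Qed.

Lemma measurable_wY (nu s a : R) : measurable_fun setT (wY nu s a).
Proof.
have mj := @measurable_japanese R; have mY := @measurable_modY R nu.
by rewrite /wY; meas.
Qed.

(** The output is tested against itself: in the square of [wX s (c - 1) q * P q] one factor is kept
    as the test function [H] and the other is bounded through the convolution, so the trilinear form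
    dominates [X]. *)
Lemma bilinear_weighted (nu s s' b b' c : R) : (`|nu| != 1)%R ->
  (0 <= s)%R -> (- (1 / 2) <= s')%R -> (1 / 2 < b)%R -> (1 / 2 < b')%R ->
  (1 / 2 < c)%R -> (c < 1)%R -> (s - s' <= 2 * (1 - c))%R ->
  exists2 C : R, (0 < C)%R & forall (P U V : R * R -> R) (X A B : R),
    measurable_fun setT P -> measurable_fun setT U -> measurable_fun setT V ->
    (forall q, 0 <= P q)%R -> (forall q, 0 <= U q)%R -> (forall q, 0 <= V q)%R ->
    (forall q, (P q)%:E <=
       \int[lebesgue2]_r (U (q.1 - r.1, q.2 - r.2)%R * V r)%:E) ->
    \int[lebesgue2]_q ((wX s (c - 1) q * P q) ^+ 2)%:E = X%:E ->
    \int[lebesgue2]_q ((wX s b q * U q) ^+ 2)%:E = A%:E ->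
    \int[lebesgue2]_q ((wY nu s' b' q * V q) ^+ 2)%:E = B%:E ->
    (X <= C * A * B)%R.
Proof.
move=> nu1 s0 s'h hb hb' hc c1 ss'.
pose g := (2 * Num.min b b')%R.
have g1 : (1 < g)%R by rewrite /g -ltr_pdivrMl // lt_min; apply/andP; split; lra.
have gb : (g <= 2 * b)%R by rewrite /g ler_wpM2l // ge_min lexx.
have gb' : (g <= 2 * b')%R by rewrite /g ler_wpM2l // ge_min lexx orbT.
have [C C0 KC] := kernel_bound nu1 s0 s'h g1 gb gb' hc c1 ss'.
have [C1 C10 HC1] := integral_resonance_X g1 nu1.
have [C2 C20 HC2] := integral_resonance_Y g1.
have [C3 C30 HC3] := integral_resonance_XY g1 nu1.
exists (2 * (4 * C * C1 + 8 * C * C2 + 8 * C * C3))%R.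
  by rewrite mulr_gt0 // !addr_gt0 // !mulr_gt0.
move=> P U V X A B mP mU mV P0 U0 V0 PUV HX HA HB.
have mj := @measurable_jweight R g; have mX := @measurable_modX R.
have mY := @measurable_modY R nu.
have mw0 := measurable_wX s (c - 1); have mw1 := measurable_wX s b.
have mw2 := measurable_wY nu s' b'.
pose H q := (wX s (c - 1) q * P q)%R; pose F q := (wX s b q * U q)%R.
pose G q := (wY nu s' b' q * V q)%R.
pose p (z : (R * R) * (R * R)) := (z.1.1 - z.2.1, z.1.2 - z.2.2)%R.
have mp : measurable_fun setT p by rewrite /p; meas.
have mp1 : measurable_fun setT (fun z => wX s b (p z)) := measurableT_comp mw1 mp.
have mp2 : measurable_fun setT (fun z => modX (p z)) := measurableT_comp mX mp.
(* The inverse is written as a real power so that measurability of powers applies; [KE] restores the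
   quotient. *)
pose K z := (wX s (c - 1) z.1 * (wX s b (p z) * wY nu s' b' z.2) `^ (-1))%R.
have KE z : K z = (wX s (c - 1) z.1 / (wX s b (p z) * wY nu s' b' z.2))%R.
  by rewrite /K powR_inv1 // mulr_ge0 // ltW // ?wX_gt0 ?wY_gt0.
have K0 z : (0 <= K z)%R.
  by rewrite mulr_ge0 ?powR_ge0 // ltW // wX_gt0.
have w00 q : (0 <= wX s (c - 1) q)%R := ltW (wX_gt0 _ _ _).
have w10 q : (0 <= wX s b q)%R := ltW (wX_gt0 _ _ _).
have w20 q : (0 <= wY nu s' b' q)%R := ltW (wY_gt0 _ _ _ _).
have H0 q : (0 <= H q)%R by exact: mulr_ge0.
have F0 q : (0 <= F q)%R by exact: mulr_ge0.
have G0 q : (0 <= G q)%R by exact: mulr_ge0.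
pose big := [set r : R * R | (1 <= `|r.2|)%R].
have mbig : measurable big.
  have m2 : measurable_fun setT (fun r : R * R => `|r.2|)%R by meas.
  have -> : big = (fun r : R * R => `|r.2|)%R @^-1` [set` `[1%R, +oo[%R].
    by apply/seteqP; split => r /=; rewrite /big /= in_itv /= andbT.
  by rewrite -[X in measurable X]setTI; exact: m2.
pose E1 z := ((1 + `|2 * (nu * `|z.2.2| + z.2.2 - z.1.2)|)
  * (h g (modY nu z.2) * h g (modX (p z))))%R.
(* The indicator extends the slice bound, which requires [|r.2| >= 1], to every [r]; the kernel
   bound selects this case only when [|r.2| >= 1]. *)
pose E2 z := (\1_big z.2 * (h g (modX z.1) * h g (modX (p z))))%R.
pose E3 (z : (R * R) * (R * R)) := (h g (modX z.1) * h g (modY nu z.2))%R.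
have mind : measurable_fun setT (\1_big : R * R -> R) by exact: measurable_indic.
have mind2 : measurable_fun setT (fun z : (R * R) * (R * R) => \1_big z.2 : R).
  exact: (measurableT_comp mind measurable_snd).
have mH : measurable_fun setT H := measurable_funM mw0 mP.
have mF : measurable_fun setT F := measurable_funM mw1 mU.
have mG : measurable_fun setT G := measurable_funM mw2 mV.
have mK : measurable_fun setT K.
  apply: measurable_funM; first exact: (measurableT_comp mw0 measurable_fst).
  apply: (measurableT_comp (measurable_powR _)).
  by apply: measurable_funM; [exact: mp1|exact: (measurableT_comp mw2 measurable_snd)].
have hX1 : measurable_fun setT (fun z : (R * R) * (R * R) => h g (modX z.1)).
  exact: (measurableT_comp mj (measurableT_comp mX measurable_fst)).
have hXp : measurable_fun setT (fun z => h g (modX (p z))) := measurableT_comp mj mp2.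
have hY2 : measurable_fun setT (fun z : (R * R) * (R * R) => h g (modY nu z.2)).
  exact: (measurableT_comp mj (measurableT_comp mY measurable_snd)).
have mE1 : measurable_fun setT E1.
  apply: measurable_funM; last exact: (measurable_funM hY2 hXp).
  by clear; meas.
have mE2 : measurable_fun setT E2 := measurable_funM mind2 (measurable_funM hX1 hXp).
have mE3 : measurable_fun setT E3 := measurable_funM hX1 hY2.
have E10 z : (0 <= E1 z)%R by rewrite mulr_ge0 ?mulr_ge0 ?addr_ge0.
have E20 z : (0 <= E2 z)%R by rewrite mulr_ge0 ?mulr_ge0 // indicE.
have E30 z : (0 <= E3 z)%R by rewrite mulr_ge0.
apply: (trilinear_bound C0 C10 C20 C30 mH mF mG mK mE1 mE2 mE3 H0 F0 G0 K0 E10 E20 E30 _ HC1 _ HC3 HX HA HB).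
- move=> [q r]; rewrite KE; have [k|[r1 k]|k] := KC q r.
  + by apply: Or31.
  + by apply: Or32; rewrite /E2 /= indicE mem_set // mul1r.
  + by apply: Or33.
- move=> r; rewrite /E2 /=; have [r1|r1] := boolP (r \in big).
    rewrite indicE r1; under eq_integral do rewrite mul1r.
    by apply: HC2; exact: set_mem r1.
  rewrite indicE (negbTE r1); under eq_integral do rewrite mul0r.
  by rewrite integral0 lee_fin ltW.
- rewrite -HX /dint; apply: ge0_le_integral => //.
  + by move=> q _; rewrite lee_fin sqr_ge0.
  + by meas.
  + apply: (@measurable_dint_inner _ (fun z => H z.1 * K z * (F (p z) * G z.2))%R).
      have mFp : measurable_fun setT (fun z => F (p z)) := measurableT_comp mF mp.
      apply: measurable_funM; last exact: (measurable_funM mFp (measurableT_comp mG measurable_snd)).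
      exact: (measurable_funM (measurableT_comp mH measurable_fst) mK).
    by move=> z; apply: mulr_ge0; exact: mulr_ge0.
  move=> q _ /=.
  apply: (@le_trans _ _ ((H q * wX s (c - 1) q)%:E *
      \int[lebesgue2]_r (U (q.1 - r.1, q.2 - r.2)%R * V r)%:E)).
    rewrite (_ : (wX s (c - 1) q * P q) ^+ 2 = H q * wX s (c - 1) q * P q)%R; last by rewrite /H; ring.
    rewrite EFinM lee_wpmul2l // lee_fin.
    by rewrite mulr_ge0.
  have mq : measurable_fun setT (fun r : R * R => (q.1 - r.1, q.2 - r.2))%R by meas.
  have mUq : measurable_fun setT (fun r : R * R => U (q.1 - r.1, q.2 - r.2)%R) := measurableT_comp mU mq.
  rewrite -ge0_integral_EFinZl; [|by rewrite mulr_ge0|by meas|by move=> r; rewrite mulr_ge0].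
  rewrite le_eqVlt; apply/orP; left; apply/eqP; apply: eq_integral => r _.
  congr EFin; rewrite KE /F /G /p /=.
  have w1 := wX_gt0 s b (q.1 - r.1, q.2 - r.2)%R; have w2 := wY_gt0 nu s' b' r.
  move: (H q) (wX s (c - 1) q) (wX s b _) (wY nu s' b' r) w1 w2 => x1 x2 x3 x4 w1 w2.
  by field; rewrite (gt_eqF w1) (gt_eqF w2).
Qed.

End weighted_bilinear_estimate.

(** * Schwartz functions *)

Section schwartz_algebra.
Context {R : realType}.
Implicit Types (f g : R * R -> R) (w : seq bool).

Definition dir (d : bool) : R * R := if d then (0, 1) else (1, 0).

Definition partial (d : bool) g : R * R -> R := fun p => 'D_(dir d) g p.

Lemma iter_partial_rcons w d g : iter_partial (rcons w d) g = iter_partial w (partial d g).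
Proof. by elim: w => //= d' w ->. Qed.

Definition decreasing g : Prop := forall j k : nat, exists M : R, forall p : R * R,
  `|p.1| ^+ j * `|p.2| ^+ k * `|g p| <= M.

Definition nice g : Prop := (forall p, differentiable g p) /\ decreasing g.

(* [iter_partial] adds derivatives on the outside; peeling them off from the
   inside makes the product rule an induction on the order. *)
Fixpoint schwartz_upto (n : nat) g : Prop :=
  if n is n'.+1 then nice g /\ forall d, schwartz_upto n' (partial d g) else nice g.

Lemma schwartz_uptoP g : real_schwartz g <-> forall n, schwartz_upto n g.
Proof.
split=> [[sg dg] n|ng].
  suff H w m : schwartz_upto m (iter_partial w g) by exact: (H [::] n).
  elim: m w => [|m IH] w /=; first by split; [exact: sg|exact: dg].
  by split=> [|d]; [split; [exact: sg|exact: dg]|exact: (IH (d :: w))].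
have N w f n : schwartz_upto (n + size w) f -> nice (iter_partial w f).
  elim/last_ind: w n f => [|w d IH] n f.
    by rewrite addn0; case: n => [|n] //= [].
  by rewrite size_rcons addnS iter_partial_rcons /= => -[_ /(_ d)]; exact: IH.
by split=> w; have [] := N w g 0%N (ng _).
Qed.

Lemma schwartz_uptoS n g : schwartz_upto n.+1 g -> schwartz_upto n g.
Proof. by elim: n g => [|n IH] g [ng dg] //; split => // d; exact/IH/dg. Qed.

Lemma nice_derivable g p v : nice g -> derivable g p v.
Proof. by move=> [dg _]; exact/diff_derivable/dg. Qed.

Lemma decreasing_bound g : decreasing g -> forall j k : nat, exists2 M : R, 0 <= M &
  forall p : R * R, `|p.1| ^+ j * `|p.2| ^+ k * `|g p| <= M.
Proof.
move=> dg j k; have [M HM] := dg j k; exists M => //.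
by apply: le_trans (HM (0, 0)); rewrite !mulr_ge0 ?exprn_ge0.
Qed.

(** The form [f + c g] serves the product rule with [c = 1] and differences with [c = - 1]. *)
Lemma decreasingDM f g (c : R) : decreasing f -> decreasing g ->
  decreasing (fun p => f p + c * g p).
Proof.
move=> df dg j k; have [M HM] := df j k; have [N HN] := dg j k.
exists (M + `|c| * N) => p.
have t0 : 0 <= `|p.1| ^+ j * `|p.2| ^+ k by rewrite mulr_ge0 ?exprn_ge0.
apply: (le_trans (ler_wpM2l t0 (ler_normD _ _))); rewrite mulrDr lerD // normrM mulrCA.
by rewrite ler_wpM2l.
Qed.

Lemma decreasingM f g : decreasing f -> decreasing g -> decreasing (fun p => f p * g p).
Proof.
move=> df dg j k; have [M M0 HM] := decreasing_bound df j k.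
have [N N0 HN] := decreasing_bound dg 0 0.
exists (M * N) => p; rewrite normrM mulrA ler_pM ?mulr_ge0 ?exprn_ge0 //.
by have := HN p; rewrite !expr0 !mul1r.
Qed.

Lemma partialDM d f g (c : R) : nice f -> nice g ->
  partial d (fun p => f p + c * g p) = (fun p => partial d f p + c * partial d g p).
Proof.
move=> nf ng; apply/funext => p; rewrite /partial.
have df := @nice_derivable f p (dir d) nf; have dg := @nice_derivable g p (dir d) ng.
have := deriveD df (derivableZ (k := c) dg).
by rewrite deriveZ.
Qed.

Lemma partialM d f g : nice f -> nice g ->
  partial d (fun p => f p * g p) = (fun p => f p * partial d g p + 1 * (g p * partial d f p)).
Proof.
move=> nf ng; apply/funext => p; rewrite /partial mul1r.
by have := deriveM (@nice_derivable f p (dir d) nf) (@nice_derivable g p (dir d) ng).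
Qed.

Lemma niceDM f g (c : R) : nice f -> nice g -> nice (fun p => f p + c * g p).
Proof.
move=> [df rf] [dg rg]; split; last exact: decreasingDM.
by move=> p; apply: (@differentiableD _ _ _ f (c *: g)) => //; exact: differentiableZ.
Qed.

Lemma niceM f g : nice f -> nice g -> nice (fun p => f p * g p).
Proof.
move=> [df rf] [dg rg]; split; last exact: decreasingM.
by move=> p; exact: (@differentiableM _ _ f g).
Qed.

Lemma schwartz_uptoDM n f g (c : R) : schwartz_upto n f -> schwartz_upto n g ->
  schwartz_upto n (fun p => f p + c * g p).
Proof.
elim: n f g => [|n IH] f g; first exact: niceDM.
move=> [nf df] [ng dg]; split; first exact: niceDM.
by move=> d; rewrite partialDM //; apply: IH; [exact: df|exact: dg].
Qed.

Lemma schwartz_uptoM n f g : schwartz_upto n f -> schwartz_upto n g ->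
  schwartz_upto n (fun p => f p * g p).
Proof.
elim: n f g => [|n IH] f g; first exact: niceM.
move=> sf sg; have [nf df] := sf; have [ng dg] := sg; split; first exact: niceM.
move=> d; rewrite partialM //; apply: schwartz_uptoDM.
  by apply: IH; [exact: schwartz_uptoS|exact: dg].
by apply: IH; [exact: schwartz_uptoS|exact: df].
Qed.

Lemma real_schwartzDM f g (c : R) : real_schwartz f -> real_schwartz g ->
  real_schwartz (fun p => f p + c * g p).
Proof.
move=> /schwartz_uptoP sf /schwartz_uptoP sg; apply/schwartz_uptoP => n.
exact: schwartz_uptoDM.
Qed.

Lemma real_schwartzM f g : real_schwartz f -> real_schwartz g ->
  real_schwartz (fun p => f p * g p).
Proof.
move=> /schwartz_uptoP sf /schwartz_uptoP sg; apply/schwartz_uptoP => n.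
exact: schwartz_uptoM.
Qed.

Lemma real_schwartz_partial d g : real_schwartz g -> real_schwartz (partial d g).
Proof.
move=> /schwartz_uptoP sg; apply/schwartz_uptoP => n.
by have [_ dg] := sg n.+1; exact: dg.
Qed.

Lemma real_schwartz_nice g : real_schwartz g -> nice g.
Proof. by move=> /schwartz_uptoP/(_ 0%N). Qed.

Lemma real_schwartz_continuous g : real_schwartz g -> continuous g.
Proof. by move=> /real_schwartz_nice[dg _] p; exact: (differentiable_continuous (dg p)). Qed.

Lemma real_schwartz_measurable g : real_schwartz g -> measurable_fun setT g.
Proof. by move=> sg; apply: continuous2_measurable; exact: real_schwartz_continuous. Qed.

(** Expanding [(1 + t ^ 2) (1 + x ^ 2)] leaves four monomials, each bounded against [g]; the
    resulting majorant is integrable on the plane. *)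
Lemma real_schwartz_bound g : real_schwartz g -> exists2 M : R, 0 <= M &
  forall p, `|g p| <= M * (jweight 2 p.1 * jweight 2 p.2).
Proof.
move=> /real_schwartz_nice[_ dg].
have [M1 M10 H1] := decreasing_bound dg 0 0; have [M2 M20 H2] := decreasing_bound dg 2 0.
have [M3 M30 H3] := decreasing_bound dg 0 2; have [M4 M40 H4] := decreasing_bound dg 2 2.
exists (M1 + M2 + M3 + M4) => [|p]; first by rewrite !addr_ge0.
have E (x : R) : jweight 2 x = (1 + `|x| ^+ 2)^-1.
  by rewrite /jweight powR_invn // japanese_sqr real_normK ?num_real.
rewrite !E -invfM ler_pdivlMr; last first.
  by rewrite mulr_gt0 // ltr_pwDl ?exprn_ge0.
have := H1 p; have := H2 p; have := H3 p; have := H4 p; rewrite !expr0 !mul1r !mulr1.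
move: (`|p.1| ^+ 2) (`|p.2| ^+ 2) (`|g p|) => a b x h4 h3 h2 h1.
rewrite (_ : x * ((1 + a) * (1 + b)) = x + a * x + b * x + a * b * x); last by ring.
by rewrite !lerD.
Qed.

Local Open Scope complex_scope.

Lemma schwartzB (u v : R * R -> R[i]) : schwartz u -> schwartz v ->
  schwartz (fun p => u p - v p).
Proof.
move=> [ur ui] [vr vi]; split.
  have -> : (fun p => complex.Re (u p - v p)) = (fun p => complex.Re (u p) + (-1) * complex.Re (v p)).
    by apply/funext => p; case: (u p) (v p) => [a b] [c d] /=; rewrite mulN1r.
  exact: real_schwartzDM.
have -> : (fun p => complex.Im (u p - v p)) = (fun p => complex.Im (u p) + (-1) * complex.Im (v p)).
  by apply/funext => p; case: (u p) (v p) => [a b] [c d] /=; rewrite mulN1r.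
exact: real_schwartzDM.
Qed.

Lemma schwartzM (u v : R * R -> R[i]) : schwartz u -> schwartz v ->
  schwartz (fun p => u p * v p).
Proof.
move=> [ur ui] [vr vi]; split.
  have -> : (fun p => complex.Re (u p * v p)) = (fun p => complex.Re (u p) * complex.Re (v p) + (-1) * (complex.Im (u p) * complex.Im (v p))).
    by apply/funext => p; case: (u p) (v p) => [a b] [c d] /=; rewrite mulN1r.
  by apply: real_schwartzDM; exact: real_schwartzM.
have -> : (fun p => complex.Im (u p * v p)) = (fun p => complex.Re (u p) * complex.Im (v p) + 1 * (complex.Im (u p) * complex.Re (v p))).
  by apply/funext => p; case: (u p) (v p) => [a b] [c d] /=; rewrite mul1r.
by apply: real_schwartzDM; exact: real_schwartzM.
Qed.

End schwartz_algebra.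

(** * Line integrals *)

Section line_integrals.
Context {R : realType}.
Local Notation mu := (@lebesgue_measure R).

Lemma is_derive_continuous (F f : R -> R) : (forall x : R, is_derive x (1 : R) F (f x)) -> continuous F.
Proof.
move=> dF x; apply: differentiable_continuous; apply/derivable1_diffP.
by have [] := dF x.
Qed.

Lemma integral_itv_is_derive (f g F : R -> R) (a b : R) : a < b ->
  (forall x : R, is_derive x (1 : R) F (g x)) -> continuous g ->
  {in `[a, b], f =1 g} ->
  (\int[mu]_(x in `[a, b]) (f x)%:E = (F b - F a)%:E)%E.
Proof.
move=> ab dF cg fg; have cF := is_derive_continuous dF.
transitivity (\int[mu]_(x in `[a, b]) (g x)%:E)%E.
  by apply: eq_integral => x /set_mem /= xab; rewrite fg.
rewrite (@continuous_FTC2 _ g F) ?EFinB //.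
- exact: continuous_subspaceT.
- split.
  + by move=> x _; have [] := dF x.
  + by apply: cvg_at_right_filter; exact: cF.
  + by apply: cvg_at_left_filter; exact: cF.
- by move=> x _; rewrite derive1E; exact: (@derive_val _ _ _ _ _ _ _ (dF x)).
Qed.

(* Two antiderivatives are allowed, to cover integrands with a kink at [0]. *)
Lemma integral_line_is_derive (f f1 f2 F1 F2 : R -> R) (l1 l2 : R) :
  mu.-integrable setT (EFin \o f) ->
  (forall x : R, is_derive x (1 : R) F1 (f1 x)) -> continuous f1 -> (forall x, 0 <= x -> f x = f1 x) ->
  (forall x : R, is_derive x (1 : R) F2 (f2 x)) -> continuous f2 -> (forall x, x <= 0 -> f x = f2 x) ->
  F1 n.+1%:R @[n --> \oo] --> l1 -> F2 (- n.+1%:R) @[n --> \oo] --> l2 ->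
  (\int[mu]_x (f x)%:E = ((l1 - F1 0) + (F2 0 - l2))%:E)%E.
Proof.
move=> intf dF1 cf1 ff1 dF2 cf2 ff2 Fl1 Fl2.
have mf := measurable_int _ intf.
have mf' : measurable_fun setT f by exact/measurable_EFinP.
(* The point [0] belongs to the right-hand interval only, so the pieces are disjoint, and [n.+1]
   keeps them nondegenerate; dominated convergence then exhausts the line. *)
pose A n : set (measurableTypeR R) := [set` `[0, n.+1%:R]%R]; pose B n : set (measurableTypeR R) := [set` `[- n.+1%:R, 0[%R].
have mA n : measurable (A n) by exact: measurable_itv.
have mB n : measurable (B n) by exact: measurable_itv.
pose fA n := (EFin \o f) \_ (A n); pose fB n := (EFin \o f) \_ (B n).
have mfA n : measurable_fun setT (fA n) by apply/(measurable_restrictT _ (mA n)); exact: measurable_funTS.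
have mfB n : measurable_fun setT (fB n) by apply/(measurable_restrictT _ (mB n)); exact: measurable_funTS.
have iA n : mu.-integrable setT (fA n).
  exact: (@integrable_mkcond _ _ _ mu (A n) (EFin \o f) (mA n)).1 (integrableS measurableT (mA n) (@subsetT _ _) intf).
have iB n : mu.-integrable setT (fB n).
  exact: (@integrable_mkcond _ _ _ mu (B n) (EFin \o f) (mB n)).1 (integrableS measurableT (mB n) (@subsetT _ _) intf).
have split0 n x : (`|fA n x + fB n x| <= `|(f x)%:E|)%E.
  rewrite /fA /fB !patchE.
  have [xA|xA] := boolP (x \in A n); have [xB|xB] := boolP (x \in B n).
  - move: xA xB => /set_mem xA /set_mem xB; move: xA xB.
    rewrite /A /B /= !in_itv /= => /andP[x0 _] /andP[_].
    by rewrite ltNge x0.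
  - by rewrite adde0.
  - by rewrite add0e.
  - by rewrite adde0 abse0.
have dom := @dominated_cvg _ _ _ mu setT measurableT (fun n x => fA n x + fB n x)%E (EFin \o f) (fun x => `|(f x)%:E|)%E.
have lim1 : (\int[mu]_x (fA n x + fB n x) @[n --> \oo] --> \int[mu]_x (f x)%:E)%E.
  apply: dom => //.
  - by move=> n; exact: emeasurable_funD.
  - move=> x _; apply: cvg_near_cst.
    near=> n; have xn : `|x| <= n.+1%:R.
      apply: (le_trans (ltW (truncnS_gt _))); rewrite ler_nat ltnS.
      by near: n; exact: nbhs_infty_ge.
    move: xn; rewrite ler_norml => /andP[xl xr].
    rewrite /fA /fB !patchE; have [x0|x0] := leP 0 x.
      rewrite mem_set; last by rewrite /A /= in_itv /= x0.
      by rewrite memNset ?adde0 // /B /= in_itv /= => /andP[_]; rewrite ltNge x0.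
    rewrite memNset; last by rewrite /A /= in_itv /= leNgt x0.
    by rewrite mem_set ?add0e // /B /= in_itv /= xl.
  - exact: integrable_abse.
have val n : (\int[mu]_x (fA n x + fB n x) = ((F1 n.+1%:R - F1 0) + (F2 0 - F2 (- n.+1%:R)))%:E)%E.
  rewrite integralD // EFinD; congr (_ + _)%E.
    rewrite /fA -integral_mkcond; apply: (integral_itv_is_derive (ltr0Sn R n) dF1 cf1).
    by move=> x; rewrite in_itv /= => /andP[x0 _]; exact: ff1.
  rewrite /fB -integral_mkcond integral_itv_bndo_bndc; last exact: measurable_funTS.
  have n0 : - n.+1%:R < 0 :> R by rewrite oppr_lt0.
  apply: (integral_itv_is_derive n0 dF2 cf2).
  by move=> x; rewrite in_itv /= => /andP[_ x0]; exact: ff2.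
have lim2 : (\int[mu]_x (fA n x + fB n x) @[n --> \oo] --> ((l1 - F1 0) + (F2 0 - l2))%:E)%E.
  rewrite (_ : (fun n => _) = (fun n => ((F1 n.+1%:R - F1 0) + (F2 0 - F2 (- n.+1%:R)))%:E)); last exact/funext.
  apply: cvg_EFin; first exact: nearW.
  by apply: cvgD; apply: cvgB => //; exact: cvg_cst.
exact: (cvg_unique _ lim1 lim2).
Unshelve. all: by end_near. Qed.

Lemma integrable_jweight (g : R) : 1 < g -> mu.-integrable setT (EFin \o jweight g).
Proof.
move=> g1; have [C C0 HC] := integral_jweight_affine g1.
have mj := @measurable_jweight R g.
apply/integrableP; split; first by meas.
apply: (@le_lt_trans _ _ C%:E); last exact: ltry.
under eq_integral do rewrite /= ger0_norm //.
apply: le_trans (HC 1 0 _); last by rewrite normr1.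
by under [leRHS]eq_integral do rewrite mul1r addr0.
Qed.

End line_integrals.

(** * Integrals of damped trigonometric functions and the Cauchy density *)

Section abel_kernel.
Context {R : realType}.
Local Notation mu := (@lebesgue_measure R).
Local Notation h := (@jweight R).

Lemma sqr1_gt0 (x : R) : 0 < 1 + x ^+ 2.
Proof. by rewrite ltr_pwDl // sqr_ge0. Qed.

Lemma jweight2E (x : R) : h 2 x = (1 + x ^+ 2)^-1.
Proof. by rewrite /jweight powR_invn // japanese_sqr. Qed.

Lemma cvg0_jweight (F : R -> R) (C : R) : (forall x, `|F x| <= C * h 2 x) ->
  F n.+1%:R @[n --> \oo] --> 0 /\ F (- n.+1%:R) @[n --> \oo] --> 0.
Proof.
move=> FC; have C0 : 0 <= C.
  have := le_trans (normr_ge0 _) (FC 0); by rewrite pmulr_lge0.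
have B (s : nat -> R) : (forall n, s n ^+ 2 = n.+1%:R ^+ 2) -> F (s n) @[n --> \oo] --> 0.
  move=> sn; apply: norm_cvg0.
  apply: (@squeeze_cvgr _ _ _ _ (cst 0) (fun n => C * harmonic n)).
  - apply: nearW => n; rewrite normr_ge0 /=; apply: (le_trans (FC _)).
    rewrite ler_wpM2l // jweight2E sn /harmonic lef_pV2 ?posrE ?sqr1_gt0 //.
    have : 1 <= n.+1%:R :> R by rewrite ler1n.
    by move: (n.+1%:R) => y; nra.
  - exact: cvg_cst.
  - by rewrite -[X in _ --> X](mulr0 C); apply: cvgM; [exact: cvg_cst|exact: cvg_harmonic].
by split; apply: B => n; rewrite ?sqrrN.
Qed.

(** Squaring [expR y >= 1 + y] at [y = e |x| / 2] gives [exp (e |x|) >= (1 + e |x| / 2) ^ 2 >= m ^ 2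
    (1 + x ^ 2)] with [m = min (1, e / 2)]. *)
Lemma expR_abs_le (e : R) : 0 < e -> exists2 C : R, 0 < C &
  forall x, expR (- (e * `|x|)) <= C * h 2 x.
Proof.
move=> e0; pose m := Num.min 1 (e / 2).
have m0 : 0 < m by rewrite lt_min ltr01 divr_gt0.
have m1 : m <= 1 by rewrite ge_min lexx.
have me : m <= e / 2 by rewrite ge_min lexx orbT.
exists ((m ^+ 2)^-1) => [|x]; first by rewrite invr_gt0 exprn_gt0.
rewrite jweight2E -invfM expRN lef_pV2 ?posrE ?expR_gt0 ?mulr_gt0 ?exprn_gt0 ?sqr1_gt0 //.
have -> : expR (e * `|x|) = expR (e / 2 * `|x|) ^+ 2.
  by rewrite expr2 -expRD; congr expR; field.
have := expR_ge1Dx (e / 2 * `|x|); move: (expR _) => y.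
have -> : x ^+ 2 = `|x| ^+ 2 by rewrite real_normK ?num_real.
move: (normr_ge0 x); move: (`|x|) => z z0 yle.
have mz : m * z <= e / 2 * z by rewrite ler_wpM2r.
have mz0 : 0 <= m * z by rewrite mulr_ge0 // ltW.
have : (m + m * z) ^+ 2 <= y ^+ 2.
  by rewrite ler_sqr ?nnegrE; move: m0 m1 mz mz0 yle; clear; lra.
have : 0 <= m ^+ 2 * (2 * z) by rewrite mulr_ge0 ?sqr_ge0 // mulr_ge0.
by clear; nra.
Qed.

Lemma measurable_expR_abs (e : R) : measurable_fun setT (fun x : R => expR (- (e * `|x|))).
Proof. have mE := @measurable_expR R; by meas. Qed.

Lemma integrable_expR_abs_mul (e : R) (f : R -> R) : 0 < e ->
  measurable_fun setT f -> (forall x, `|f x| <= 1) ->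
  mu.-integrable setT (EFin \o (fun x : R => expR (- (e * `|x|)) * f x)).
Proof.
move=> e0 mf f1; have [C C0 HC] := expR_abs_le e0.
have ih := @integrable_jweight R 2 (ltr1n R 2).
have mE := measurable_expR_abs e.
apply: (@le_integrable _ _ _ mu setT measurableT _ (fun x => (C * h 2 x)%:E)).
- by meas.
- move=> x _ /=; rewrite lee_fin normrM (ger0_norm (expR_ge0 _)).
  rewrite [leRHS]ger0_norm ?mulr_ge0 ?(ltW C0) //.
  apply: le_trans (HC x); rewrite ler_piMr // expR_ge0.
- by have := integrableZl measurableT C ih.
Qed.

Lemma is_derive_scale (f df : R -> R) (k x : R) :
  (forall y : R, is_derive y (1 : R) f (df y)) ->
  is_derive x (1 : R) (fun y : R => f (k * y)) (k * df (k * x)).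
Proof.
move=> H; have h1 : is_derive x (1 : R) (fun y => k * y) k.
  have := @is_deriveZ _ _ _ (@id R) k x 1 1 (is_derive_id x 1).
  by rewrite /GRing.scale /= mulr1.
have := @is_derive1_comp R f (fun y => k * y) x _ _ (H (k * x)) h1.
by rewrite mulrC.
Qed.

(** The span of the damped sine and cosine is stable under differentiation, so antiderivatives come
    from a linear system of size two. *)
Lemma is_derive_expR_trig (e w a b x : R) :
  is_derive x (1 : R) (fun y : R => expR (e * y) * (a * sin (w * y) + b * cos (w * y)))
    (expR (e * x) * ((e * a - w * b) * sin (w * x) + (w * a + e * b) * cos (w * x))).
Proof.
have h1 := is_derive_scale e x (@is_derive_expR R).
have h2 := is_derive_scale w x (@is_derive_sin R).
have h3 := is_derive_scale w x (@is_derive_cos R).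
have h4 := is_deriveM h1 (is_deriveD (is_deriveZ a h2) (is_deriveZ b h3)).
apply: (is_derive_eq h4).
transitivity (expR (e * x) * (a * (w * cos (w * x)) + b * (w * - sin (w * x)))
  + (a * sin (w * x) + b * cos (w * x)) * (e * expR (e * x))); first by [].
by ring.
Qed.

Lemma continuous_expR_trig (e w a b : R) :
  continuous (fun y : R => expR (e * y) * (a * sin (w * y) + b * cos (w * y))).
Proof. by apply: is_derive_continuous => x; exact: is_derive_expR_trig. Qed.

Lemma expR_trig_bound (e w a b : R) : 0 < e -> exists C : R, forall x : R,
  `|expR (- (e * `|x|)) * (a * sin (w * x) + b * cos (w * x))| <= C * h 2 x.
Proof.
move=> e0; have [C C0 HC] := expR_abs_le e0.
exists ((`|a| + `|b|) * C) => x.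
rewrite normrM (ger0_norm (expR_ge0 _)) mulrC -mulrA.
apply: ler_pM; [exact: normr_ge0|exact: expR_ge0| |exact: HC].
have s1 : `|sin (w * x)| <= 1 by rewrite ler_norml sin_geN1 sin_le1.
have c1 : `|cos (w * x)| <= 1 by rewrite ler_norml cos_geN1 cos_le1.
apply: (le_trans (ler_normD _ _)); by rewrite !normrM lerD // ler_piMr.
Qed.

Lemma integral_expR_trig (e w A B : R) : 0 < e ->
  (\int[mu]_x (expR (- (e * `|x|)) * (A * sin (w * x) + B * cos (w * x)))%:E
   = (B * (2 * e / (e ^+ 2 + w ^+ 2)))%:E)%E.
Proof.
move=> e0; pose D := e ^+ 2 + w ^+ 2.
have D0 : D != 0 by rewrite gt_eqF // ltr_pwDl ?exprn_gt0 ?sqr_ge0.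
(* Solutions of the systems [E1] and [E2], of determinant [D], for the half-lines where [|x|] is [x]
   and [- x]. At [0] the antiderivatives are [b1] and [b2], and the sine part cancels in
   [b2 - b1]. *)
pose a1 := (- e * A + w * B) / D; pose b1 := (- w * A - e * B) / D.
pose a2 := (e * A + w * B) / D; pose b2 := (- w * A + e * B) / D.
pose G (e' a b x : R) := expR (e' * x) * (a * sin (w * x) + b * cos (w * x)).
have E1 : (- e * a1 - w * b1 = A) /\ (w * a1 + - e * b1 = B).
  by rewrite /a1 /b1; split; rewrite !mulrA -?mulNr -mulrDl -?mulrBl; apply: (mulIf D0); rewrite divfK // /D; ring.
have E2 : (e * a2 - w * b2 = A) /\ (w * a2 + e * b2 = B).
  by rewrite /a2 /b2; split; rewrite !mulrA -?mulNr -mulrDl -?mulrBl; apply: (mulIf D0); rewrite divfK // /D; ring.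
have d1 x : is_derive x (1 : R) (G (- e) a1 b1) (G (- e) A B x).
  by have := is_derive_expR_trig (- e) w a1 b1 x; rewrite E1.1 E1.2.
have d2 x : is_derive x (1 : R) (G e a2 b2) (G e A B x).
  by have := is_derive_expR_trig e w a2 b2 x; rewrite E2.1 E2.2.
have [C1 HC1] := expR_trig_bound w a1 b1 e0.
have [C2 HC2] := expR_trig_bound w a2 b2 e0.
have [l1 _] := cvg0_jweight HC1; have [_ l2] := cvg0_jweight HC2.
rewrite (@integral_line_is_derive _ _ (G (- e) A B) (G e A B) (G (- e) a1 b1) (G e a2 b2) 0 0) //.
- rewrite /G !mulr0 expR0 sin0 cos0 !mulr0 !add0r !mul1r !mulr1 subr0 -/D.
  by congr (_%:E); apply: (mulIf D0); rewrite /b1 /b2 mulrDl mulNr !divfK // mulrA divfK //; ring.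
- have [CA HCA] := expR_trig_bound w A B e0.
  have ih := @integrable_jweight R 2 (ltr1n R 2).
  have mE := measurable_expR_abs e.
  have ms : measurable_fun setT (@sin R) := continuous_measurable_fun (@continuous_sin R).
  have mc : measurable_fun setT (@cos R) := continuous_measurable_fun (@continuous_cos R).
  apply: (@le_integrable _ _ _ mu setT measurableT _ (fun x => (CA * h 2 x)%:E)).
  + by meas.
  + by move=> x _ /=; rewrite lee_fin (le_trans (HCA x)) // ler_norm.
  + by have := integrableZl measurableT CA ih.
- exact: continuous_expR_trig.
- by move=> x x0; rewrite /G ger0_norm // mulNr.
- exact: continuous_expR_trig.
- by move=> x x0; rewrite /G ler0_norm // mulrN opprK.
- rewrite (_ : (fun n => _) = (fun n : nat => expR (- (e * `|n.+1%:R|)) * (a1 * sin (w * n.+1%:R) + b1 * cos (w * n.+1%:R)))) //.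
  by apply/funext => n; rewrite /G ger0_norm // mulNr.
- rewrite (_ : (fun n => _) = (fun n : nat => expR (- (e * `|- n.+1%:R|)) * (a2 * sin (w * - n.+1%:R) + b2 * cos (w * - n.+1%:R)))) //.
  by apply/funext => n; rewrite /G normrN ger0_norm // mulrN.
Qed.

Lemma integral_cauchy_density : (\int[mu]_x ((pi * (1 + x ^+ 2))^-1)%:E = 1%:E :> \bar R)%E.
Proof.
have pi0 := pi_gt0 R.
have dF x : is_derive x (1 : R) (fun y : R => pi^-1 * atan y) ((pi * (1 + x ^+ 2))^-1).
  have ha : is_derive x (1 : R) (@atan R) ((1 + x ^+ 2)^-1).
    by apply: DeriveDef; [exact: derivable_atan|rewrite -derive1E derive1_atan].
  apply: (is_derive_eq (is_deriveZ pi^-1 ha)).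
  by rewrite /GRing.scale /= invfM.
have E x : ((pi : R) * (1 + x ^+ 2))^-1 = pi^-1 * h 2 x by rewrite jweight2E invfM.
have cf : continuous (fun x : R => (pi * (1 + x ^+ 2))^-1).
  move=> x; apply: cvgV; first by rewrite gt_eqF // mulr_gt0 // sqr1_gt0.
  apply: cvgM; first exact: cvg_cst.
  by apply: cvgD; [exact: cvg_cst|exact: exprn_continuous].
have la : pi^-1 * atan (n.+1%:R : R) @[n --> \oo] --> (1 / 2 : R).
  rewrite (_ : 1 / 2 = pi^-1 * (pi / 2)); last by rewrite mulKf ?gt_eqF // div1r.
  apply: cvgM; first exact: cvg_cst.
  apply: (cvg_comp (fun n : nat => n.+1%:R : R) (@atan R)); last exact: cvgy_atan.
  by have := @cvgr_idn R; rewrite -(cvg_shiftS (fun n : nat => n%:R : R)).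
have la' : pi^-1 * atan (- n.+1%:R : R) @[n --> \oo] --> - (1 / 2 : R).
  rewrite (_ : (fun n => _) = (fun n : nat => - (pi^-1 * atan (n.+1%:R : R)))); last first.
    by apply/funext => n; rewrite atanN mulrN.
  exact: cvgN.
rewrite (@integral_line_is_derive _ _ _ _ _ _ _ _ _ dF cf _ dF cf _ la la') //.
- by rewrite atan0 mulr0; congr (_%:E); lra.
- have ih := @integrable_jweight R 2 (ltr1n R 2).
  rewrite (_ : EFin \o _ = (fun x => pi^-1%:E * (EFin \o h 2) x)%E); first exact: (integrableZl measurableT _ ih).
  by apply/funext => x /=; rewrite E EFinM.
Qed.

End abel_kernel.

(** * Complex-valued integrals and the Fourier transform *)

Section complex_integral.
Context d (T : measurableType d) (R : realType) (m : {measure set T -> \bar R}).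
Local Open Scope complex_scope.
Local Notation Re := complex.Re.
Local Notation Im := complex.Im.
Local Notation normc := ComplexField.Normc.normc.
Implicit Types F G : T -> R[i].

Definition cint F : R[i] := (\int[m]_x Re (F x)) +i* (\int[m]_x Im (F x)).

Definition cmeasurable F : Prop :=
  measurable_fun setT (fun x => Re (F x)) /\ measurable_fun setT (fun x => Im (F x)).

Definition cintegrable F : Prop :=
  m.-integrable setT (EFin \o (fun x => Re (F x))) /\
  m.-integrable setT (EFin \o (fun x => Im (F x))).

Lemma normc_sqr (z : R[i]) : normc z ^+ 2 = Re z ^+ 2 + Im z ^+ 2.
Proof. by case: z => a b; rewrite /= sqr_sqrtr // addr_ge0 ?sqr_ge0. Qed.

Lemma normc_ge0 (z : R[i]) : 0 <= normc z.
Proof. by case: z => a b; exact: sqrtr_ge0. Qed.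

Lemma Re_le_normc (z : R[i]) : `|Re z| <= normc z.
Proof.
rewrite -(ler_pXn2r (ltn0Sn 1)) ?nnegrE ?normc_ge0 // normc_sqr real_normK ?num_real //.
by rewrite lerDl sqr_ge0.
Qed.

Lemma Im_le_normc (z : R[i]) : `|Im z| <= normc z.
Proof.
rewrite -(ler_pXn2r (ltn0Sn 1)) ?nnegrE ?normc_ge0 // normc_sqr real_normK ?num_real //.
by rewrite lerDr sqr_ge0.
Qed.

Lemma normc_le_ReIm (z : R[i]) : normc z <= `|Re z| + `|Im z|.
Proof.
rewrite -(ler_pXn2r (ltn0Sn 1)) ?nnegrE ?normc_ge0 ?addr_ge0 // normc_sqr sqrrD.
rewrite !real_normK ?num_real // addrAC lerDl mulrn_wge0 // mulr_ge0 //.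
Qed.

Lemma cmeasurable_normc F : cmeasurable F -> measurable_fun setT (fun x => normc (F x)).
Proof.
move=> [mr mi].
have mf : measurable_fun setT (fun x => Re (F x) ^+ 2 + Im (F x) ^+ 2) by meas.
have := measurableT_comp (continuous_measurable_fun (@sqrt_continuous R)) mf.
by apply: eq_measurable_fun => x _ /=; case: (F x).
Qed.

Lemma cintegrable_measurable F : cintegrable F -> cmeasurable F.
Proof. by move=> [/measurable_int/measurable_EFinP ir /measurable_int/measurable_EFinP ii]. Qed.

Lemma cintegrable_le F (g : T -> R) : cmeasurable F -> m.-integrable setT (EFin \o g) ->
  (forall x, normc (F x) <= g x) -> cintegrable F.
Proof.
move=> [mr mi] ig Fg.
by split; apply: (@le_integrable _ _ _ m setT measurableT _ _ _ _ ig); try exact/measurable_EFinP;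
  move=> x _ /=; rewrite lee_fin; apply: (le_trans _ (ler_norm _)); apply: (le_trans _ (Fg x));
  [exact: Re_le_normc|exact: Im_le_normc].
Qed.

Lemma eq_cint F G : (forall x, F x = G x) -> cint F = cint G.
Proof. by move=> FG; congr cint; exact/funext. Qed.

Lemma cintB F G : cintegrable F -> cintegrable G ->
  cint (fun x => F x - G x) = cint F - cint G.
Proof.
move=> [Fr Fi] [Gr Gi]; rewrite /cint.
have -> : (fun x => Re (F x - G x)) = (fun x => Re (F x) - Re (G x)).
  by apply/funext => x; case: (F x) (G x) => [a b] [c e].
have -> : (fun x => Im (F x - G x)) = (fun x => Im (F x) - Im (G x)).
  by apply/funext => x; case: (F x) (G x) => [a b] [c e].
by rewrite !RintegralB.
Qed.

Lemma ReM (z w : R[i]) : Re (z * w) = Re z * Re w - Im z * Im w.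
Proof. by case: z w => [a b] [c e]. Qed.

Lemma ImM (z w : R[i]) : Im (z * w) = Re z * Im w + Im z * Re w.
Proof. by case: z w => [a b] [c e]. Qed.

Lemma cintZl (z : R[i]) F : cintegrable F -> cint (fun x => z * F x) = z * cint F.
Proof.
move=> [Fr Fi]; case: z => a b.
have iZ (c : R) (f : T -> R) : m.-integrable setT (EFin \o f) ->
    m.-integrable setT (EFin \o (fun x => c * f x)).
  by move=> jf; have := integrableZl measurableT c jf.
rewrite /cint; under [X in X +i* _]eq_Rintegral do rewrite ReM /=.
under [X in _ +i* X]eq_Rintegral do rewrite ImM /=.
rewrite RintegralB // ?RintegralD //; try exact: iZ.
by rewrite !RintegralZl.
Qed.

Lemma le_normc_cint F : cintegrable F -> ((normc (cint F))%:E <= \int[m]_x (normc (F x))%:E)%E.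
Proof.
move=> iF; have [Fr Fi] := iF; set z := cint F.
have mF := cmeasurable_normc (cintegrable_measurable iF).
have [z0|z0] := eqVneq (normc z) 0.
  by rewrite z0; apply: integral_ge0 => x _; rewrite lee_fin normc_ge0.
have zp : 0 < normc z by rewrite lt_neqAle eq_sym z0 normc_ge0.
(* Multiplying by the conjugate of [z] turns [z] into the real number
   [normc z ^+ 2]. *)
have iZ (c : R) (f : T -> R) : m.-integrable setT (EFin \o f) ->
    m.-integrable setT (EFin \o (fun x => c * f x)).
  by move=> jf; have := integrableZl measurableT c jf.
pose g x := Re z * Re (F x) + Im z * Im (F x).
have ig : m.-integrable setT (EFin \o g).
  by have := integrableD measurableT (iZ (Re z) _ Fr) (iZ (Im z) _ Fi).
have gle x : `|g x| <= normc z * normc (F x).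
  rewrite -(ler_pXn2r (ltn0Sn 1)) ?nnegrE ?mulr_ge0 ?normc_ge0 //.
  rewrite real_normK ?num_real // exprMn !normc_sqr /g.
  have := sqr_ge0 (Re z * Im (F x) - Im z * Re (F x)); nra.
have E : (normc z * normc z)%:E = (\int[m]_x (g x)%:E)%E.
  rewrite -[RHS]fineK; last exact: (integrable_fin_num measurableT ig).
  congr (_%:E); rewrite -expr2 normc_sqr -[RHS]/(\int[m]_x g x).
  by rewrite RintegralD // ?RintegralZl //; exact: iZ.
have : ((normc z * normc z)%:E <= (normc z)%:E * \int[m]_x (normc (F x))%:E)%E.
  rewrite E -ge0_integral_EFinZl ?normc_ge0 //; last by move=> x; exact: normc_ge0.
  apply: (le_trans (lee_abs _)); apply: (le_trans (le_abse_integral _ measurableT (measurable_int _ ig))).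
  apply: ge0_le_integral => //.
  - by apply: measurableT_comp => //; exact: measurable_int ig.
  - by meas.
  - by move=> x _; rewrite lee_fin.
by rewrite EFinM lee_pmul2l // lte_fin.
Qed.

End complex_integral.

(** * Fubini under domination by a product of integrable functions *)

Section real_fubini.
Context d1 d2 (T1 : measurableType d1) (T2 : measurableType d2) (R : realType).
Context (m1 : {sigma_finite_measure set T1 -> \bar R}).
Context (m2 : {sigma_finite_measure set T2 -> \bar R}).
Context (f : T1 * T2 -> R) (a : T1 -> R) (b : T2 -> R).
Hypothesis mf : measurable_fun setT f.
Hypothesis ia : m1.-integrable setT (EFin \o a).
Hypothesis ib : m2.-integrable setT (EFin \o b).
Hypothesis fab : forall x y, `|f (x, y)| <= a x * b y.

Let ma : measurable_fun setT a. Proof. exact/measurable_EFinP/(measurable_int _ ia). Qed.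
Let mb : measurable_fun setT b. Proof. exact/measurable_EFinP/(measurable_int _ ib). Qed.

Lemma integrable_section1 x : m2.-integrable setT (EFin \o (fun y => f (x, y))).
Proof.
have i1 := integrableZl measurableT (a x) ib.
apply: (@le_integrable _ _ _ m2 setT measurableT _ (fun y => (a x * b y)%:E)) => //.
- by meas.
- by move=> y _ /=; rewrite lee_fin; exact: le_trans (fab x y) (ler_norm _).
Qed.

Lemma integrable_section2 y : m1.-integrable setT (EFin \o (fun x => f (x, y))).
Proof.
have i1 := integrableZr measurableT (b y) ia.
apply: (@le_integrable _ _ _ m1 setT measurableT _ (fun x => (a x * b y)%:E)) => //.
- by meas.
- by move=> x _ /=; rewrite lee_fin; exact: le_trans (fab x y) (ler_norm _).
Qed.

Lemma integrable_prod_le : (m1 \x m2)%E.-integrable setT (EFin \o f).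
Proof.
have mf' : measurable_fun setT (EFin \o f) by meas.
apply/(integrable12ltyP m1 m2 mf').
have Bfin : (\int[m2]_y `|(b y)%:E| < +oo)%E by have /integrableP[] := ib.
have Afin : (\int[m1]_x `|(a x)%:E| < +oo)%E by have /integrableP[] := ia.
have mb' : measurable_fun setT (fun y => `|b y|) by meas.
have ma' : measurable_fun setT (fun x => `|a x|) by meas.
apply: (@le_lt_trans _ _ (\int[m1]_x (`|a x|%:E * \int[m2]_y `|b y|%:E))%E).
  apply: ge0_le_integral => //.
  - by move=> x _; apply: integral_ge0.
  - apply: (measurable_fun_fubini_tonelli_F (fun z => `|(f z)%:E|%E)) => //.
    exact: measurableT_comp.
  - by apply: emeasurable_funM; [exact/measurable_EFinP|exact: measurable_cst].
  - move=> x _; rewrite -ge0_integral_EFinZl //.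
    apply: ge0_le_integral => //.
    + by apply: measurableT_comp => //; meas.
    + by meas.
    + by move=> y _ /=; rewrite lee_fin -normrM; apply: (le_trans (fab x y)); exact: ler_norm.
rewrite ge0_integralZr //; last exact: integral_ge0.
  have A0 : (0 <= \int[m1]_x `|(a x)%:E|)%E by exact: integral_ge0.
  by apply: lte_mul_pinfty => //; rewrite ge0_fin_numE.
exact/measurable_EFinP.
Qed.

(** Domination by [a x * b y] makes every section integrable, not just almost every one, so the
    inner real-valued integral agrees everywhere with the extended one. *)
Lemma Rintegral_prod1 : \int[m1]_x \int[m2]_y f (x, y) = \int[(m1 \x m2)%E]_z f z.
Proof.
rewrite /Rintegral -(integral12_prod_meas1 integrable_prod_le); congr fine.
apply: eq_integral => x _; rewrite fineK //.
exact: (integrable_fin_num measurableT (integrable_section1 x)).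
Qed.

Lemma Rintegral_prod2 : \int[m2]_y \int[m1]_x f (x, y) = \int[(m1 \x m2)%E]_z f z.
Proof.
rewrite /Rintegral -(integral21_prod_meas1 integrable_prod_le); congr fine.
apply: eq_integral => y _; rewrite fineK //.
exact: (integrable_fin_num measurableT (integrable_section2 y)).
Qed.

Lemma Rintegral_fubini : \int[m1]_x \int[m2]_y f (x, y) = \int[m2]_y \int[m1]_x f (x, y).
Proof. by rewrite Rintegral_prod1 Rintegral_prod2. Qed.

End real_fubini.

Section complex_fubini.
Context d1 d2 (T1 : measurableType d1) (T2 : measurableType d2) (R : realType).
Context (m1 : {sigma_finite_measure set T1 -> \bar R}).
Context (m2 : {sigma_finite_measure set T2 -> \bar R}).
Context (F : T1 * T2 -> R[i]) (a : T1 -> R) (b : T2 -> R).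
Hypothesis mF : cmeasurable F.
Hypothesis ia : m1.-integrable setT (EFin \o a).
Hypothesis ib : m2.-integrable setT (EFin \o b).
Hypothesis Fab : forall x y, ComplexField.Normc.normc (F (x, y)) <= a x * b y.

Let rab x y : `|complex.Re (F (x, y))| <= a x * b y.
Proof. exact: le_trans (Re_le_normc _) (Fab x y). Qed.
Let iab x y : `|complex.Im (F (x, y))| <= a x * b y.
Proof. exact: le_trans (Im_le_normc _) (Fab x y). Qed.

Lemma cint_fubini : cint m1 (fun x => cint m2 (fun y => F (x, y)))
  = cint m2 (fun y => cint m1 (fun x => F (x, y))).
Proof.
rewrite /cint /=; congr Complex.
  exact: (@Rintegral_fubini _ _ _ _ _ m1 m2 (fun z => complex.Re (F z)) a b mF.1 ia ib rab).
exact: (@Rintegral_fubini _ _ _ _ _ m1 m2 (fun z => complex.Im (F z)) a b mF.2 ia ib iab).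
Qed.

End complex_fubini.

Section measurable_integrals.
Context d1 d2 (T1 : measurableType d1) (T2 : measurableType d2) (R : realType).
Context (m2 : {sigma_finite_measure set T2 -> \bar R}).

Lemma measurable_Rintegral (f : T1 * T2 -> R) : measurable_fun setT f ->
  measurable_fun setT (fun x => \int[m2]_y f (x, y)).
Proof.
move=> mf; have mf' : measurable_fun setT (EFin \o f) by meas.
apply: (@measurableT_comp _ _ _ _ _ _ fine); first exact: fine_measurable.
have mp := measurable_funepos mf'; have mn := measurable_funeneg mf'.
have := emeasurable_funB (@measurable_fun_fubini_tonelli_F _ _ T1 T2 R m2 _ mp (fun=> funepos_ge0 _ _))
  (@measurable_fun_fubini_tonelli_F _ _ T1 T2 R m2 _ mn (fun=> funeneg_ge0 _ _)).
apply: eq_measurable_fun => x _ /=; rewrite integralE /fubini_F.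
by congr (_ - _)%E; apply: eq_integral => y _; rewrite ?funepos.unlock ?funeneg.unlock.
Qed.

End measurable_integrals.

(** * First properties of the Fourier transform *)

Section fourier_basics.
Context {R : realType}.
Local Open Scope complex_scope.
Local Notation Re := complex.Re.
Local Notation Im := complex.Im.
Local Notation normc := ComplexField.Normc.normc.
Local Notation h := (@jweight R).

Definition phase (p q : R * R) : R := 2 * pi * (p.1 * q.1 + p.2 * q.2).

Lemma fourierE (f : R * R -> R[i]) q :
  fourier f q = cint lebesgue2 (fun p => expi (- phase p q) * f p).
Proof. by []. Qed.

Lemma normc_expi (y : R) : normc (expi y) = 1.
Proof. by rewrite /expi /= cos2Dsin2 sqrtr1. Qed.

Lemma expiD (x y : R) : expi (x + y) = expi x * expi y.
Proof. by rewrite /expi cosD sinD; apply/eqP; rewrite eq_complex /= eqxx addrC eqxx. Qed.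

Lemma cmeasurableM d (T : measurableType d) (F G : T -> R[i]) :
  cmeasurable F -> cmeasurable G -> cmeasurable (fun x => F x * G x).
Proof.
move=> [Fr Fi] [Gr Gi]; split.
  have -> : (fun x => Re (F x * G x)) = (fun x => Re (F x) * Re (G x) - Im (F x) * Im (G x)).
    by apply/funext => x; exact: ReM.
  by meas.
have -> : (fun x => Im (F x * G x)) = (fun x => Re (F x) * Im (G x) + Im (F x) * Re (G x)).
  by apply/funext => x; exact: ImM.
by meas.
Qed.

Lemma cmeasurable_expi d (T : measurableType d) (f : T -> R) :
  measurable_fun setT f -> cmeasurable (fun x => expi (f x)).
Proof.
move=> mf; split => /=.
  exact: (measurableT_comp (continuous_measurable_fun (@continuous_cos R)) mf).
exact: (measurableT_comp (continuous_measurable_fun (@continuous_sin R)) mf).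
Qed.

Lemma cmeasurable_comp d d' (T : measurableType d) (T' : measurableType d')
    (F : T' -> R[i]) (f : T -> T') :
  cmeasurable F -> measurable_fun setT f -> cmeasurable (fun x => F (f x)).
Proof. by move=> [Fr Fi] mf; split; [exact: (measurableT_comp Fr mf)|exact: (measurableT_comp Fi mf)]. Qed.

Lemma cmeasurable_real d (T : measurableType d) (f : T -> R) :
  measurable_fun setT f -> cmeasurable (fun x => (f x)%:C).
Proof. by move=> mf; split => //=; exact: measurable_cst. Qed.

(** Common integrable majorant, up to constants, for Schwartz functions and their transforms; its
    product form suits Fubini. *)
Definition h22 (p : R * R) : R := h 2 p.1 * h 2 p.2.

Lemma h22_ge0 p : 0 <= h22 p. Proof. exact: mulr_ge0. Qed.

Lemma measurable_h22 : measurable_fun setT h22.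
Proof. have mh := @measurable_jweight R 2; by rewrite /h22; meas. Qed.

Lemma integrable_h22 : (@lebesgue2 R).-integrable setT (EFin \o h22).
Proof.
have ih := @integrable_jweight R 2 (ltr1n R 2).
have hh (x y : R) : `|h22 (x, y)| <= h 2 x * h 2 y by rewrite ger0_norm // h22_ge0.
exact: (@integrable_prod_le _ _ _ _ R (@lebesgue_measure R) (@lebesgue_measure R)
  h22 (h 2) (h 2) measurable_h22 ih ih hh).
Qed.

Lemma integrable_h22Z (M : R) : (@lebesgue2 R).-integrable setT (EFin \o (fun p => M * h22 p)).
Proof. by have := integrableZl measurableT M integrable_h22. Qed.

Lemma schwartz_cmeasurable (u : R * R -> R[i]) : schwartz u -> cmeasurable u.
Proof. by move=> [ur ui]; split; exact: real_schwartz_measurable. Qed.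

Lemma schwartz_bound (u : R * R -> R[i]) : schwartz u -> exists2 M : R, 0 <= M &
  forall p, normc (u p) <= M * h22 p.
Proof.
move=> [ur ui]; have [M1 M10 H1] := real_schwartz_bound ur.
have [M2 M20 H2] := real_schwartz_bound ui.
exists (M1 + M2) => [|p]; first exact: addr_ge0.
by apply: (le_trans (normc_le_ReIm _)); rewrite mulrDl lerD.
Qed.

Lemma schwartz_cintegrable_expi (u : R * R -> R[i]) (t : R * R -> R) : schwartz u ->
  measurable_fun setT t -> cintegrable lebesgue2 (fun p => expi (t p) * u p).
Proof.
move=> su mt; have [M M0 HM] := schwartz_bound su.
apply: (cintegrable_le _ (integrable_h22Z M)).
  by apply: cmeasurableM; [exact: cmeasurable_expi|exact: schwartz_cmeasurable].
by move=> p; rewrite ComplexField.Normc.normcM normc_expi mul1r.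
Qed.

Lemma measurable_phasel (q : R * R) : measurable_fun setT (fun p => - phase p q).
Proof. by rewrite /phase; meas. Qed.

Lemma fourierB (u v : R * R -> R[i]) q : schwartz u -> schwartz v ->
  fourier (fun p => u p - v p) q = fourier u q - fourier v q.
Proof.
move=> su sv; rewrite !fourierE -cintB.
- by apply: eq_cint => p; rewrite mulrBr.
- exact: (schwartz_cintegrable_expi su (measurable_phasel q)).
- exact: (schwartz_cintegrable_expi sv (measurable_phasel q)).
Qed.

Lemma cmeasurable_cint (F : (R * R) * (R * R) -> R[i]) : cmeasurable F ->
  cmeasurable (fun q => cint lebesgue2 (fun p => F (q, p))).
Proof.
move=> [Fr Fi]; split => /=.
  exact: (measurable_Rintegral (@lebesgue2 R) Fr).
exact: (measurable_Rintegral (@lebesgue2 R) Fi).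
Qed.

Lemma cmeasurable_fourier (u : R * R -> R[i]) : schwartz u -> cmeasurable (fourier u).
Proof.
move=> su; apply: (@cmeasurable_cint (fun z => expi (- phase z.2 z.1) * u z.2)).
apply: cmeasurableM.
  by apply: cmeasurable_expi; rewrite /phase; meas.
exact: (cmeasurable_comp (schwartz_cmeasurable su) measurable_snd).
Qed.

Lemma measurable_normc_fourier (u : R * R -> R[i]) : schwartz u ->
  measurable_fun setT (fun q => normc (fourier u q)).
Proof. by move=> su; exact: cmeasurable_normc (cmeasurable_fourier su). Qed.

End fourier_basics.

(** * Decay of the Fourier transform *)

Section integration_by_parts.
Context {R : realType}.
Local Notation mu := (@lebesgue_measure R).
Local Notation h := (@jweight R).
Implicit Types (g G K : R * R -> R).

(** Parametrizes by [t] the line in direction [dir d], with [x] the other coordinate, so that both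
    directions share one proof. *)
Definition slice (d : bool) (x t : R) : R * R := if d then (x, t) else (t, x).
Definition coord (d : bool) (q : R * R) : R := if d then q.2 else q.1.

Lemma is_derive_slice d g (x t : R) : differentiable g (slice d x t) ->
  is_derive t (1 : R) (fun s : R => g (slice d x s)) (partial d g (slice d x t)).
Proof.
move=> dg; have dv := @diff_derivable _ _ _ g (slice d x t) (dir d) dg.
have E : (fun e : R => e^-1 *: ((fun s : R => g (slice d x s)) (e *: (1 : R) + t) - g (slice d x t)))
    = (fun e : R => e^-1 *: (g (e *: dir d + slice d x t) - g (slice d x t))).
  apply/funext => e; congr (_ *: (g _ - _)).
  case: d {dg dv} => /=.
    by rewrite (_ : _ *: (0, 1) + (x, t) = (e *: (0 : R) + x, e *: (1 : R) + t)) // scaler0 add0r.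
  by rewrite (_ : _ *: (1, 0) + (t, x) = (e *: (1 : R) + t, e *: (0 : R) + x)) // scaler0 add0r.
by apply: DeriveDef; [rewrite /derivable E; exact: dv|rewrite /partial /derive E].
Qed.

(** On each line in direction [d] the integral of the derivative telescopes to boundary values,
    which vanish by the decay of [G]; Fubini is then applied in the order that integrates along [d]
    first. *)
Lemma integral_partial_eq0 d G K (M N : R) :
  (forall x t, is_derive t (1 : R) (fun s : R => G (slice d x s)) (K (slice d x t))) ->
  (forall x, continuous (fun t : R => K (slice d x t))) ->
  measurable_fun setT K ->
  (forall p, `|G p| <= M * h22 p) -> (forall p, `|K p| <= N * h22 p) ->
  \int[@lebesgue2 R]_p K p = 0.
Proof.
move=> dG cK mK GM KN.
have ih := @integrable_jweight R 2 (ltr1n R 2).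
have iN : mu.-integrable setT (EFin \o (fun x => N * h 2 x)).
  by have := integrableZl measurableT N ih.
have KN' x y : `|K (x, y)| <= N * h 2 x * h 2 y by rewrite -mulrA; exact: KN.
have line x : \int[mu]_t K (slice d x t) = 0.
  have iK : mu.-integrable setT (EFin \o (fun t => K (slice d x t))).
    case: d {dG cK} => /=.
      exact: (@integrable_section1 _ _ _ _ R mu K (fun x => N * h 2 x) (h 2) mK ih KN').
    exact: (@integrable_section2 _ _ _ _ R mu K (fun x => N * h 2 x) (h 2) mK iN KN').
  have GB t : `|G (slice d x t)| <= M * h 2 x * h 2 t.
    apply: (le_trans (GM _)); rewrite /h22 -mulrA.
    by case: d {dG cK iK} => //=; rewrite [h 2 t * _]mulrC.
  have [l1 l2] := cvg0_jweight GB.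
  rewrite /Rintegral (integral_line_is_derive iK (dG x) (cK x) _ (dG x) (cK x) _ l1 l2) //=.
  by rewrite sub0r subr0 addNr.
have [] : (d = true \/ d = false) by case: d {dG cK line}; [left|right].
  move=> dE; move: line; rewrite dE /= => line.
  have := @Rintegral_prod1 _ _ _ _ R mu mu K (fun x => N * h 2 x) (h 2) mK iN ih KN'.
  by under [X in X = _]eq_Rintegral do rewrite line; rewrite Rintegral_cst // mul0r.
move=> dE; move: line; rewrite dE /= => line.
have := @Rintegral_prod2 _ _ _ _ R mu mu K (fun x => N * h 2 x) (h 2) mK iN ih KN'.
by under [X in X = _]eq_Rintegral do rewrite line; rewrite Rintegral_cst // mul0r.
Qed.

(** With [T] the cosine or the sine and [g] the real or imaginary part of a function, these are the
    four real integrals that make up its Fourier transform. *)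
Definition trig_int (T : R -> R) g (q : R * R) : R :=
  \int[@lebesgue2 R]_p (g p * T (phase p q)).

Lemma is_derive_phase d (T T' : R -> R) (q : R * R) (x t : R) :
  (forall y : R, is_derive y (1 : R) T (T' y)) ->
  is_derive t (1 : R) (fun s : R => T (phase (slice d x s) q))
    (2 * pi * coord d q * T' (phase (slice d x t) q)).
Proof.
move=> dT; pose c := 2 * pi * (x * coord (~~ d) q).
have E s : phase (slice d x s) q = 2 * pi * coord d q * s + c.
  by rewrite /phase /c; case: (d) => /=; ring.
have h1 : is_derive t (1 : R) (fun s => phase (slice d x s) q) (2 * pi * coord d q).
  rewrite (_ : (fun s => _) = (fun s => 2 * pi * coord d q * s) + cst c); last first.
    by apply/funext => s; exact: E.
  have := @is_deriveD _ _ _ _ _ t 1 _ _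
    (@is_deriveZ _ _ _ (@id R) (2 * pi * coord d q) t 1 1 (is_derive_id t 1)) (is_derive_cst c t 1).
  by rewrite /GRing.scale /= mulr1 addr0.
have := @is_derive1_comp R T _ t _ _ (dT _) h1.
by rewrite mulrC.
Qed.

Lemma trig_integrable (T : R -> R) g q : real_schwartz g -> measurable_fun setT T ->
  (forall y, `|T y| <= 1) ->
  (@lebesgue2 R).-integrable setT (EFin \o (fun p => g p * T (phase p q))).
Proof.
move=> sg mT T1; have [M M0 HM] := real_schwartz_bound sg.
have mg := real_schwartz_measurable sg.
have mp : measurable_fun setT (fun p : R * R => phase p q) by rewrite /phase; meas.
apply: (@le_integrable _ _ _ (@lebesgue2 R) setT measurableT _ _ _ _ (integrable_h22Z M)).
- by meas.
- move=> p _ /=; rewrite lee_fin normrM; apply: (le_trans _ (ler_norm _)).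
  by apply: le_trans (HM p); rewrite ler_piMr.
Qed.

(** Integration by parts: the two sides differ by the integral of the partial derivative of [g]
    times [T] of the phase. *)
Lemma trig_int_partial d (T T' : R -> R) g q : real_schwartz g ->
  (forall y : R, is_derive y (1 : R) T (T' y)) -> continuous T' ->
  (forall y, `|T y| <= 1) -> (forall y, `|T' y| <= 1) ->
  2 * pi * coord d q * trig_int T' g q = - trig_int T (partial d g) q.
Proof.
move=> sg dT cT' T1 T1'.
have sdg := real_schwartz_partial d sg.
have [dg _] := real_schwartz_nice sg; have [ddg _] := real_schwartz_nice sdg.
have mT : measurable_fun setT T := continuous_measurable_fun (is_derive_continuous dT).
have mT' : measurable_fun setT T' := continuous_measurable_fun cT'.
have i1 := trig_integrable q sdg mT T1; have i2 := trig_integrable q sg mT' T1'.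
have i2k : (@lebesgue2 R).-integrable setT
    (EFin \o (fun p => 2 * pi * coord d q * (g p * T' (phase p q)))).
  by have := integrableZl measurableT (2 * pi * coord d q) i2.
have [M M0 HM] := real_schwartz_bound sg; have [N N0 HN] := real_schwartz_bound sdg.
rewrite /trig_int -RintegralZl //; apply/eqP; rewrite -addr_eq0 addrC -RintegralD //.
apply/eqP.
have cg x : continuous (fun t : R => g (slice d x t)).
  by apply: is_derive_continuous => t; apply: is_derive_slice.
have cdg x : continuous (fun t : R => partial d g (slice d x t)).
  by apply: is_derive_continuous => t; apply: is_derive_slice.
have cp (S S' : R -> R) x : (forall y : R, is_derive y (1 : R) S (S' y)) ->
    continuous (fun t : R => S (phase (slice d x t) q)).
  by move=> dS; exact: (is_derive_continuous (fun t => is_derive_phase d q x t dS)).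
apply: (@integral_partial_eq0 d (fun p => g p * T (phase p q)) _ M
  (N + `|2 * pi * coord d q| * M)).
- move=> x t.
  have := is_deriveM (is_derive_slice (dg (slice d x t))) (is_derive_phase d q x t dT).
  move=> /is_derive_eq; apply; rewrite /GRing.scale /=; ring.
- move=> x t.
  have c1 := cp T T' x dT t.
  have c2 : {for t, continuous (fun t : R => T' (phase (slice d x t) q))}.
    have cid : continuous (fun s : R => phase (slice d x s) q).
      exact: (is_derive_continuous (fun s => is_derive_phase d q x s (fun y => is_derive_id y 1))).
    exact: (continuous_comp (cid t) (cT' _)).
  apply: cvgD; first by apply: cvgM; [exact: cdg|exact: c1].
  by apply: cvgM; [exact: cvg_cst|apply: cvgM; [exact: cg|exact: c2]].
- have /measurable_EFinP m1 := measurable_int _ i1.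
  have /measurable_EFinP m2 := measurable_int _ i2k.
  exact: measurable_funD.
- by move=> p; rewrite normrM; apply: le_trans (HM p); rewrite ler_piMr.
- move=> p; apply: (le_trans (ler_normD _ _)); rewrite [leRHS]mulrDl lerD //.
    by rewrite normrM; apply: le_trans (HN p); rewrite ler_piMr.
  rewrite normrM -[leRHS]mulrA ler_wpM2l // normrM.
  by apply: le_trans (HM p); rewrite ler_piMr.
Qed.

Lemma trig_int_bound (T : R -> R) g : real_schwartz g -> measurable_fun setT T ->
  (forall y, `|T y| <= 1) -> exists M : R, forall q, `|trig_int T g q| <= M.
Proof.
move=> sg mT T1; have [M M0 HM] := real_schwartz_bound sg.
exists (\int[@lebesgue2 R]_p (M * h22 p)) => q.
have i := trig_integrable q sg mT T1.
apply: (le_trans (le_normr_Rintegral measurableT i)); apply: le_Rintegral => //.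
- by have := integrable_abse i.
- exact: integrable_h22Z.
- by move=> p _; rewrite normrM; apply: le_trans (HM p); rewrite ler_piMr.
Qed.

(** Each integration by parts trades a power of the frequency for a derivative of [g] and exchanges
    sine and cosine, so both bounds run through one induction. The factor [2 pi >= 1] is dropped. *)
Lemma trig_int_decay (j k : nat) g : real_schwartz g -> exists M : R, forall q,
  `|q.1| ^+ j * `|q.2| ^+ k * `|trig_int cos g q| <= M /\
  `|q.1| ^+ j * `|q.2| ^+ k * `|trig_int sin g q| <= M.
Proof.
have c1 (y : R) : `|cos y| <= 1 by rewrite ler_norml cos_geN1 cos_le1.
have s1 (y : R) : `|sin y| <= 1 by rewrite ler_norml sin_geN1 sin_le1.
have ms1 (y : R) : `|- sin y| <= 1 by rewrite normrN.
have mc := continuous_measurable_fun (@continuous_cos R).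
have ms := continuous_measurable_fun (@continuous_sin R).
have cms : continuous (fun y : R => - sin y) by move=> y; apply: cvgN; exact: continuous_sin.
have pi0 := pi_gt0 R.
have trigN g' q : real_schwartz g' -> trig_int (fun y => - sin y) g' q = - trig_int sin g' q.
  move=> sg'; have i := trig_integrable q sg' ms s1.
  rewrite /trig_int -mulN1r -RintegralZl //.
  by apply: eq_Rintegral => p _; rewrite mulrN mulN1r.
have step d g' q : real_schwartz g' ->
    `|coord d q| * `|trig_int cos g' q| <= `|trig_int sin (partial d g') q| /\
    `|coord d q| * `|trig_int sin g' q| <= `|trig_int cos (partial d g') q|.
  move=> sg'.
  have K (x y : R) : 2 * pi * coord d q * x = - y -> `|coord d q| * `|x| <= `|y|.
    move=> xy; rewrite -[`|y|]normrN -xy !normrM -mulrA ler_peMl ?mulr_ge0 //.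
    rewrite !ger0_norm ?(ltW pi0) //.
    by have := @pi_ge2 R; lra.
  split; first exact: K (trig_int_partial d q sg' (@is_derive_sin R) (@continuous_cos R) s1 c1).
  have := trig_int_partial d q sg' (@is_derive_cos R) cms c1 ms1.
  by rewrite trigN // mulrN => /eqP; rewrite eqr_opp => /eqP E; rewrite -[leRHS]normrN; apply: K; rewrite E opprK.
elim: j k g => [|j IHj] k g sg.
  elim: k g sg => [|k IHk] g sg.
    have [M1 H1] := trig_int_bound sg mc c1; have [M2 H2] := trig_int_bound sg ms s1.
    exists (Num.max M1 M2) => q; rewrite !expr0 !mul1r !le_max H1 H2 orbT.
    by [].
  have [M HM] := IHk _ (real_schwartz_partial true sg); exists M => q.
  have [Ec Es] := step true g q sg; have [Hc Hs] := HM q.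
  have t0 : 0 <= `|q.1| ^+ 0 * `|q.2| ^+ k by rewrite mulr_ge0 ?exprn_ge0.
  rewrite exprSr !mulrA; split.
    by apply: le_trans Hs; rewrite -mulrA ler_wpM2l.
  by apply: le_trans Hc; rewrite -mulrA ler_wpM2l.
have [M HM] := IHj k _ (real_schwartz_partial false sg); exists M => q.
have [Ec Es] := step false g q sg; have [Hc Hs] := HM q.
have t0 : 0 <= `|q.1| ^+ j * `|q.2| ^+ k by rewrite mulr_ge0 ?exprn_ge0.
rewrite exprSr -[`|q.1| ^+ j * _ * _]mulrA [`|q.1| * _]mulrC mulrA; split.
  by apply: le_trans Hs; rewrite -mulrA ler_wpM2l.
by apply: le_trans Hc; rewrite -mulrA ler_wpM2l.
Qed.

End integration_by_parts.

(** * Decay of the transform against polynomial weights *)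

Section fourier_decay.
Context {R : realType}.
Local Notation j := (@japanese R).
Local Notation h := (@jweight R).
Local Notation normc := ComplexField.Normc.normc.
Local Open Scope complex_scope.

Lemma fourier_trig_int (u : R * R -> R[i]) q : schwartz u ->
  let ur p := complex.Re (u p) in let ui p := complex.Im (u p) in
  fourier u q = (trig_int cos ur q + trig_int sin ui q)
             +i* (trig_int cos ui q - trig_int sin ur q).
Proof.
move=> [sr si] ur ui.
have c1 (y : R) : `|cos y| <= 1 by rewrite ler_norml cos_geN1 cos_le1.
have s1 (y : R) : `|sin y| <= 1 by rewrite ler_norml sin_geN1 sin_le1.
have mc := continuous_measurable_fun (@continuous_cos R).
have ms := continuous_measurable_fun (@continuous_sin R).
have i1 := trig_integrable q sr mc c1; have i2 := trig_integrable q si ms s1.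
have i3 := trig_integrable q si mc c1; have i4 := trig_integrable q sr ms s1.
rewrite fourierE /cint /trig_int -RintegralD // -RintegralB //; congr Complex.
  by apply: eq_Rintegral => p _; rewrite ReM /expi /= cosN sinN /ur /ui; ring.
by apply: eq_Rintegral => p _; rewrite ImM /expi /= cosN sinN /ur /ui; ring.
Qed.

Lemma fourier_decay (n k : nat) (u : R * R -> R[i]) : schwartz u -> exists M : R, forall q,
  `|q.1| ^+ n * `|q.2| ^+ k * normc (fourier u q) <= M.
Proof.
move=> su; have [sr si] := su.
have [M1 H1] := trig_int_decay n k sr; have [M2 H2] := trig_int_decay n k si.
exists ((M1 + M2) + (M2 + M1)) => q.
have t0 : 0 <= `|q.1| ^+ n * `|q.2| ^+ k by rewrite mulr_ge0 ?exprn_ge0.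
apply: (le_trans (ler_wpM2l t0 (normc_le_ReIm _))); rewrite fourier_trig_int //=.
have [a1 a2] := H1 q; have [b1 b2] := H2 q.
rewrite mulrDr lerD //.
  by apply: (le_trans (ler_wpM2l t0 (ler_normD _ _))); rewrite mulrDr lerD.
by apply: (le_trans (ler_wpM2l t0 (ler_normB _ _))); rewrite mulrDr lerD.
Qed.

Lemma japanese_expr_le (n : nat) (x : R) : j x ^+ n <= 2 ^+ n * (1 + `|x| ^+ n).
Proof.
apply: (@le_trans _ _ ((2 * Num.max 1 `|x|) ^+ n)).
  rewrite lerXn2r ?nnegrE ?mulr_ge0 ?le_max ?ler01 //.
  apply: (le_trans (japanese_le1D _)).
  have : 1 <= Num.max 1 `|x| by rewrite le_max lexx.
  have : `|x| <= Num.max 1 `|x| by rewrite le_max lexx orbT.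
  by lra.
rewrite exprMn ler_wpM2l ?exprn_ge0 //.
have [x1|x1] := leP 1 `|x|; first by rewrite lerDr.
by rewrite expr1n lerDl exprn_ge0.
Qed.

Lemma fourier_jweight_bound (n : nat) (u : R * R -> R[i]) : schwartz u ->
  exists2 M : R, 0 <= M & forall q, normc (fourier u q) <= M * (h n%:R q.1 * h n%:R q.2).
Proof.
move=> su.
have [M1 H1] := fourier_decay 0 0 su; have [M2 H2] := fourier_decay n 0 su.
have [M3 H3] := fourier_decay 0 n su; have [M4 H4] := fourier_decay n n su.
pose M := 2 ^+ n * 2 ^+ n * (M1 + M2 + M3 + M4).
have HM q : normc (fourier u q) <= M * (h n%:R q.1 * h n%:R q.2).
  rewrite /jweight !powR_invn // -invfM ler_pdivlMr ?mulr_gt0 ?exprn_gt0 //.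
  have n0 := normc_ge0 (fourier u q).
  have A : j q.1 ^+ n * j q.2 ^+ n <= (2 ^+ n * (1 + `|q.1| ^+ n)) * (2 ^+ n * (1 + `|q.2| ^+ n)).
    by apply: ler_pM; rewrite ?exprn_ge0 ?japanese_expr_le.
  apply: (le_trans (ler_wpM2l n0 A)).
  have := H1 q; have := H2 q; have := H3 q; have := H4 q; rewrite !expr0 !mul1r !mulr1 /M.
  move: (`|q.1| ^+ n) (`|q.2| ^+ n) (normc _) => a b x h4 h3 h2 h1.
  rewrite (_ : _ * _ = 2 ^+ n * 2 ^+ n * (x + a * x + b * x + a * b * x)); last by ring.
  by rewrite ler_wpM2l ?mulr_ge0 ?exprn_ge0 // !lerD.
exists M => //.
have := le_trans (normc_ge0 _) (HM (0, 0)); rewrite pmulr_lge0 //.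
by rewrite mulr_gt0.
Qed.

Lemma japanese_quadratic_le (k t x y : R) : 0 <= k -> `|y| <= `|t| + k * x ^+ 2 ->
  j y <= (2 + k) * (j t * j x ^+ 2).
Proof.
move=> k0 yt; apply: (le_trans (japanese_le1D _)).
have t1 := japanese_ge1 t; have tn := norm_le_japanese t.
rewrite japanese_sqr; have x0 := sqr_ge0 x.
move: t1 tn x0 yt; move: (j t) (`|t|) (`|y|) (x ^+ 2) => T t' y' X t1 tn x0 yt.
have TX : X <= T * X by rewrite ler_peMl.
have kTX : k * X <= k * (T * X) by rewrite ler_wpM2l.
have kT : 0 <= k * T by rewrite mulr_ge0 //; lra.
by move: yt tn TX kTX kT t1 x0; clear; nra.
Qed.

(** Polynomial growth is all that is asked of the weights against rapidly decaying transforms.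
    Absolute values dispose of the signs of the exponents, and [2 |a|] reflects that the modulation
    is quadratic in the spatial frequency. *)
Lemma weight_bound (k s a : R) : 0 <= k -> exists C A : R, 0 <= A /\
  forall (t x y : R), `|y| <= `|t| + k * x ^+ 2 ->
    j x `^ s * j y `^ a <= C * (j t `^ A * j x `^ A).
Proof.
move=> k0; pose A := `|s| + 2 * `|a|.
have A0 : 0 <= A by rewrite addr_ge0 // mulr_ge0.
exists ((2 + k) `^ `|a|), A; split => // t x y yt.
have k2 : 0 <= 2 + k by lra.
have h1 : j x `^ s <= j x `^ `|s| by apply: ler_powR => //; exact: ler_norm.
have h2 : j y `^ a <= (2 + k) `^ `|a| * (j t `^ `|a| * j x `^ (2 * `|a|)).
  apply: (@le_trans _ _ (j y `^ `|a|)); first by apply: ler_powR => //; exact: ler_norm.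
  have -> : j x `^ (2 * `|a|) = (j x ^+ 2) `^ `|a| by rewrite powRrM powR_mulrn.
  rewrite -powRM ?exprn_ge0 // -powRM ?mulr_ge0 ?exprn_ge0 //.
  by apply: le_powR_nneg => //; exact: japanese_quadratic_le.
apply: (le_trans (ler_pM (powR_ge0 _ _) (powR_ge0 _ _) h1 h2)).
have h3 : j t `^ `|a| <= j t `^ A.
  by apply: ler_powR => //; rewrite ler_wpDl // ler_peMl // ler1n.
have h4 : j x `^ `|s| * j x `^ (2 * `|a|) = j x `^ A by rewrite -powRD_pos.
rewrite mulrCA ler_wpM2l ?powR_ge0 // mulrCA h4.
by rewrite ler_wpM2r ?powR_ge0.
Qed.

Lemma wX_bound (s a : R) : exists C A : R, 0 <= A /\
  forall q, wX s a q <= C * (j q.1 `^ A * j q.2 `^ A).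
Proof.
have [C [A [A0 H]]] := weight_bound s a (@ler01 R); exists C, A; split => // q.
apply: H; rewrite mul1r /modX; apply: (le_trans (ler_normD _ _)).
by rewrite lerD2l ger0_norm // sqr_ge0.
Qed.

Lemma wY_bound (nu s a : R) : exists C A : R, 0 <= A /\
  forall q, wY nu s a q <= C * (j q.1 `^ A * j q.2 `^ A).
Proof.
have [C [A [A0 H]]] := weight_bound s a (normr_ge0 nu); exists C, A; split => // q.
apply: H; rewrite /modY; apply: (le_trans (ler_normD _ _)).
by rewrite lerD2l !normrM normr_id -mulrA -expr2 real_normK ?num_real.
Qed.

Lemma fourier_weighted_L2 (w : R * R -> R) (C A : R) (u : R * R -> R[i]) :
  schwartz u -> measurable_fun setT w -> (forall q, 0 <= w q) -> 0 <= A ->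
  (forall q, w q <= C * (j q.1 `^ A * j q.2 `^ A)) ->
  exists2 X : R, 0 <= X &
    (\int[lebesgue2]_q ((w q * normc (fourier u q)) ^+ 2)%:E = X%:E)%E.
Proof.
move=> su mw w0 A0 wle.
(* As [n >= A + 1], a factor [jweight 1] survives in each variable; its square [jweight 2] is
   integrable. *)
pose n := (Num.truncn A).+2.
have nA : A + 1 <= n%:R by rewrite /n -natr1 lerD2r ltW // truncnS_gt.
have [M M0 HM] := fourier_jweight_bound n su.
have mF := measurable_normc_fourier su.
have C0 : 0 <= C.
  by have := le_trans (w0 (0, 0)) (wle (0, 0)); rewrite pmulr_lge0 // mulr_gt0 ?powR_gt0.
have key (x : R) : j x `^ A * h n%:R x <= h 1 x.
  rewrite /jweight -powRD_pos //; apply: ler_powR => //.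
  by move: nA; clear; lra.
have B q : w q * normc (fourier u q) <= C * M * (h 1 q.1 * h 1 q.2).
  apply: (le_trans (ler_pM (w0 q) (normc_ge0 _) (wle q) (HM q))).
  rewrite mulrACA [X in _ * X <= _]mulrACA.
  by rewrite ler_wpM2l ?mulr_ge0 // ler_pM ?mulr_ge0 ?powR_ge0.
have hsq (x : R) : h 1 x ^+ 2 = h 2 x.
  by rewrite /jweight powR_sqr; congr (_ `^ _); lra.
have B2 q : (w q * normc (fourier u q)) ^+ 2 <= (C * M) ^+ 2 * h22 q.
  have -> : h22 q = (h 1 q.1 * h 1 q.2) ^+ 2 by rewrite exprMn !hsq.
  rewrite -[leRHS]exprMn; apply: lerXn2r (B q); rewrite nnegrE.
    by rewrite mulr_ge0 // normc_ge0.
  by apply: mulr_ge0; exact: mulr_ge0.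
have i2 : lebesgue2.-integrable setT (EFin \o (fun q => (w q * normc (fourier u q)) ^+ 2)).
  apply: (@le_integrable _ _ _ (@lebesgue2 R) setT measurableT _ _ _ _ (integrable_h22Z ((C * M) ^+ 2))).
  - by meas.
  - move=> q _ /=; rewrite lee_fin ger0_norm ?sqr_ge0 //.
    exact: le_trans (B2 q) (ler_norm _).
exists (fine (\int[lebesgue2]_q ((w q * normc (fourier u q)) ^+ 2)%:E)%E).
  by apply: fine_ge0; apply: integral_ge0 => q _; rewrite lee_fin sqr_ge0.
by rewrite fineK //; exact: (integrable_fin_num measurableT i2).
Qed.

Lemma Lnorm2_eq (f : R * R -> R) (X : R) : 0 <= X -> (forall q, 0 <= f q) ->
  (\int[lebesgue2]_q ((f q) ^+ 2)%:E = X%:E)%E ->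
  Lnorm lebesgue2 2%:E (fun q => (f q)%:E) = (Num.sqrt X)%:E.
Proof.
move=> X0 f0 fX; rewrite Lnorm.unlock.
have -> : (\int[lebesgue2]_x `|(f x)%:E| `^ 2 = X%:E)%E.
  by rewrite -fX; apply: eq_integral => q _; rewrite poweR_EFin /= ger0_norm // powR_mulrn.
by rewrite poweR_EFin powR12_sqrt.
Qed.

End fourier_decay.

(** * Fourier inversion *)

Section fourier_inversion.
Context {R : realType}.
Local Notation mu := (@lebesgue_measure R).
Local Notation mu2 := (@lebesgue2 R).
Local Notation h := (@jweight R).
Local Notation normc := ComplexField.Normc.normc.
Local Open Scope complex_scope.

(** Abel summation factor for the inversion integral; its transform is a product of two Poisson
    kernels. *)
Definition abel (e : R) (r : R * R) : R := expR (- (e * `|r.1|)) * expR (- (e * `|r.2|)).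

Lemma abel_ge0 e r : 0 <= abel e r. Proof. by rewrite mulr_ge0 // expR_ge0. Qed.

Lemma measurable_abel e : measurable_fun setT (abel e).
Proof. have mE := @measurable_expR_abs R e; by rewrite /abel; apply: measurable_funM; exact: (measurableT_comp mE). Qed.

Lemma integrable_expR_abs (e : R) : 0 < e -> mu.-integrable setT (EFin \o (fun x : R => expR (- (e * `|x|)))).
Proof.
move=> e0; have o1 (x : R) : `|(cst 1 : R -> R) x| <= 1 by rewrite /= normr1.
have := integrable_expR_abs_mul e0 (measurable_cst (1 : R)) o1.
by rewrite (_ : (fun x => _ * cst 1 x) = (fun x : R => expR (- (e * `|x|)))) //; apply/funext => x; rewrite mulr1.
Qed.

Lemma integrable_abel (e : R) : 0 < e -> mu2.-integrable setT (EFin \o abel e).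
Proof.
move=> e0; have ie := integrable_expR_abs e0.
have ee (x y : R) : `|abel e (x, y)| <= expR (- (e * `|x|)) * expR (- (e * `|y|)).
  by rewrite ger0_norm // abel_ge0.
exact: (@integrable_prod_le _ _ _ _ R mu mu (abel e) _ _ (measurable_abel e) ie ie ee).
Qed.

Definition poisson (e w : R) : R := 2 * e / (e ^+ 2 + w ^+ 2).

Lemma Rintegral_expR_trig (e w A B : R) : 0 < e ->
  \int[mu]_x (expR (- (e * `|x|)) * (A * sin (w * x) + B * cos (w * x))) = B * poisson e w.
Proof. by move=> e0; rewrite /Rintegral integral_expR_trig. Qed.

Lemma abel_kernel_transform (e a b : R) : 0 < e ->
  cint mu2 (fun r => (abel e r)%:C * expi (a * r.1 + b * r.2)) = (poisson e a * poisson e b)%:C.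
Proof.
move=> e0; have ie := integrable_expR_abs e0; have mA := measurable_abel e.
have bnd (T : R -> R) : (forall y, `|T y| <= 1) -> forall x y,
    `|abel e (x, y) * T (a * x + b * y)| <= expR (- (e * `|x|)) * expR (- (e * `|y|)).
  move=> T1 x y; rewrite normrM ger0_norm ?abel_ge0 //.
  by rewrite ler_piMr // abel_ge0.
have c1 (y : R) : `|cos y| <= 1 by rewrite ler_norml cos_geN1 cos_le1.
have s1 (y : R) : `|sin y| <= 1 by rewrite ler_norml sin_geN1 sin_le1.
have mc := continuous_measurable_fun (@continuous_cos R).
have ms := continuous_measurable_fun (@continuous_sin R).
have mph : measurable_fun setT (fun r : R * R => a * r.1 + b * r.2) by meas.
have mcc : measurable_fun setT (fun r => abel e r * cos (a * r.1 + b * r.2)).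
  by apply: measurable_funM => //; exact: (measurableT_comp mc mph).
have mss : measurable_fun setT (fun r => abel e r * sin (a * r.1 + b * r.2)).
  by apply: measurable_funM => //; exact: (measurableT_comp ms mph).
rewrite /cint.
have -> : \int[mu2]_r complex.Re ((abel e r)%:C * expi (a * r.1 + b * r.2))
    = \int[mu2]_r (abel e r * cos (a * r.1 + b * r.2)).
  by apply: eq_Rintegral => r _; rewrite ReM /= mul0r subr0.
have -> : \int[mu2]_r complex.Im ((abel e r)%:C * expi (a * r.1 + b * r.2))
    = \int[mu2]_r (abel e r * sin (a * r.1 + b * r.2)).
  by apply: eq_Rintegral => r _; rewrite ImM /= mul0r addr0.
congr Complex.
  have := @Rintegral_prod1 _ _ _ _ R mu mu _ _ _ mcc ie ie (bnd cos c1) => /= <-.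
  (* The inner integral kills the part odd in [y] and leaves [poisson e b]; the zero sine term
     brings the outer integrand into the shape of [Rintegral_expR_trig]. *)
  transitivity (\int[mu]_x (expR (- (e * `|x|)) * (0 * sin (a * x) + poisson e b * cos (a * x)))).
    apply: eq_Rintegral => x _.
    rewrite -[RHS]/(expR (- (e * `|x|)) * (0 * sin (a * x) + poisson e b * cos (a * x))).
    rewrite mul0r add0r [poisson e b * _]mulrC -(Rintegral_expR_trig b (- sin (a * x)) (cos (a * x)) e0).
    rewrite -RintegralZl //; last first.
      apply: integrable_expR_abs_mul => //; first by meas.
      by move=> y; rewrite mulNr addrC -cosD; exact: c1.
    by apply: eq_Rintegral => y _; rewrite cosD /abel /=; ring.
  by rewrite Rintegral_expR_trig // mulrC.
have := @Rintegral_prod1 _ _ _ _ R mu mu _ _ _ mss ie ie (bnd sin s1) => /= <-.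
transitivity (\int[mu]_x (expR (- (e * `|x|)) * (poisson e b * sin (a * x) + 0 * cos (a * x)))).
  apply: eq_Rintegral => x _.
  rewrite mul0r addr0 [poisson e b * _]mulrC -(Rintegral_expR_trig b (cos (a * x)) (sin (a * x)) e0).
  rewrite -RintegralZl //; last first.
    apply: integrable_expR_abs_mul => //; first by meas.
    by move=> y; rewrite addrC -sinD; exact: s1.
  by apply: eq_Rintegral => y _; rewrite sinD /abel /=; ring.
by rewrite Rintegral_expR_trig // mul0r.
Qed.

Definition cauchy2 (p : R * R) : R := (pi * (1 + p.1 ^+ 2))^-1 * (pi * (1 + p.2 ^+ 2))^-1.

Lemma cauchy2E p : cauchy2 p = pi ^- 2 * h22 p.
Proof. by rewrite /cauchy2 /h22 !jweight2E !invfM; ring. Qed.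

Lemma integrable_cauchy2 : mu2.-integrable setT (EFin \o cauchy2).
Proof. by rewrite (_ : cauchy2 = fun p => pi ^- 2 * h22 p); [exact: integrable_h22Z|apply/funext => p; exact: cauchy2E]. Qed.

Lemma Rintegral_cauchy2 : \int[mu2]_p cauchy2 p = 1.
Proof.
have ih := @integrable_jweight R 2 (ltr1n R 2).
have iN : mu.-integrable setT (EFin \o (fun x => pi ^- 2 * h 2 x)).
  by have := integrableZl measurableT (pi ^- 2) ih.
have /measurable_EFinP mC := measurable_int _ integrable_cauchy2.
have cB x y : `|cauchy2 (x, y)| <= pi ^- 2 * h 2 x * h 2 y.
  by rewrite cauchy2E ger0_norm ?mulr_ge0 ?invr_ge0 ?sqr_ge0 // -mulrA.
have one : \int[mu]_x (pi * (1 + x ^+ 2))^-1 = 1 by rewrite /Rintegral integral_cauchy_density.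
have i1 : mu.-integrable setT (EFin \o (fun x : R => (pi * (1 + x ^+ 2))^-1)).
  have := integrableZl measurableT (pi^-1) ih.
  by apply: eq_integrable => // x _ /=; rewrite jweight2E invfM.
have := @Rintegral_prod1 _ _ _ _ R mu mu cauchy2 _ _ mC iN ih cB => <-.
rewrite -[RHS]one; apply: eq_Rintegral => x _.
by rewrite /cauchy2 /= RintegralZl // one mulr1.
Qed.

(** At parameter [2 pi n] the kernel, rescaled by [n], is the Cauchy density whatever [n] is; hence
    the Abel parameters [2 * pi * harmonic n] below. *)
Lemma poisson_scale (n x : R) : 0 < n ->
  n * poisson (2 * pi * n) (2 * pi * (n * x)) = (pi * (1 + x ^+ 2))^-1.
Proof.
move=> n0; have pi0 := pi_gt0 R; have d := sqr1_gt0 x; rewrite /poisson.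
rewrite (_ : (2 * pi * n) ^+ 2 + _ = (2 * pi * n) ^+ 2 * (1 + x ^+ 2)); last by ring.
move: (1 + x ^+ 2) (pi : R) d pi0 => y P y0 P0; field.
by rewrite (gt_eqF P0) (gt_eqF n0) (gt_eqF y0).
Qed.

Lemma poissonN (e w : R) : poisson e (- w) = poisson e w.
Proof. by rewrite /poisson sqrrN. Qed.

(** Approximate identity with the density kept fixed and the argument of [g] shrinking to [p], so
    that dominated convergence applies with majorant [M * cauchy2]. *)
Lemma cauchy_average_cvg (g : R * R -> R) (M : R) (p : R * R) :
  continuous g -> measurable_fun setT g -> (forall p, `|g p| <= M) ->
  \int[mu2]_s (g (harmonic n * s.1 + p.1, harmonic n * s.2 + p.2) * cauchy2 s) @[n --> \oo] --> g p.
Proof.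
move=> cg mg gM.
have mC := measurable_int _ integrable_cauchy2; have /measurable_EFinP mC' := mC.
have C0 s : 0 <= cauchy2 s by rewrite cauchy2E mulr_ge0 ?invr_ge0 ?sqr_ge0 ?h22_ge0.
have mgn (n : nat) : measurable_fun setT (fun s : R * R => g (harmonic n * s.1 + p.1, harmonic n * s.2 + p.2)).
  have mh : measurable_fun setT (fun s : R * R => (harmonic n * s.1 + p.1, harmonic n * s.2 + p.2)) by meas.
  exact: (measurableT_comp mg mh).
have iM : mu2.-integrable setT (EFin \o (fun s => M * cauchy2 s)).
  by have := integrableZl measurableT M integrable_cauchy2.
have M0 : 0 <= M := le_trans (normr_ge0 _) (gM p).
have cv s : g (harmonic n * s.1 + p.1, harmonic n * s.2 + p.2) @[n --> \oo] --> g p.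
  have c2 (x y : R) : (harmonic n * x + y : R) @[n --> \oo] --> y.
    rewrite -[X in _ --> X]add0r; apply: cvgD; last exact: cvg_cst.
    by rewrite -[X in _ --> X](mul0r x); apply: cvgM; [exact: cvg_harmonic|exact: cvg_cst].
  case: p {mgn} => p1 p2 /=.
  exact: (cvg_comp _ _ (cvg_pair (c2 s.1 p1) (c2 s.2 p2)) (cg (p1, p2))).
have lim : (\int[mu2]_s (g (harmonic n * s.1 + p.1, harmonic n * s.2 + p.2) * cauchy2 s)%:E @[n --> \oo]
    --> \int[mu2]_s (g p * cauchy2 s)%:E)%E.
  apply: (@dominated_cvg _ _ _ mu2 setT measurableT _ _ (fun s => (M * cauchy2 s)%:E)) => //.
  - by move=> n; have mn := mgn n; meas.
  - move=> s _; apply: cvg_EFin; first exact: nearW.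
    by apply: cvgM; [exact: cv|exact: cvg_cst].
  - move=> n s _; rewrite /= lee_fin normrM (ger0_norm (C0 s)).
    by rewrite ler_wpM2r.
have ig : mu2.-integrable setT (EFin \o (fun s => g p * cauchy2 s)).
  by have := integrableZl measurableT (g p) integrable_cauchy2.
move: lim; rewrite -(fineK (integrable_fin_num measurableT ig)) => /fine_cvg.
rewrite -[fine _]/(\int[mu2]_s (g p * cauchy2 s)) RintegralZl //; last exact: integrable_cauchy2.
by rewrite Rintegral_cauchy2 mulr1.
Qed.

Lemma abel_cvg (G : R * R -> R) : mu2.-integrable setT (EFin \o G) ->
  \int[mu2]_r (abel (2 * pi * harmonic n) r * G r) @[n --> \oo] --> \int[mu2]_r G r.
Proof.
move=> iG; have /measurable_EFinP mG := measurable_int _ iG.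
have lim : (\int[mu2]_r (abel (2 * pi * harmonic n) r * G r)%:E @[n --> \oo] --> \int[mu2]_r (G r)%:E)%E.
  apply: (@dominated_cvg _ _ _ mu2 setT measurableT _ _ (fun r => `|(G r)%:E|%E)) => //.
  - by move=> n; have mA := measurable_abel (2 * pi * harmonic n); meas.
  - move=> r _; apply: cvg_EFin; first exact: nearW.
    rewrite -[X in _ --> X]mul1r; apply: cvgM; last exact: cvg_cst.
    have c1 (x : R) : expR (- (2 * pi * harmonic n * `|x|)) @[n --> \oo] --> (1 : R).
      have c0 : - (2 * pi * harmonic n * `|x|) @[n --> \oo] --> (0 : R).
        have := cvgN (cvgM (cvgM (@cvg_cst R (2 * pi) _ \oo _) (@cvg_harmonic R)) (@cvg_cst R `|x| _ \oo _)).
        by rewrite mulr0 mul0r oppr0; apply.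
      by have := cvg_comp _ _ c0 (@continuous_expR R 0); rewrite expR0.
    by rewrite -[X in _ --> X]mul1r; apply: cvgM; exact: c1.
  - exact: integrable_abse.
  - move=> n r _; rewrite /= lee_fin normrM ger0_norm ?abel_ge0 // ler_piMl //.
    have e1 (x : R) : expR (- (2 * pi * harmonic n * `|x|)) <= 1.
      rewrite -[leRHS](@expR0 R) ler_expR oppr_le0 !mulr_ge0 // ?pi_ge0 //.
      exact: harmonic_ge0.
    by rewrite -[leRHS]mul1r ler_pM // expR_ge0.
by move: lim; rewrite -(fineK (integrable_fin_num measurableT iG)) => /fine_cvg.
Qed.

End fourier_inversion.

(** * The inversion formula *)

Section inversion_formula.
Context {R : realType}.
Local Notation mu2 := (@lebesgue2 R).
Local Notation h := (@jweight R).
Local Notation normc := ComplexField.Normc.normc.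
Local Notation Re := complex.Re.
Local Notation Im := complex.Im.
Local Open Scope complex_scope.

Lemma h22_le1 p : @h22 R p <= 1.
Proof. by rewrite /h22 mulr_ile1 // jweight_le1. Qed.

Lemma fourier_h22_bound (u : R * R -> R[i]) : schwartz u ->
  exists2 M : R, 0 <= M & forall q, normc (fourier u q) <= M * h22 q.
Proof. exact: (fourier_jweight_bound 2). Qed.

Lemma schwartz_cintegrable (u : R * R -> R[i]) : schwartz u -> cintegrable mu2 u.
Proof.
move=> su; have [M _ HM] := schwartz_bound su.
by apply: (cintegrable_le _ (integrable_h22Z M)) => //; exact: schwartz_cmeasurable.
Qed.

Definition poisson2 (e : R) (p : R * R) : R := poisson e (2 * pi * p.1) * poisson e (2 * pi * p.2).

Lemma measurable_poisson (e k : R) : 0 < e -> measurable_fun setT (fun x => poisson e (k * x)).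
Proof.
move=> e0; rewrite /poisson; apply: measurable_funM; first exact: measurable_cst.
apply: continuous_measurable_fun => x.
apply: cvgV; last first.
  apply: cvgD; first exact: cvg_cst.
  have ck : k * y @[y --> x] --> k * x by apply: cvgM; [exact: cvg_cst|exact: cvg_id].
  exact: (cvgM ck ck).
by rewrite gt_eqF // ltr_pwDl ?exprn_gt0 // sqr_ge0.
Qed.

Lemma poisson_bound (e w : R) : 0 < e -> 0 <= poisson e w <= 2 / e.
Proof.
move=> e0; have d : 0 < e ^+ 2 + w ^+ 2 by rewrite ltr_pwDl ?exprn_gt0 // sqr_ge0.
rewrite /poisson divr_ge0 ?mulr_ge0 ?(ltW e0) ?(ltW d) //=.
rewrite ler_pdivrMr // mulrAC ler_pdivlMr // -mulrA -expr2.
by rewrite ler_wpM2l // lerDl sqr_ge0.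
Qed.

(** The Abel factor makes the double integral absolutely convergent; after Fubini the integral in
    [r] is a Poisson kernel at [p - x], and evenness turns it into [x - p]. *)
Lemma abel_inversion (v : R * R -> R[i]) (e : R) (p : R * R) : schwartz v -> 0 < e ->
  cint mu2 (fun r => (abel e r)%:C * (expi (phase p r) * fourier v r))
  = cint mu2 (fun x => (poisson2 e (x.1 - p.1, x.2 - p.2))%:C * v x).
Proof.
move=> sv e0; have [M M0 HM] := schwartz_bound sv.
pose E r x := (abel e r)%:C * expi (2 * pi * (p.1 - x.1) * r.1 + 2 * pi * (p.2 - x.2) * r.2).
have EE r x : (abel e r)%:C * (expi (phase p r) * (expi (- phase x r) * v x)) = E r x * v x.
  by rewrite /E !mulrA -[(abel e r)%:C * _ * _]mulrA -expiD /phase; congr (_ * expi _ * _); ring.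
have me : measurable_fun setT (abel e) := measurable_abel e.
have mE x : cmeasurable (fun r => E r x).
  apply: cmeasurableM; first exact: cmeasurable_real.
  by apply: cmeasurable_expi; meas.
have normE r x : normc (E r x) = abel e r.
  rewrite ComplexField.Normc.normcM normc_expi mulr1 /= expr0n addr0 sqrtr_sqr.
  by rewrite ger0_norm ?abel_ge0.
have iE x : cintegrable mu2 (fun r => E r x).
  by apply: (cintegrable_le _ (integrable_abel e0)) => [|r]; [exact: mE|rewrite normE].
transitivity (cint mu2 (fun r => cint mu2 (fun x => E r x * v x))).
  apply: eq_cint => r; rewrite fourierE -!cintZl.
  - by apply: eq_cint => x; exact: EE.
  - have := schwartz_cintegrable_expi sv (measurable_phasel r).
    have mp : measurable_fun setT (fun x => phase p r - phase x r) by rewrite /phase; meas.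
    have := schwartz_cintegrable_expi sv mp.
    by under eq_fun do rewrite expiD -mulrA.
  - exact: schwartz_cintegrable_expi sv (measurable_phasel r).
have mEv : cmeasurable (fun z : (R * R) * (R * R) => E z.1 z.2 * v z.2).
  apply: cmeasurableM; last exact: (cmeasurable_comp (schwartz_cmeasurable sv) measurable_snd).
  apply: cmeasurableM; first exact: (cmeasurable_comp (cmeasurable_real me) measurable_fst).
  by apply: cmeasurable_expi; meas.
have bE r x : normc (E r x * v x) <= abel e r * (M * h22 x).
  by rewrite ComplexField.Normc.normcM normE ler_wpM2l // abel_ge0.
rewrite (@cint_fubini _ _ _ _ R mu2 mu2 _ _ _ mEv (integrable_abel e0) (integrable_h22Z M) bE).
apply: eq_cint => x /=.
transitivity (cint mu2 (fun r => v x * E r x)).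
  by apply: eq_cint => r; rewrite mulrC.
rewrite cintZl // /E abel_kernel_transform // mulrC /poisson2 /=.
congr (_%:C * _); congr (_ * _).
  by rewrite -[in LHS]poissonN; congr poisson; ring.
by rewrite -[in LHS]poissonN; congr poisson; ring.
Qed.

(** The Jacobian [k ^ 2] of the substitution [x = k s + p] supplies the factor [k] that
    [poisson_scale] asks for in each coordinate. *)
Lemma poisson_average (g : R * R -> R) (M : R) (p : R * R) (k : R) : (forall x, `|g x| <= M) ->
  mu2.-integrable setT (EFin \o g) -> 0 < k ->
  \int[mu2]_x (poisson2 (2 * pi * k) (x.1 - p.1, x.2 - p.2) * g x)
  = \int[mu2]_s (g (k * s.1 + p.1, k * s.2 + p.2) * cauchy2 s).
Proof.
move=> gM ig k0; have /measurable_EFinP mg := measurable_int _ ig.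
have e0 : 0 < 2 * pi * k by rewrite !mulr_gt0 // pi_gt0.
have mP := measurable_poisson (2 * pi) e0.
have mP2 : measurable_fun setT (fun x : R * R => poisson2 (2 * pi * k) (x.1 - p.1, x.2 - p.2)).
  have m1 : measurable_fun setT (fun x : R * R => x.1 - p.1) by meas.
  have m2 : measurable_fun setT (fun x : R * R => x.2 - p.2) by meas.
  by apply: measurable_funM; [exact: (measurableT_comp mP m1)|exact: (measurableT_comp mP m2)].
pose B := (2 / (2 * pi * k)) * (2 / (2 * pi * k)) : R.
have iB : mu2.-integrable setT (EFin \o (fun x => B * g x)).
  by have := integrableZl measurableT B ig.
have iF : mu2.-integrable setT (EFin \o (fun x => poisson2 (2 * pi * k) (x.1 - p.1, x.2 - p.2) * g x)).
  apply: (@le_integrable _ _ _ mu2 setT measurableT _ _ _ _ iB); first by meas.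
  move=> x _ /=; rewrite lee_fin normrM [leRHS]normrM ler_wpM2r //.
  have /andP[a0 a1] := poisson_bound (2 * pi * (x.1 - p.1)) e0.
  have /andP[b0 b1] := poisson_bound (2 * pi * (x.2 - p.2)) e0.
  have B0 : 0 <= 2 / (2 * pi * k) := le_trans a0 a1.
  rewrite ger0_norm; last exact: (mulr_ge0 a0 b0).
  by rewrite ger0_norm; [exact: (ler_pM a0 b0 a1 b1)|exact: (mulr_ge0 B0 B0)].
pose H s := g (k * s.1 + p.1, k * s.2 + p.2) * cauchy2 s.
have iH : mu2.-integrable setT (EFin \o H).
  have iM : mu2.-integrable setT (EFin \o (fun s => M * cauchy2 s)).
    by have := integrableZl measurableT M (@integrable_cauchy2 R).
  have /measurable_EFinP mC := measurable_int _ (@integrable_cauchy2 R).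
  have mH : measurable_fun setT H.
    have ma : measurable_fun setT (fun s : R * R => (k * s.1 + p.1, k * s.2 + p.2)) by meas.
    by apply: measurable_funM => //; exact: (measurableT_comp mg ma).
  apply: (@le_integrable _ _ _ mu2 setT measurableT _ _ _ _ iM); first exact/measurable_EFinP.
  by move=> s _ /=; rewrite lee_fin !normrM ler_wpM2r // (le_trans (gM _)) // ler_norm.
rewrite -/(Rintegral mu2 setT H) /Rintegral (integral_affine2 p.1 p.2 k0 iF).
transitivity (fine ((k ^+ 2)%:E * \int[mu2]_s ((k ^- 2)%:E * (H s)%:E))%E).
  congr (fine (_ * _)%E); apply: eq_integral => s _ /=.
  rewrite -EFinM /H !addrK /poisson2 /= /cauchy2 -!(poisson_scale _ k0); congr _%:E.
  move: (g _) (poisson _ _) (poisson _ _) => x y z; field; exact: lt0r_neq0.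
rewrite (integralZl measurableT iH) muleA -EFinM divff ?mul1e //.
by rewrite expf_neq0 // lt0r_neq0.
Qed.

(** The Abel means of the inversion integral tend to it by [abel_cvg]; they are also averages of [v]
    against a concentrating kernel and tend to [v p]. Limits are compared separately in the real and
    the imaginary parts. *)
Theorem fourier_inversion (v : R * R -> R[i]) (p : R * R) : schwartz v ->
  v p = cint mu2 (fun r => expi (phase p r) * fourier v r).
Proof.
move=> sv; have [M M0 HM] := schwartz_bound sv; have [N N0 HN] := fourier_h22_bound sv.
set G := fun r => _.
have mG : cmeasurable G.
  apply: cmeasurableM; last exact: cmeasurable_fourier.
  by apply: cmeasurable_expi; rewrite /phase; meas.
have [iGr iGi] : cintegrable mu2 G.
  apply: (cintegrable_le _ (integrable_h22Z N)); first exact: mG.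
  move=> r;   by rewrite ComplexField.Normc.normcM normc_expi mul1r.
have [ivr ivi] := schwartz_cintegrable sv.
have e0 n : 0 < 2 * pi * (harmonic n : R) by rewrite !mulr_gt0 ?pi_gt0 ?harmonic_gt0.
have inv n := abel_inversion p sv (e0 n).
have vM x : normc (v x) <= M.
  by apply: (le_trans (HM x)); rewrite ler_piMr // h22_le1.
have [cr ci] : continuous (fun p => Re (v p)) /\ continuous (fun p => Im (v p)).
  by split; apply: real_schwartz_continuous; case: sv.
have [mr mi] := schwartz_cmeasurable sv.
have bR x : `|Re (v x)| <= M := le_trans (Re_le_normc _) (vM x).
have bI x : `|Im (v x)| <= M := le_trans (Im_le_normc _) (vM x).
apply/eqP; rewrite eq_complex; apply/andP; split; apply/eqP.
  have cA := abel_cvg iGr; have cB := cauchy_average_cvg (p := p) cr mr bR.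
  set A := fun n => _ in cA; set B := fun n => _ in cB.
  suff AB : A = B by rewrite AB in cA; exact: (@cvg_unique R (@norm_hausdorff _ R) _ _ _ _ cB cA).
  apply/funext => n; rewrite /A /B.
  rewrite -(poisson_average p bR ivr (harmonic_gt0 n)).
  transitivity (Re (cint mu2 (fun r => (abel (2 * pi * harmonic n) r)%:C * G r))).
    by apply: eq_Rintegral => r _; rewrite ReM /= mul0r subr0.
  by rewrite inv; apply: eq_Rintegral => x _; rewrite ReM /= mul0r subr0.
have cA := abel_cvg iGi; have cB := cauchy_average_cvg (p := p) ci mi bI.
set A := fun n => _ in cA; set B := fun n => _ in cB.
suff AB : A = B by rewrite AB in cA; exact: (@cvg_unique R (@norm_hausdorff _ R) _ _ _ _ cB cA).
apply/funext => n; rewrite /A /B.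
rewrite -(poisson_average p bI ivi (harmonic_gt0 n)).
transitivity (Im (cint mu2 (fun r => (abel (2 * pi * harmonic n) r)%:C * G r))).
  by apply: eq_Rintegral => r _; rewrite ImM /= mul0r addr0.
by rewrite inv; apply: eq_Rintegral => x _; rewrite ImM /= mul0r addr0.
Qed.

End inversion_formula.

(** * The transform of a product as a convolution *)

Section fourier_of_product.
Context {R : realType}.
Local Notation mu2 := (@lebesgue2 R).
Local Notation normc := ComplexField.Normc.normc.
Local Open Scope complex_scope.

(** With [v] replaced by its inversion integral, the phases at [q] and [r] combine into the phase at
    [q - r], and the inner integral is the transform of [u]. *)
Lemma fourierM (u v : R * R -> R[i]) q : schwartz u -> schwartz v ->
  fourier (fun p => u p * v p) q
  = cint mu2 (fun r => fourier u (q.1 - r.1, q.2 - r.2) * fourier v r).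
Proof.
move=> su sv; have [M _ HM] := schwartz_bound su; have [N _ HN] := fourier_h22_bound sv.
have mFv := cmeasurable_fourier sv.
have iV x : cintegrable mu2 (fun r => expi (phase x r) * fourier v r).
  apply: (cintegrable_le _ (integrable_h22Z N)).
    apply: cmeasurableM; last exact: mFv.
    by apply: cmeasurable_expi; rewrite /phase; meas.
  by move=> r; rewrite ComplexField.Normc.normcM normc_expi mul1r.
pose F (z : (R * R) * (R * R)) :=
  (expi (- phase z.1 (q.1 - z.2.1, q.2 - z.2.2)) * u z.1) * fourier v z.2.
have mF : cmeasurable F.
  apply: cmeasurableM; last exact: (cmeasurable_comp mFv measurable_snd).
  apply: cmeasurableM; last exact: (cmeasurable_comp (schwartz_cmeasurable su) measurable_fst).
  by apply: cmeasurable_expi; rewrite /phase /=; meas.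
have bF x r : normc (F (x, r)) <= M * h22 x * (N * h22 r).
  rewrite /F !ComplexField.Normc.normcM normc_expi mul1r.
  by apply: ler_pM; [exact: normc_ge0|exact: normc_ge0|exact: HM|exact: HN].
transitivity (cint mu2 (fun x => cint mu2 (fun r => F (x, r)))).
  rewrite fourierE; apply: eq_cint => x.
  rewrite {1}(fourier_inversion x sv) mulrA -cintZl; last exact: iV.
  apply: eq_cint => r; rewrite /F /= !mulrA; congr (_ * _).
  rewrite mulrAC -expiD; congr (expi _ * _).
  by rewrite /phase /=; ring.
rewrite (@cint_fubini _ _ _ _ R mu2 mu2 _ _ _ mF (integrable_h22Z M) (integrable_h22Z N) bF).
apply: eq_cint => r; rewrite /F /=.
transitivity (cint mu2 (fun x => fourier v r * (expi (- phase x (q.1 - r.1, q.2 - r.2)) * u x))).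
  by apply: eq_cint => x; rewrite mulrC.
rewrite cintZl; last exact: (schwartz_cintegrable_expi su (measurable_phasel _)).
by rewrite mulrC.
Qed.

Lemma le_normc_fourierM (u v : R * R -> R[i]) q : schwartz u -> schwartz v ->
  ((normc (fourier (fun p => (u p * v p)%R) q))%:E
   <= \int[mu2]_r (normc (fourier u (q.1 - r.1, q.2 - r.2)) * normc (fourier v r))%:E)%E.
Proof.
move=> su sv; rewrite fourierM //.
have [M _ HM] := fourier_h22_bound su; have [N N0 HN] := fourier_h22_bound sv.
have M0 : 0 <= M by have := le_trans (normc_ge0 _) (HM (0, 0)); rewrite pmulr_lge0 // /h22 mulr_gt0 // jweight_gt0.
have mh : measurable_fun setT (fun r : R * R => (q.1 - r.1, q.2 - r.2)) by meas.
have iF : cintegrable mu2 (fun r => fourier u (q.1 - r.1, q.2 - r.2) * fourier v r).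
  apply: (cintegrable_le _ (integrable_h22Z (M * N))).
    apply: cmeasurableM; last exact: cmeasurable_fourier.
    exact: (cmeasurable_comp (cmeasurable_fourier su) mh).
  move=> r; rewrite ComplexField.Normc.normcM -mulrA.
  apply: ler_pM; [exact: normc_ge0|exact: normc_ge0| |exact: HN].
  by apply: (le_trans (HM _)); rewrite ler_piMr // h22_le1.
apply: (le_trans (le_normc_cint iF)); rewrite le_eqVlt; apply/orP; left; apply/eqP.
by apply: eq_integral => r _; rewrite ComplexField.Normc.normcM.
Qed.

End fourier_of_product.

(** * Completions *)

Lemma real_cauchy_cvg (R : realType) (a : R ^nat) :
  (forall e : R, 0 < e -> exists n0 : nat, forall m n : nat,
    (n0 <= m)%N -> (n0 <= n)%N -> `|a m - a n| < e) -> cvg (a @ \oo).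
Proof.
move=> H; apply/cauchy_cvgP/cauchy_exP => e e0; have [n0 H0] := H e e0.
exists (a n0); exists n0 => // n /= n0n; rewrite /ball /=; exact: H0.
Qed.

Section completions.
Context {R : realType}.
Implicit Types (N : (R * R -> R[i]) -> \bar R) (f g k : R * R -> R[i]).

(** What the extension by continuity uses of a norm, expressed through differences of Schwartz
    functions. *)
Definition schwartz_seminorm N := [/\
  forall f, schwartz f -> 0 <= N f < +oo,
  forall f g, schwartz f -> schwartz g -> N (fun p => f p - g p)%R = N (fun p => g p - f p)%R &
  forall f g, schwartz f -> schwartz g -> N f <= N g + N (fun p => f p - g p)%R]%E.

Section seminorm.
Context N (sN : schwartz_seminorm N).
Local Notation nr f := (fine (N f)).
Local Notation sub f g := (fun p => f p - g p).

Lemma seminorm_fin f : schwartz f -> N f = (nr f)%:E.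
Proof. by case: sN => H _ _ /H /andP[H0 H1]; rewrite fineK // ge0_fin_numE. Qed.

Lemma seminorm_ge0 f : schwartz f -> 0 <= nr f.
Proof. by case: sN => H _ _ /H /andP[H0 H1]; exact: fine_ge0. Qed.

Lemma seminorm_sym f g : schwartz f -> schwartz g -> nr (sub f g) = nr (sub g f).
Proof. by case: sN => _ H _ sf sg; rewrite H. Qed.

Lemma seminorm_le f g : schwartz f -> schwartz g -> nr f <= nr g + nr (sub f g).
Proof.
case: sN => _ _ H sf sg; have sb := schwartzB sf sg; have := H f g sf sg.
by rewrite (seminorm_fin sf) (seminorm_fin sg) (seminorm_fin sb) -EFinD lee_fin.
Qed.

Lemma seminorm_dist f g : schwartz f -> schwartz g -> `|nr f - nr g| <= nr (sub f g).
Proof.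
move=> sf sg; have := seminorm_le sf sg; have := seminorm_le sg sf.
rewrite [nr (sub g f)]seminorm_sym // ler_norml; lra.
Qed.

Lemma seminorm_triangle f g k : schwartz f -> schwartz g -> schwartz k ->
  nr (sub f g) <= nr (sub f k) + nr (sub k g).
Proof.
move=> sf sg sk; have := seminorm_le (schwartzB sf sg) (schwartzB sf sk).
suff -> : (fun p => sub f g p - sub f k p) = sub k g by [].
by apply/funext => p; rewrite opprB addrC addrA subrK.
Qed.

Variable x : completion N.

Lemma completion_cauchy (e : R) : 0 < e -> exists n0 : nat, forall m n : nat,
  (n0 <= m)%N -> (n0 <= n)%N -> nr (sub (x m) (x n)) < e.
Proof.
move=> /(cseq_cauchy x)[n0 H]; exists n0 => m n /H/[apply].
by rewrite seminorm_fin ?lte_fin //; apply: schwartzB; exact: cseq_schwartz.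
Qed.

Lemma cvg_completion_norm : nr (x n) @[n --> \oo] --> fine (completion_norm x) /\
  completion_norm x = (fine (completion_norm x))%:E.
Proof.
have c : cvg (nr (x n) @[n --> \oo]).
  apply: real_cauchy_cvg => e /completion_cauchy[n0 H]; exists n0 => m n m0 n1.
  apply: le_lt_trans (H m n m0 n1).
  by apply: seminorm_dist; exact: cseq_schwartz.
have -> : completion_norm x = (limn (fun n => nr (x n)))%:E.
  rewrite -EFin_lim //; congr (limn _); apply/funext => n.
  by rewrite /= -seminorm_fin //; exact: cseq_schwartz.
by [].
Qed.

(** Real-valued form of the inner limit in [tends_in_completion]; it exists for Schwartz [f] because
    the distances to the members of a Cauchy sequence are themselves Cauchy. *)
Definition completion_dist f : R := limn (fun m => nr (sub f (x m))).

Lemma cvg_completion_dist f : schwartz f ->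
  nr (sub f (x m)) @[m --> \oo] --> completion_dist f.
Proof.
move=> sf; apply: real_cauchy_cvg => e /completion_cauchy[n0 H]; exists n0 => m n m0 n1.
apply: le_lt_trans (H n m n1 m0).
have sm := cseq_schwartz x m; have sn := cseq_schwartz x n.
apply: le_trans (seminorm_dist (schwartzB sf sm) (schwartzB sf sn)) _.
suff -> : (fun p => sub f (x m) p - sub f (x n) p) = sub (x n) (x m) by [].
by apply/funext => p; rewrite opprB addrC addrA subrK.
Qed.

Lemma completion_distE f : schwartz f ->
  limn (fun m => N (sub f (x m))) = (completion_dist f)%:E.
Proof.
move=> sf; rewrite -EFin_lim; last exact: cvg_completion_dist.
congr (limn _); apply/funext => m.
by rewrite /= -seminorm_fin //; apply: schwartzB => //; exact: cseq_schwartz.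
Qed.

Lemma tends_in_completionP (f : nat -> R * R -> R[i]) : (forall n, schwartz (f n)) ->
  tends_in_completion f x <-> completion_dist (f n) @[n --> \oo] --> 0.
Proof.
move=> sf; rewrite /tends_in_completion.
have -> : (fun n => limn (fun m => N (sub (f n) (x m)))) = (fun n => (completion_dist (f n))%:E).
  by apply/funext => n; exact: completion_distE.
split=> [|H]; first by move/fine_cvg.
by apply: cvg_EFin => //; exact: nearW.
Qed.

Lemma completion_bounded : exists2 A : R, 0 < A & forall n, nr (x n) <= A.
Proof.
have [c _] := cvg_completion_norm.
have [A [_ HA]] := cvg_seq_bounded (cvgP _ c).
exists (`|A| + 1) => [|n]; first by rewrite ltr_wpDl.
apply: le_trans (ler_norm _) _; apply: HA => //.
by rewrite (le_lt_trans (ler_norm A)) // ltrDl.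
Qed.

End seminorm.

(** The product is represented by the termwise product of the two given sequences. Bilinearity and
    boundedness make it Cauchy, and the same difference estimate compares it with any other
    approximating sequences. *)
Lemma product_in_completions N1 N2 N3 (C : R) :
  schwartz_seminorm N1 -> schwartz_seminorm N2 -> schwartz_seminorm N3 -> 0 <= C ->
  (forall f g, schwartz f -> schwartz g ->
    (N3 (fun p => (f p * g p)%R) <= C%:E * N1 f * N2 g)%E) ->
  forall (u : completion N1) (v : completion N2), exists w : completion N3,
    is_product u v w /\ (completion_norm w <= C%:E * completion_norm u * completion_norm v)%E.
Proof.
move=> s1 s2 s3 C0 H u v.
have su n := cseq_schwartz u n; have sv n := cseq_schwartz v n.
have bil f g : schwartz f -> schwartz g ->
    fine (N3 (fun p => f p * g p)) <= C * fine (N1 f) * fine (N2 g).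
  move=> sf sg; have := H f g sf sg.
  by rewrite (seminorm_fin s1 sf) (seminorm_fin s2 sg) (seminorm_fin s3 (schwartzM sf sg)) -!EFinM lee_fin.
(* Telescoping through [f' g]: the difference is [(f - f') g + f' (g - g')]. *)
have dif f g f' g' : schwartz f -> schwartz g -> schwartz f' -> schwartz g' ->
    fine (N3 (fun p => f p * g p - f' p * g' p)) <=
      C * fine (N1 (fun p => f p - f' p)) * fine (N2 g) +
      C * fine (N1 f') * fine (N2 (fun p => g p - g' p)).
  move=> sf sg sf' sg'.
  apply: le_trans (seminorm_triangle s3 (schwartzM sf sg) (schwartzM sf' sg') (schwartzM sf' sg)) _.
  have := bil _ _ (schwartzB sf sf') sg; have := bil _ _ sf' (schwartzB sg sg').
  under [X in fine (N3 X) <= _ -> _]funext => p do rewrite mulrBr.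
  under [X in _ -> fine (N3 X) <= _ -> _]funext => p do rewrite mulrBl.
  by move=> h1 h2; rewrite lerD.
have [A A0 HA] := completion_bounded s1 u; have [B B0 HB] := completion_bounded s2 v.
have cw (e : R) : 0 < e -> exists n0 : nat, forall m n : nat, (n0 <= m)%N -> (n0 <= n)%N ->
    (N3 (fun p => u m p * v m p - u n p * v n p)%R < e%:E)%E.
  move=> e0.
  have d0 : 0 < e / (C * B + C * A + 1).
    by rewrite divr_gt0 // ltr_wpDl // addr_ge0 // mulr_ge0 // ltW.
  have [n1 H1] := completion_cauchy s1 u d0; have [n2 H2] := completion_cauchy s2 v d0.
  exists (maxn n1 n2) => m n; rewrite !geq_max => /andP[m1 m2] /andP[k1 k2].
  rewrite (seminorm_fin s3 (schwartzB (schwartzM (su m) (sv m)) (schwartzM (su n) (sv n)))) lte_fin.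
  apply: le_lt_trans (dif _ _ _ _ (su m) (sv m) (su n) (sv n)) _.
  have K0 : 0 < C * B + C * A + 1 by rewrite ltr_wpDl // addr_ge0 // mulr_ge0 // ltW.
  apply: (@le_lt_trans _ _ (e / (C * B + C * A + 1) * (C * B + C * A))); last first.
    by rewrite mulrAC ltr_pdivrMr // ltr_pM2l // ltrDl.
  rewrite mulrDr; apply: lerD.
    have h := ler_pM (seminorm_ge0 s1 (schwartzB (su m) (su n))) (seminorm_ge0 s2 (sv m)) (ltW (H1 m n m1 k1)) (HB m).
    by rewrite -mulrA [leRHS]mulrCA ler_wpM2l.
  have h := ler_pM (seminorm_ge0 s1 (su n)) (seminorm_ge0 s2 (schwartzB (sv m) (sv n))) (HA n) (ltW (H2 m n m2 k2)).
  by rewrite -mulrA [leRHS]mulrC -[leRHS]mulrA ler_wpM2l.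
pose w := Completion (fun n => schwartzM (su n) (sv n)) cw.
exists w; split; last first.
  have [c1 ->] := cvg_completion_norm s1 u; have [c2 ->] := cvg_completion_norm s2 v.
  have [c3 ->] := cvg_completion_norm s3 w; rewrite -!EFinM lee_fin.
  apply: (ler_cvg_to c3 (cvgM (cvgM (cvg_cst C) c1) c2)).
  by apply: nearW => n; exact: bil.
move=> f g sf sg; rewrite (tends_in_completionP s1 u) // (tends_in_completionP s2 v) // => fu gv.
apply/(tends_in_completionP s3 w) => [n|]; first exact: schwartzM.
(* The norm of [g n] is at most [B], which bounds every [v m], plus the distance from [g n] to
   [v m]; the limit in [m] yields the stated bound. *)
have D n : completion_dist w (fun p => f n p * g n p)
    <= C * completion_dist u (f n) * (B + completion_dist v (g n)) + C * A * completion_dist v (g n).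
  have c1 := cvg_completion_dist s1 (x := u) (sf n); have c2 := cvg_completion_dist s2 (x := v) (sg n).
  have c3 := cvg_completion_dist s3 (x := w) (schwartzM (sf n) (sg n)).
  apply: (ler_cvg_to c3 (cvgD (cvgM (cvgM (cvg_cst C) c1) (cvgD (cvg_cst B) c2)) (cvgM (cvg_cst (C * A)) c2))).
  apply: nearW => m; apply: le_trans (dif _ _ _ _ (sf n) (sg n) (su m) (sv m)) _.
  rewrite lerD //.
    apply: ler_wpM2l; first by rewrite mulr_ge0 ?seminorm_ge0 //; apply: schwartzB.
    apply: le_trans (seminorm_le s2 (sg n) (sv m)) _.
    by rewrite lerD2r.
  apply: ler_wpM2r; first by apply: seminorm_ge0 => //; exact: schwartzB.
  exact: ler_wpM2l.
have D0 n : 0 <= completion_dist w (fun p => f n p * g n p).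
  have c3 := cvg_completion_dist s3 (x := w) (schwartzM (sf n) (sg n)).
  apply: limr_ge; first exact: cvgP c3.
  apply: nearW => m; apply: seminorm_ge0 => //; apply: schwartzB; exact: schwartzM.
pose bound n := C * completion_dist u (f n) * (B + completion_dist v (g n)) + C * A * completion_dist v (g n).
have b0 : bound n @[n --> \oo] --> (0 : R).
  have := cvgD (cvgM (cvgM (@cvg_cst R C _ \oo _) fu) (cvgD (@cvg_cst R B _ \oo _) gv)) (cvgM (@cvg_cst R (C * A) _ \oo _) gv).
  by rewrite !mulr0 mul0r addr0; apply.
apply: (squeeze_cvgr _ (@cvg_cst R 0 _ \oo _) b0).
by apply: nearW => n /=; rewrite D0 D.
Qed.

End completions.

(** * The product estimate *)

Section weighted_norms.
Context {R : realType}.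
Local Notation mu2 := (@lebesgue2 R).
Local Notation normc := ComplexField.Normc.normc.
Local Notation j := (@japanese R).

Lemma le_Lnorm2 (f g : R * R -> R) : measurable_fun setT f -> measurable_fun setT g ->
  (forall q, 0 <= f q) -> (forall q, f q <= g q) ->
  (Lnorm mu2 2%:E (fun q => (f q)%:E) <= Lnorm mu2 2%:E (fun q => (g q)%:E))%E.
Proof.
move=> mf mg f0 fg; rewrite Lnorm.unlock.
have E (k : R * R -> R) : (forall q, 0 <= k q) ->
    (\int[mu2]_x `|(k x)%:E| `^ 2 = \int[mu2]_x (k x ^+ 2)%:E)%E.
  by move=> k0; apply: eq_integral => q _; rewrite poweR_EFin /= ger0_norm // powR_mulrn.
have g0 q : 0 <= g q := le_trans (f0 q) (fg q).
rewrite !E //.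
have I0 (k : R * R -> R) : (0 <= \int[mu2]_x (k x ^+ 2)%:E)%E.
  by apply: integral_ge0 => q _; rewrite lee_fin sqr_ge0.
have L : (\int[mu2]_x (f x ^+ 2)%:E <= \int[mu2]_x (g x ^+ 2)%:E)%E.
  apply: ge0_le_integral => //.
  - by move=> q _; rewrite lee_fin sqr_ge0.
  - by meas.
  - by meas.
  - by move=> q _; rewrite lee_fin lerXn2r ?nnegrE.
by apply: gt0_ler_poweR L; rewrite ?invr_ge0 // in_itv /= I0 leey.
Qed.

(** [normX] and [normY] are instances up to conversion, with the weights [wX] and [wY]. *)
Definition weighted_norm (w : R * R -> R) (f : R * R -> R[i]) : \bar R :=
  Lnorm mu2 2%:E (fun q => (w q * normc (fourier f q))%:E).

(** Finiteness comes from the decay of the transform against the polynomially bounded weight; the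
    triangle inequality is Minkowski's. *)
Lemma weighted_norm_seminorm (w : R * R -> R) : measurable_fun setT w -> (forall q, 0 <= w q) ->
  (exists C A : R, 0 <= A /\ forall q, w q <= C * (j q.1 `^ A * j q.2 `^ A)) ->
  schwartz_seminorm (weighted_norm w).
Proof.
move=> mw w0 [C [A [A0 HA]]].
have mF f : schwartz f -> measurable_fun setT (fun q => w q * normc (fourier f q)).
  by move=> sf; have m := measurable_normc_fourier sf; meas.
have F0 f q : 0 <= w q * normc (fourier f q) by rewrite mulr_ge0 // normc_ge0.
split=> [f sf|f g sf sg|f g sf sg].
- have [X X0 HX] := fourier_weighted_L2 sf mw w0 A0 HA.
  by rewrite /weighted_norm (Lnorm2_eq X0 (F0 f) HX) lee_fin sqrtr_ge0 ltry.
- apply: eq_Lnorm => q; rewrite !fourierB // -normcN.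
  by congr (_ * normc _)%:E; exact: opprB.
have sfg := schwartzB sf sg.
apply: (@le_trans _ _ (Lnorm mu2 2%:E (fun q => (w q * normc (fourier g q)
    + w q * normc (fourier (fun p => f p - g p) q))%:E))).
  apply: le_Lnorm2 => //; first exact: mF.
  - by apply: measurable_funD; exact: mF.
  move=> q; rewrite -mulrDr ler_wpM2l // fourierB //.
  apply: le_trans (le_normcD _ _); rewrite [in leRHS]addrC.
  by rewrite -[fourier f q in leLHS](subrK (fourier g q)).
by apply: (@minkowski_EFin _ _ R mu2 _ _ 2 (mF g sg) (mF _ sfg)); rewrite ler1n.
Qed.

End weighted_norms.

Section product_estimate.
Context {R : realType}.
Variables (nu s s' b b' c : R).
Hypotheses (hnu : `|nu| != 1) (hs : 0 <= s) (hs' : - (1 / 2) <= s').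
Hypotheses (hb : 1 / 2 < b) (hb' : 1 / 2 < b') (hc : 1 / 2 < c) (hc1 : c < 1).
Hypothesis hss : s - s' <= 2 * (1 - c).

Lemma schwartz_product_estimate : exists2 C : R, 0 < C &
  forall u v : R * R -> R[i], schwartz u -> schwartz v ->
  (normX s (c - 1) (fun p => (u p * v p)%R) <= C%:E * normX s b u * normY nu s' b' v)%E.
Proof.
have [C C0 HC] := bilinear_weighted hnu hs hs' hb hb' hc hc1 hss.
(* The bilinear estimate compares squares of the norms. *)
exists (Num.sqrt C) => [|u v su sv]; first by rewrite sqrtr_gt0.
have suv := schwartzM su sv.
have [C1 [A1 [A10 H1]]] := wX_bound s (c - 1).
have [C2 [A2 [A20 H2]]] := wX_bound s b.
have [C3 [A3 [A30 H3]]] := wY_bound nu s' b'.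
have wX0 a q : 0 <= wX s a q := ltW (wX_gt0 s a q).
have wY0 q : 0 <= wY nu s' b' q := ltW (wY_gt0 nu s' b' q).
have [X X0 HX] := fourier_weighted_L2 suv (measurable_wX s (c - 1)) (wX0 _) A10 H1.
have [A A0 HA] := fourier_weighted_L2 su (measurable_wX s b) (wX0 _) A20 H2.
have [B B0 HB] := fourier_weighted_L2 sv (measurable_wY nu s' b') wY0 A30 H3.
have -> : normX s (c - 1) (fun p => u p * v p) = (Num.sqrt X)%:E.
  by apply: (Lnorm2_eq X0 _ HX) => q; rewrite mulr_ge0 // normc_ge0.
have -> : normX s b u = (Num.sqrt A)%:E.
  by apply: (Lnorm2_eq A0 _ HA) => q; rewrite mulr_ge0 // normc_ge0.
have -> : normY nu s' b' v = (Num.sqrt B)%:E.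
  by apply: (Lnorm2_eq B0 _ HB) => q; rewrite mulr_ge0 // normc_ge0.
rewrite -!EFinM lee_fin -!sqrtrM ?mulr_ge0 ?(ltW C0) //; apply: ler_wsqrtr.
apply: (HC _ _ _ X A B (measurable_normc_fourier suv) (measurable_normc_fourier su)
  (measurable_normc_fourier sv) _ _ _ _ HX HA HB).
- by move=> q; exact: normc_ge0.
- by move=> q; exact: normc_ge0.
- by move=> q; exact: normc_ge0.
- by move=> q; exact: le_normc_fourierM.
Qed.

End product_estimate.

Theorem theorem2p3 (R : realType) (nu : R) (hnu : `|nu| <> 1)
  (s s' : R) (hs : 0 <= s) (hs' : - (1 / 2) <= s') (hss' : s - 1 < s')
  (b b' c : R) (hb : 1 / 2 < b) (hb' : 1 / 2 < b') (hc : 1 / 2 < c)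
  (hc' : c < Num.min (3 / 4) ((s' - s) / 2 + 1)) :
  exists C : R, 0 < C /\
    (forall u v : R * R -> R[i], schwartz u -> schwartz v ->
       (normX s (c - 1) (fun p => (u p * v p)%R)
          <= C%:E * normX s b u * normY nu s' b' v)%E) /\
    (forall (u : completion (normX s b)) (v : completion (normY nu s' b')),
       exists w : completion (normX s (c - 1)),
         is_product u v w /\
         (completion_norm w
            <= C%:E * completion_norm u * completion_norm v)%E).
Proof.
move: hc'; rewrite lt_min => /andP[c34 cs].
have c1 : c < 1 by lra.
have ss : s - s' <= 2 * (1 - c) by lra.
have nu1 : `|nu| != 1 by apply/eqP.
have [C C0 HC] := schwartz_product_estimate nu1 hs hs' hb hb' hc c1 ss.
have sX a : schwartz_seminorm (normX s a : (R * R -> R[i]) -> \bar R).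
  apply: (weighted_norm_seminorm (measurable_wX s a)); last exact: wX_bound.
  by move=> q; rewrite ltW // wX_gt0.
have sY : schwartz_seminorm (normY nu s' b' : (R * R -> R[i]) -> \bar R).
  apply: (weighted_norm_seminorm (measurable_wY nu s' b')); last exact: wY_bound.
  by move=> q; rewrite ltW // wY_gt0.
exists C; split; [exact: C0|split; first exact: HC].
exact: (product_in_completions (sX b) sY (sX (c - 1)) (ltW C0) HC).
Qed.
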